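(* Let $n\ge 1$ be an integer, $m\ge 0$ a real number, and let $1<p\le p_T(n,m)$ (that is, $1<p<\infty$ if $n=1$), where $$p_T(n,m):=\begin{cases}1+\dfrac{2}{(m+1)(n-1)-m} & \text{if } n\ge 2,\\ +\infty & \text{if } n=1.\end{cases}$$ Assume that $f\in H^1(\mathbb{R}^n)$ and $g\in H^{1-\frac{1}{m+1}}(\mathbb{R}^n)$ satisfy $\operatorname{supp}(f,g)\subset\{x\in\mathbb{R}^n:|x|\le 1\}$ and that the function $$a(m)f+g,\qquad a(m):=[2(m+1)]^{\frac{m}{m+1}}\,\Gamma\left(\frac12+\frac{m}{2(m+1)}\right)\Gamma\left(\frac12-\frac{m}{2(m+1)}\right)^{-1},$$ is non-negative and not identically vanishing. Suppose that $u$ is an energy solution on $[0,T)$ of the Cauchy problem $$u_{tt}-t^{2m}\Delta u=|u_t|^p\ \text{ in } [0,T)\times\mathbb{R}^n,\qquad u(0,x)=\varepsilon f(x),\quad u_t(0,x)=\varepsilon g(x),\quad x\in\mathbb{R}^n,$$ with compact support in the ''cone'' $$\operatorname{supp}u\subset\left\{(t,x)\in[0,T)\times\mathbb{R}^n:\ |x|\le 1+\frac{t^{m+1}}{m+1}\right\}.$$ Then there exists a constant $\varepsilon_0=\varepsilon_0(f,g,m,n,p)>0$ such that the lifespan $T_\varepsilon$ satisfies $$T_\varepsilon\le\begin{cases} C\,\varepsilon^{-\frac{2(p-1)}{\gamma_T(n,m;p)}} & \text{if } 1<p<p_T(n,m),\\ \exp\left(C\varepsilon^{-(p-1)}\right)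 & \text{if } p=p_T(n,m),\end{cases}$$ for $0<\varepsilon\le\varepsilon_0$ and some constant $C>0$ independent of $\varepsilon$, where $$\gamma_T(n,m;p):=2-[(m+1)(n-1)-m](p-1).$$
   Context: $\Gamma$ is the Gamma function and $\varepsilon>0$ is a parameter multiplying the fixed data $f,g$. Energy (weak) solution on $[0,T)$: a function $u\in C([0,T),H^1(\mathbb{R}^n))\cap C^1([0,T),H^{1-\frac{1}{m+1}}(\mathbb{R}^n))$ with $u_t\in L^p_{\rm loc}((0,T)\times\mathbb{R}^n)$, such that $u(0,\cdot)=\varepsilon f$ in $H^1(\mathbb{R}^n)$, $u_t(0,\cdot)=\varepsilon g$ in $H^{1-\frac{1}{m+1}}(\mathbb{R}^n)$, and $$\varepsilon\int_{\mathbb{R}^n}g(x)\Psi(0,x)\,dx+\int_0^T\!\!\int_{\mathbb{R}^n}|u_t|^p\Psi(t,x)\,dx\,dt=\int_0^T\!\!\int_{\mathbb{R}^n}-u_t(t,x)\Psi_t(t,x)\,dx\,dt+\int_0^T\!\!\int_{\mathbb{R}^n}t^{2m}\nabla u(t,x)\cdot\nabla\Psi(t,x)\,dx\,dt$$ for every $\Psi\in C^1_0([0,T)\times\mathbb{R}^n)\cap C^\infty((0,T)\times\mathbb{R}^n)$ (the subscript $0$ denoting compact support in $[0,T)\times\mathbb{R}^n$). The lifespan $T_\varepsilon$ is the maximal existence time of the solution, depending on the parameter $\varepsilon$. *)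

(* Defs.v *)
From HB Require Import structures.
From mathcomp Require Import all_boot all_order all_algebra.
From mathcomp Require Import all_classical all_reals all_analysis.

Set Implicit Arguments.
Unset Strict Implicit.
Unset Printing Implicit Defensive.

Import Order.TTheory GRing.Theory Num.Theory.
Import numFieldNormedType.Exports.

Local Open Scope classical_set_scope.
Local Open Scope ring_scope.

(* R^n is ['rV[R]_n]. The library provides its topology but neither a
   sigma-algebra nor Lebesgue measure. The sigma-algebra generated by the
   coordinates is the Borel one. *)
Section rV_measurable.
Context (R : realType) (n : nat).

Let coords (i : 'I_n) (x : 'rV[R]_n) : R := x ord0 i.

Let rV_set0 : g_sigma_preimage coords set0.
Proof. exact: sigma_algebra0. Qed.

Let rV_setC A : g_sigma_preimage coords A -> g_sigma_preimage coords (~` A).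
Proof. exact: sigma_algebraC. Qed.

Let rV_bigcup (F : (set 'rV[R]_n)^nat) :
  (forall i, g_sigma_preimage coords (F i)) ->
  g_sigma_preimage coords (\bigcup_i F i).
Proof. exact: sigma_algebra_bigcup. Qed.

HB.instance Definition _ := @isMeasurable.Build default_measure_display
  'rV[R]_n (g_sigma_preimage coords) rV_set0 rV_setC rV_bigcup.

Lemma measurable_coord (i : 'I_n) :
  measurable_fun [set: 'rV[R]_n] (fun x : 'rV[R]_n => x ord0 i).
Proof.
move=> _ Y mY; rewrite setTI; apply: sub_sigma_algebra => /=.
rewrite -bigcup_seq/=; exists i => /=; first by rewrite mem_index_enum.
by exists Y => //; rewrite setTI.
Qed.

Lemma measurable_fun_coordP d (T : measurableType d) (f : T -> 'rV[R]_n) :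
  (forall i, measurable_fun [set: T] (fun z => f z ord0 i)) ->
  measurable_fun [set: T] f.
Proof.
move=> mf.
have mG : <<s preimage_set_system setT f
    (\big[setU/set0]_(i < n) preimage_set_system setT (coords i) measurable) >>
    `<=` measurable.
  apply: smallest_sub; first exact: sigma_algebra_measurable.
  rewrite -bigcup_seq/= => _ [B [i _ [A mA <-]] <-].
  by have := mf i measurableT A mA; rewrite !setTI.
move=> _ B mB; apply: mG.
by rewrite g_sigma_preimageE; exists B.
Qed.

End rV_measurable.

Section lebesgue_rV.
Context (R : realType).

Definition rV_cons n (z : R * 'rV[R]_n) : 'rV[R]_n.+1 :=
  \row_i oapp (fun j => z.2 ord0 j) z.1 (unlift ord0 i).

Definition rV_uncons n (x : 'rV[R]_n.+1) : R * 'rV[R]_n :=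
  (x ord0 ord0, \row_j x ord0 (lift ord0 j)).

Lemma rV_consK n : cancel (@rV_cons n) (@rV_uncons n).
Proof.
move=> [a x]; rewrite /rV_uncons /rV_cons mxE unlift_none/=; congr pair.
by apply/rowP => j; rewrite !mxE liftK.
Qed.

Lemma measurable_rV_cons n : measurable_fun setT (@rV_cons n).
Proof.
apply: measurable_fun_coordP => i.
case: (unliftP ord0 i) => [j|] ->.
  rewrite (_ : (fun z => _) = (fun x : 'rV[R]_n => x ord0 j) \o snd).
    exact: (measurableT_comp (measurable_coord j)).
  by apply/funext => z /=; rewrite mxE liftK.
rewrite (_ : (fun z => _) = fst); first exact: measurable_fst.
by apply/funext => z /=; rewrite mxE unlift_none.
Qed.

Lemma measurable_rV_uncons n : measurable_fun setT (@rV_uncons n).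
Proof.
apply: measurable_fun_pair; first exact: measurable_coord.
apply: measurable_fun_coordP => j.
rewrite (_ : (fun z => _) = (fun x : 'rV[R]_n.+1 => x ord0 (lift ord0 j))).
  exact: measurable_coord.
by apply/funext => x /=; rewrite mxE.
Qed.

Section step.
Context (n : nat) (mu : {sigma_finite_measure set 'rV[R]_n -> \bar R}).

Definition lebesgue_rV_step : set 'rV[R]_n.+1 -> \bar R :=
  pushforward (lebesgue_measure \x mu)%E (@rV_cons n).

HB.instance Definition _ :=
  Measure.copy lebesgue_rV_step
    (measure_function_pushforward__canonical__measure_function_Measure
      (lebesgue_measure \x mu)%E (@measurable_rV_cons n)).

Let step_sigma_finite : sigma_finite setT lebesgue_rV_step.
Proof.
have /sigma_finiteP[F [FT ndF Foo]] :
  sigma_finite setT (@lebesgue_measure R) by exact: sigma_finiteT.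
have /sigma_finiteP[G [GT ndG Goo]] := sigma_finiteT mu.
exists (fun k => @rV_uncons n @^-1` (F k `*` G k)).
  rewrite -preimage_bigcup (_ : \bigcup_k _ = setT) ?preimage_setT//.
  apply/seteqP; split => // -[a x] _.
  have [i _ Fi] : (\bigcup_k F k) a by rewrite -FT.
  have [j _ Gj] : (\bigcup_k G k) x by rewrite -GT.
  exists (maxn i j) => //; split => /=.
    by move: a Fi; exact/subsetPset/ndF/leq_maxl.
  by move: x Gj; exact/subsetPset/ndG/leq_maxr.
move=> k; have [mF Fk] := Foo k; have [mG Gk] := Goo k; split.
  by rewrite -[X in measurable X]setTI; apply: measurable_rV_uncons => //;
     exact: measurableX.
rewrite /lebesgue_rV_step /pushforward -comp_preimage.
rewrite (_ : _ \o _ = id) ?preimage_id; last first.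
  by apply/funext => z /=; rewrite rV_consK.
by rewrite product_measure1E// lte_mul_pinfty// ge0_fin_numE.
Qed.

HB.instance Definition _ :=
  Measure_isSigmaFinite.Build _ _ _ lebesgue_rV_step step_sigma_finite.

End step.

Fixpoint lebesgue_rV n : {sigma_finite_measure set 'rV[R]_n -> \bar R} :=
  match n with
  | 0 => dirac (0 : 'rV[R]_0)
  | k.+1 => lebesgue_rV_step (lebesgue_rV k)
  end.

Lemma lebesgue_rV_box n (A : 'I_n -> set R) :
  (forall i, measurable (A i)) ->
  lebesgue_rV n [set x | forall i, A i (x ord0 i)] =
  (\prod_(i < n) lebesgue_measure (A i))%E.
Proof.
elim: n A => [|n IH] A mA.
  rewrite big_ord0 /= /dirac indicE mem_set//=.
  by case.
rewrite big_ord_recl/= /lebesgue_rV_step /pushforward.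
rewrite (_ : _ @^-1` _ = A ord0 `*`
    [set x : 'rV[R]_n | forall i, A (lift ord0 i) (x ord0 i)]).
  rewrite product_measure1E//; first by rewrite (IH (fun i => A (lift ord0 i))).
    exact: mA.
  rewrite (_ : mkset _ = \bigcap_(i in [set: 'I_n])
      ((fun x : 'rV[R]_n => x ord0 i) @^-1` A (lift ord0 i))); last first.
    by apply/seteqP; split => x /=; [move=> h i _; exact: h|move=> h i; exact: h].
  apply: fin_bigcap_measurable => // i _.
  by rewrite -[X in measurable X]setTI; exact: measurable_coord.
apply/seteqP; split => [[a x] h|[a x] [h0 h] i] /=.
  split => [|i].
    by have := h ord0; rewrite /= mxE unlift_none.
  by have := h (lift ord0 i); rewrite /= mxE liftK.
by rewrite mxE; case: unliftP => [j|] ->.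
Qed.

End lebesgue_rV.

Definition basis_rV (R : realType) n (i : 'I_n) : 'rV[R]_n := delta_mx ord0 i.

(* The library norm of ['rV[R]_n] is the sup norm. *)
Definition enorm (R : realType) n (x : 'rV[R]_n) : R :=
  Num.sqrt (\sum_(i < n) x ord0 i ^+ 2).

Definition spacetime_measure (R : realType) n :
    {measure set (measurableTypeR R * 'rV[R]_n)%type -> \bar R} :=
  (lebesgue_measure \x lebesgue_rV R n)%E.

(* On an open set of a finite-dimensional space this is C^k in the usual sense:
   all iterated partial derivatives up to order k exist and are continuous. *)
Fixpoint Ck_on (R : realType) (V : normedModType R) (U : set V) (k : nat)
    (f : V -> R) : Prop :=
  (forall x, U x -> {for x, continuous f}) /\
  match k with
  | 0 => True
  | k'.+1 => forall v : V,
      (forall x, U x -> derivable f x v) /\ Ck_on U k' ('D_v f)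
  end.

Definition smooth_on (R : realType) (V : normedModType R) (U : set V)
    (f : V -> R) : Prop :=
  forall k, Ck_on U k f.

Definition compactly_supported_in (R : realType) (V : normedModType R)
    (D : set V) (f : V -> R) : Prop :=
  exists K : set V,
    [/\ compact K, K `<=` D & forall x, D x -> ~ K x -> f x = 0].

(* [null] is the family of negligible sets of a measure on [T]; the result is
   the support of the class of [f] modulo equality almost everywhere. *)
Definition ess_support (T : topologicalType) (R : realType)
    (null : set T -> Prop) (f : T -> R) : set T :=
  [set x | forall U, nbhs x U -> ~ null (U `&` [set y | f y != 0])].

Section sobolev.
Context (R : realType) (n : nat).
Local Notation E := 'rV[R]_n.
Local Notation mu := (lebesgue_rV R n).
Implicit Types (f w : E -> R) (i : 'I_n) (s : R).

Definition in_L2 f : Prop :=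
  measurable_fun setT f /\ ('N[mu]_2%:E [EFin \o f] < +oo)%E.

Definition is_weak_partial i f w : Prop :=
  forall phi : E -> R, smooth_on setT phi -> compactly_supported_in setT phi ->
    \int[mu]_x (f x * 'D_(basis_rV R i) phi x) = - \int[mu]_x (w x * phi x).

Definition weak_partial i f : E -> R :=
  xget (fun=> 0) [set w | in_L2 w /\ is_weak_partial i f w].

(* For 0 < s < 1 this is the Gagliardo (Sobolev-Slobodeckij) form of the
   H^s seminorm. Only 0 <= s <= 1 is meaningful. *)
Definition sobolev_seminorm_sq s f : \bar R :=
  if s == 0 then 0%E
  else if s == 1 then (\sum_(i < n) 'N[mu]_2%:E [EFin \o weak_partial i f] ^+ 2)%E
  else (\int[mu]_x \int[mu]_y
          (((f x - f y) ^+ 2) / enorm (x - y) `^ (n%:R + 2 * s))%:E)%E.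

Definition sobolev_norm s f : \bar R :=
  (('N[mu]_2%:E [EFin \o f] ^+ 2 + sobolev_seminorm_sq s f) `^ 2^-1)%E.

Definition in_sobolev s f : Prop :=
  [/\ measurable_fun setT f,
      s = 1 -> forall i, exists w, in_L2 w /\ is_weak_partial i f w
    & (sobolev_norm s f < +oo)%E].

End sobolev.

Section energy_solution.
Context (R : realType) (n : nat).
Local Notation E := 'rV[R]_n.
Local Notation mu := (lebesgue_rV R n).
Local Notation vol := (spacetime_measure R n).
Implicit Types (T : \bar R) (m p s eps : R) (f g : E -> R).
Implicit Types (u v ut : R -> E -> R).

Definition time T : set R := [set t | 0 <= t /\ (t%:E < T)%E].
Definition time_pos T : set R := [set t | 0 < t /\ (t%:E < T)%E].
Definition slab T : set (R * E)%type := time T `*` setT.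
Definition slab_pos T : set (R * E)%type := time_pos T `*` setT.

Definition sobolev_continuous s T u : Prop :=
  (forall t, time T t -> in_sobolev s (u t)) /\
  forall t, time T t ->
    sobolev_norm s (u t' \- u t) @[t' --> within (time T) (nbhs t)] --> 0%E.

(* [v] is the time derivative of [u] in H^s, one-sided at t = 0. *)
Definition sobolev_time_derivative s T u v : Prop :=
  forall t, time T t ->
    sobolev_norm s (fun x => (u t' x - u t x) / (t' - t) - v t x)
      @[t' --> within (time T) t^'] --> 0%E.

Definition in_Lp_loc p (D : set (R * E)%type) (w : R * E -> R) : Prop :=
  forall K : set (R * E)%type, compact K -> K `<=` D ->
    (\int[vol]_(z in K) (`|w z| `^ p)%:E < +oo)%E.

Definition dt (Psi : R * E -> R) : R * E -> R := 'D_((1, 0) : R * E) Psi.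
Definition dx (i : 'I_n) (Psi : R * E -> R) : R * E -> R :=
  'D_((0, basis_rV R i) : R * E) Psi.

(* C^1 up to t = 0: the first derivatives on (0,T) x R^n extend continuously
   to [0,T) x R^n. Values of [Psi] outside [0,T) x R^n play no role. *)
Definition C1_slab T (Psi : R * E -> R) : Prop :=
  [/\ {within slab T, continuous Psi},
      Ck_on (slab_pos T) 1 Psi
    & forall v : R * E, exists h : R * E -> R,
        {within slab T, continuous h} /\
        forall z, slab_pos T z -> h z = 'D_v Psi z].

Definition test_function T (Psi : R * E -> R) : Prop :=
  [/\ C1_slab T Psi, smooth_on (slab_pos T) Psi
    & compactly_supported_in (slab T) Psi].

(* [ut] stands for u_t. [u] and [ut] are chosen jointly measurable, which every
   class admits, so that space-time integrals and supports make sense. Membership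
   of u_t in L^p_loc((0,T) x R^n) does not make |u_t|^p Psi integrable near
   t = 0; [energy_integrable] states this implicit requirement of the identity,
   since a divergent integral would otherwise be read as 0. *)
Record energy_solution_with m p eps f g T u ut : Prop := EnergySolution {
  energy_measurable : measurable_fun (slab T) (fun z => u z.1 z.2) ;
  energy_measurable_t : measurable_fun (slab T) (fun z => ut z.1 z.2) ;
  energy_cont : sobolev_continuous 1 T u ;
  energy_cont_s : sobolev_continuous (1 - (m + 1)^-1) T u ;
  energy_cont_t : sobolev_continuous (1 - (m + 1)^-1) T ut ;
  energy_derivative : sobolev_time_derivative (1 - (m + 1)^-1) T u ut ;
  energy_Lp_loc : in_Lp_loc p (slab_pos T) (fun z => ut z.1 z.2) ;
  energy_init : {ae mu, forall x, u 0 x = eps * f x} ;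
  energy_init_t : {ae mu, forall x, ut 0 x = eps * g x} ;
  energy_integrable : forall Psi, test_function T Psi ->
    vol.-integrable (slab_pos T)
      (fun z => (`|ut z.1 z.2| `^ p * Psi z)%:E) ;
  energy_identity : forall Psi, test_function T Psi ->
    eps * \int[mu]_x (g x * Psi (0, x))
    + \int[lebesgue_measure]_(t in time_pos T)
        \int[mu]_x (`|ut t x| `^ p * Psi (t, x))
    = \int[lebesgue_measure]_(t in time_pos T)
        \int[mu]_x (- ut t x * dt Psi (t, x))
    + \int[lebesgue_measure]_(t in time_pos T)
        \int[mu]_x (t `^ (2 * m)
          * \sum_(i < n) weak_partial i (u t) x * dx i Psi (t, x)) }.

Definition energy_solution m p eps f g T u : Prop :=
  exists ut, energy_solution_with m p eps f g T u ut.

Definition solution_support T u : set (R * E)%type :=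
  slab T `&`
  ess_support vol.-negligible ((fun z : R * E => u z.1 z.2) \_ (slab T)).

Definition cone m T : set (R * E)%type :=
  [set z | slab T z /\ enorm z.2 <= 1 + z.1 `^ (m + 1) / (m + 1)].

(* T = +oo is allowed. Uniqueness is not known in this class, so the supremum
   runs over all solutions supported in the cone. *)
Definition lifespan m p eps f g : \bar R :=
  ereal_sup [set T | (0 < T)%E /\ exists u,
    energy_solution m p eps f g T u /\ solution_support T u `<=` cone m T].

End energy_solution.

Section parameters.
Context (R : realType).

(* Euler's integral, for 0 < x. *)
Definition Gamma (x : R) : R :=
  \int[lebesgue_measure]_(t in `]0%R, +oo[) (t `^ (x - 1) * expR (- t)).

Definition a_coef (m : R) : R :=
  (2 * (m + 1)) `^ (m / (m + 1))
  * Gamma (2^-1 + m / (2 * (m + 1))) / Gamma (2^-1 - m / (2 * (m + 1))).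

Definition p_T (n : nat) (m : R) : \bar R :=
  if (n <= 1)%N then +oo%E
  else (1 + 2 / ((m + 1) * (n%:R - 1) - m))%:E.

Definition gamma_T (n : nat) (m p : R) : R :=
  2 - ((m + 1) * (n%:R - 1) - m) * (p - 1).

End parameters.

(* Main.v *)
Require Import Defs.
From HB Require Import structures.
From mathcomp Require Import all_boot all_order all_algebra.
From mathcomp Require Import all_classical all_reals all_analysis.
From mathcomp Require Import measurable_realfun ring lra.

(** Why the lifespan is bounded.

    The function [phi(x) = exp(x_1)] is its own Laplacian, and [w'' = t^(2 m) w] has a positive
    decaying solution [weight], a Bessel function of [z(t) = t^(m+1) / (m+1)], the distance that
    waves travel up to time [t]. So [weight(t) phi(x)] solves the linear equation. Let
    [coweight = - weight'], let [U] and [V] be the integrals of [u_t phi] and [u phi] over space,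
    and let [W = weight U + coweight V]. Testing the weak form against the solution of the linear
    equation gives [energy_balance]: [W(t)] is [W(0)] plus the integral over [(0, t)] of [weight]
    times the integral of [|u_t|^p phi]. Since [coweight(0) / weight(0) = a(m)], the initial
    value is [eps weight(0)] times the integral of [(a(m) f + g) phi], which is positive by the
    assumption on the data. Hence [W] is nondecreasing and at least a multiple of [eps].

    Two estimates turn this into a differential inequality. First, [V / weight] has derivative
    [W / weight^2], so the monotonicity of [W] and the size of the weights bound [coweight V] by
    a fixed fraction of [W], up to a term that tends to 0; from some time [t0] on,
    [weight U >= d W] ([weight_velocity_lower_bound]). Second, at time [t] the solution lives in
    the ball of radius [1 + z(t)], where the mass of [phi] is [O(z^((n-1)/2) e^z)]
    ([plane_exp_ball]), while [weight] is [O(t^(-m/2) e^(-z))]. The exponentials cancel in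
    Hoelder's inequality, and with [kappa = (m+1)(n-1) - m] the growth of [W] is at least
    [c t^(-kappa (p-1)/2) (weight U)^p] ([source_lower_bound], [weight_cone_growth]).

    Therefore [W' >= c t^(-kappa (p-1)/2) W^p] in integrated form, so the integral of
    [t^(-kappa (p-1)/2)] from [t0] to any time of existence is at most a multiple of
    [eps^(1-p)] ([blowup_time_bound]). The exponent is [gamma_T / 2 - 1]: for [p < p_T] the
    integral grows like [t^(gamma_T / 2)], for [p = p_T] it is a logarithm, and these are the two
    bounds claimed.
    The estimate holds for every solution with the given data, hence for the supremum that
    defines the lifespan.

    Part of the work is to make the weak form usable. The support condition concerns [u] in
    space-time and up to null sets; L^2 continuity transfers it to [u] and [u_t] at every time
    ([solution_off_cone], [solution_t_off_cone]). This allows [phi] to be replaced by a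
    compactly supported function ([weak_laplacian]). The balance at a given time is the limit
    of test functions that drop to 0 within a short time interval ([weak_rhs]). *)

Set Implicit Arguments.
Unset Strict Implicit.
Unset Printing Implicit Defensive.

Import Order.TTheory GRing.Theory Num.Theory archimedean.Num.Theory.
Import numFieldNormedType.Exports.

Local Open Scope classical_set_scope.
Local Open Scope ring_scope.

(** * Bessel integrals *)

Section bessel_integrability.
Context (R : realType).
Local Notation leb := (@lebesgue_measure R).
Implicit Types (a b c s : R).

Lemma powR_le_expR b s : 0 < b -> 0 <= s -> s `^ b <= b `^ b * expR s.
Proof.
move=> b0 s0.
have -> : s `^ b = (b * (s / b)) `^ b by rewrite mulrC divfK ?gt_eqF.
rewrite powRM ?divr_ge0 ?(ltW b0)// ler_wpM2l ?powR_ge0//.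
have -> : expR s = expR (s / b) `^ b by rewrite -expRM divfK ?gt_eqF.
apply: ge0_ler_powR; rewrite ?nnegrE ?expR_ge0 ?divr_ge0 ?(ltW b0)//.
by apply: le_trans (expR_ge1Dx _); rewrite lerDr.
Qed.

(** This exhaustion of the half line is stable under [s |-> c / s], so that substitution
    can be made on each interval. *)
Definition pos_exhaustion c (n : nat) : set R := `[c / n.+1%:R, n.+1%:R].

Lemma bigcup_pos_exhaustion c : 0 < c -> \bigcup_n pos_exhaustion c n = `]0, +oo[%classic.
Proof.
move=> c0; apply/seteqP; split => [x [n _]|x] /=.
  rewrite /pos_exhaustion/= !in_itv/= andbT => /andP[+ _].
  by apply: lt_le_trans; rewrite divr_gt0.
rewrite in_itv/= andbT => x0.
exists (maxn (Num.truncn x) (Num.truncn (c / x))) => //=.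
rewrite /pos_exhaustion/= in_itv/=; apply/andP; split.
  rewrite ler_pdivrMr// mulrC -ler_pdivrMr//.
  apply: (le_trans (ltW (truncnS_gt _))).
  by rewrite ler_nat ltnS leq_maxr.
apply: (le_trans (ltW (truncnS_gt _))).
by rewrite ler_nat ltnS leq_maxl.
Qed.

Lemma nd_pos_exhaustion c : 0 < c -> nondecreasing_seq (pos_exhaustion c).
Proof.
move=> c0 k n kn; apply/subsetPset => x; rewrite /pos_exhaustion/= !in_itv/=.
move=> /andP[h1 h2]; apply/andP; split.
  by apply: le_trans h1; rewrite ler_pM2l// lef_pV2 ?posrE// ler_nat ltnS.
by apply: le_trans h2 _; rewrite ler_nat ltnS.
Qed.

Lemma pos_exhaustion_gt0 c n x : 0 < c -> pos_exhaustion c n x -> 0 < x.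
Proof.
move=> c0; rewrite /pos_exhaustion/= in_itv/= => /andP[+ _].
by apply: lt_le_trans; rewrite divr_gt0.
Qed.

Lemma is_derive_continuous (f : R -> R) (x df : R) : is_derive x 1 f df -> {for x, continuous f}.
Proof.
move=> d; apply: differentiable_continuous; apply/derivable1_diffP.
exact: ex_derive.
Qed.

Lemma near_eq_continuous (f g : R -> R) (x : R) : (\near x, f x = g x) ->
  {for x, continuous f} -> {for x, continuous g}.
Proof.
move=> fg cf; rewrite /prop_for /continuous_at -(nbhs_singleton fg).
by apply: cvg_trans cf; exact: near_eq_cvg.
Qed.

Lemma cvg_pos_exhaustion (f : R -> R) c : 0 < c ->
  measurable_fun (`]0, +oo[ : set R) f -> (forall s, 0 < s -> 0 <= f s) ->
  (\int[leb]_(x in pos_exhaustion c n) (f x)%:E @[n --> \oo] -->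
   \int[leb]_(x in `]0%R, +oo[) (f x)%:E)%E.
Proof.
move=> c0 mf f0; rewrite -(bigcup_pos_exhaustion c0).
apply: ge0_nondecreasing_set_cvg_integral.
- exact: nd_pos_exhaustion.
- by move=> i; exact: measurable_itv.
- move=> i; apply/measurable_EFinP; apply: measurable_funS mf => //.
  by move=> x /(pos_exhaustion_gt0 c0); rewrite /= in_itv/= andbT.
- by move=> i x /(pos_exhaustion_gt0 c0) x0; rewrite lee_fin f0.
Qed.

Lemma continuous_pos_measurable (f : R -> R) :
  (forall s, 0 < s -> {for s, continuous f}) -> measurable_fun (`]0, +oo[ : set R) f.
Proof.
move=> cf; apply: open_continuous_measurable_fun; first exact: interval_open.
by move=> s; rewrite inE/= in_itv/= andbT; exact: cf.
Qed.

Lemma within_continuousW (A : set R) (f : R -> R) :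
  (forall s, A s -> {for s, continuous f}) -> {within A, continuous f}.
Proof.
move=> cf; apply/subspace_continuousP => s As.
by apply: cvg_within_filter; exact: cf.
Qed.

Lemma integrable_bounded_primitive (f F : R -> R) (M : R) :
  (forall s, 0 < s -> 0 <= f s) ->
  (forall s, 0 < s -> {for s, continuous f}) ->
  (forall s, 0 < s -> is_derive s 1 F (f s)) ->
  (forall s, 0 < s -> `|F s| <= M) ->
  leb.-integrable `]0, +oo[ (EFin \o f).
Proof.
move=> f0 cf dF FM; have mf := continuous_pos_measurable cf.
have c01 : (0 : R) < 1 by [].
apply/integrableP; split; first exact/measurable_EFinP.
apply: (@le_lt_trans _ _ (2 * M)%:E); last exact: ltry.
have -> : (\int[leb]_(x in `]0%R, +oo[) `|(EFin \o f) x| =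
    \int[leb]_(x in `]0%R, +oo[) (f x)%:E)%E.
  apply: eq_integral => x /set_mem; rewrite /= in_itv/= andbT => x0.
  by rewrite ger0_norm ?f0.
have h := cvg_pos_exhaustion c01 mf f0.
rewrite -(cvg_lim _ h)//.
apply: lime_le; first by apply/cvg_ex; eexists; exact: h.
apply: nearW => n; rewrite /pos_exhaustion.
have n0 : (1 / n.+1%:R : R) <= n.+1%:R.
  by apply: (@le_trans _ _ (1 : R)); rewrite ?div1r ?invf_le1 ?ler1n.
have M0 : 0 <= M by apply: le_trans (normr_ge0 _) (FM 1 ltr01).
have [n1|n1] := eqVneq (1 / n.+1%:R : R) n.+1%:R.
  by rewrite n1 set_itv1 integral_set1 lee_fin mulr_ge0.
have pos (x : R) : x \in `[1 / n.+1%:R, n.+1%:R] -> 0 < x.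
  by move=> xn; exact: (@pos_exhaustion_gt0 1 n).
rewrite (@continuous_FTC2 _ f F); first last.
- move=> x xn; rewrite derive1E; apply: derive_val; apply: dF.
  by apply: pos; apply: subset_itv_oo_cc.
- split => [x xn||].
  + by apply: ex_derive; apply: dF; apply: pos; apply: subset_itv_oo_cc.
  + apply: cvg_at_right_filter; apply: is_derive_continuous.
    by apply: dF; apply: pos; rewrite in_itv/= lexx.
  + apply: cvg_at_left_filter; apply: is_derive_continuous.
    by apply: dF; apply: pos; rewrite in_itv/= lexx andbT.
- by apply: within_continuousW => s /pos; exact: cf.
- by rewrite lt_neqAle n1.
rewrite -EFinB lee_fin.
have h1 := FM _ (pos n.+1%:R _); have h2 := FM _ (pos (1 / n.+1%:R) _).
rewrite mulrDl mul1r; apply: le_trans (ler_norm _) _.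
apply: le_trans (ler_normB _ _) _; apply: lerD.
  by apply: h1; rewrite in_itv/= lexx andbT.
by apply: h2; rewrite in_itv/= lexx.
Qed.

Lemma is_derive_powR_pos a s : 0 < s -> is_derive s 1 (fun x => x `^ a) (a * s `^ (a - 1)).
Proof. exact: is_derive1_powR. Qed.

Lemma powR_continuous_pos a s : 0 < s -> {for s, continuous (fun x => x `^ a)}.
Proof. by move=> s0; apply: is_derive_continuous (is_derive_powR_pos a s0). Qed.

Lemma gamma_integrable a : 0 < a ->
  leb.-integrable `]0, +oo[ (EFin \o (fun s => s `^ (a - 1) * expR (- s))).
Proof.
move=> a0.
pose f s := a * s `^ (a - 1) / (1 + s `^ a) ^+ 2.
pose F s := - (1 + s `^ a)^-1.
have p1 s : 0 < 1 + s `^ a by rewrite ltr_pwDl// powR_ge0.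
have dF s : 0 < s -> is_derive s 1 F (f s).
  move=> s0; have d0 := is_derive_powR_pos a s0.
  have d1 : is_derive s 1 (fun x : R => 1 + x `^ a) (0 + a * s `^ (a - 1)).
    by apply: is_deriveD.
  have h : (fun x : R => 1 + x `^ a) s != 0 by rewrite gt_eqF.
  have d2 := is_deriveN (@is_deriveV _ (fun x : R => 1 + x `^ a) s _ _ h d1).
  apply: (is_derive_eq d2).
  by rewrite /f add0r /GRing.scale/= mulNr opprK mulrC.
have cf s : 0 < s -> {for s, continuous f}.
  move=> s0; have d0 := is_derive_powR_pos a s0; have d1 := is_derive_powR_pos (a - 1) s0.
  apply: continuousM.
    by apply: continuousM; [exact: cst_continuous|exact: powR_continuous_pos].
  apply: continuousV; first by rewrite gt_eqF// exprn_gt0.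
  apply: (@continuous_comp _ _ _ (fun x => 1 + x `^ a) (fun y => y ^+ 2)).
    by apply: continuousD; [exact: cst_continuous|exact: powR_continuous_pos].
  exact: exprn_continuous.
have intf : leb.-integrable `]0, +oo[ (EFin \o f).
  apply: (@integrable_bounded_primitive f F 1) => //.
    by move=> s s0; rewrite /f divr_ge0 ?mulr_ge0 ?powR_ge0 ?(ltW a0) ?exprn_ge0 ?(ltW (p1 s)).
  move=> s s0; rewrite normrN ger0_norm ?invr_ge0 ?(ltW (p1 s))//.
  by rewrite invf_le1// lerDl powR_ge0.
pose K := 2 * (1 + (2 * a) `^ (2 * a)) / a.
apply: (le_integrable _ _ _ (integrableZl _ K intf)) => //.
  apply/measurable_EFinP; apply: continuous_pos_measurable => s s0.
  apply: continuousM; first exact: powR_continuous_pos.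
  apply: continuous_comp; last exact: continuous_expR.
  exact: oppr_continuous.
move=> s; rewrite /= in_itv/= andbT => s0; rewrite lee_fin.
have K0 : 0 <= K by rewrite /K divr_ge0 ?(ltW a0)// mulr_ge0// addr_ge0// powR_ge0.
have f0 : 0 <= f s.
  by rewrite /f divr_ge0 ?mulr_ge0 ?powR_ge0 ?(ltW a0) ?exprn_ge0 ?(ltW (p1 s)).
rewrite ger0_norm ?mulr_ge0 ?powR_ge0 ?expR_ge0// ger0_norm ?(mulr_ge0 K0 f0)//.
have -> : K * f s = s `^ (a - 1) * (2 * (1 + (2 * a) `^ (2 * a)) / (1 + s `^ a) ^+ 2).
  by rewrite /K /f; field; rewrite !gt_eqF.
rewrite ler_wpM2l ?powR_ge0// ler_pdivlMr ?exprn_gt0// expRN mulrC ler_pdivrMr ?expR_gt0//.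
have h := @powR_le_expR (2 * a) s (mulr_gt0 (@ltr0n _ 2) a0) (ltW s0).
have h2 : s `^ (2 * a) = (s `^ a) ^+ 2 by rewrite mulrC powRrM powR_mulrn// powR_ge0.
have e1 : 1 <= expR s by rewrite -expR0 ler_expR ltW.
rewrite h2 in h.
have := sqr_ge0 (1 - s `^ a); nra.
Qed.

(** The integral [bessel_integral a c] of this kernel is [2 c^(a/2) K_a(2 sqrt c)], with K_a
    the modified Bessel function of the second kind. In this form everything needed
    follows from differentiation under the integral sign and from [s |-> c / s]. *)
Definition bessel_kernel a c s := s `^ (a - 1) * expR (- s - c / s).

Definition bessel_integral a c := \int[leb]_(s in `]0%R, +oo[) bessel_kernel a c s.

Lemma bessel_kernel_ge0 a c s : 0 <= bessel_kernel a c s.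
Proof. by rewrite mulr_ge0 ?powR_ge0 ?expR_ge0. Qed.

Lemma bessel_kernel_continuous a c s : 0 < s -> {for s, continuous (bessel_kernel a c)}.
Proof.
move=> s0; apply: continuousM; first exact: powR_continuous_pos.
apply: continuous_comp; last exact: continuous_expR.
apply: continuousB; first exact: oppr_continuous.
apply: (@continuousM _ R (cst _)); first exact: cst_continuous.
by apply: continuousV => //; rewrite gt_eqF.
Qed.

Lemma measurable_bessel_kernel a c : measurable_fun (`]0, +oo[ : set R) (bessel_kernel a c).
Proof. by apply: continuous_pos_measurable => s; exact: bessel_kernel_continuous. Qed.

Lemma bessel_kernel_le_gamma a c s : 0 <= c -> 0 < s ->
  bessel_kernel a c s <= s `^ (a - 1) * expR (- s).
Proof.
move=> c0 s0; rewrite ler_wpM2l ?powR_ge0// ler_expR gerDl oppr_le0.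
by rewrite divr_ge0// ltW.
Qed.

(** The factor [expR (- c / s)] absorbs any negative power of [s]: this makes the kernel
    integrable for every real [a] when [0 < c], and gives decay in [c]. *)
Lemma bessel_kernel_le_shift a b c s : 0 < b -> 0 < c -> 0 < s ->
  bessel_kernel a c s <= (b / c) `^ b * (s `^ (a + b - 1) * expR (- s)).
Proof.
move=> b0 c0 s0; rewrite /bessel_kernel expRD.
have h : expR (- (c / s)) <= b `^ b * (s / c) `^ b.
  have x0 : 0 < c / s by rewrite divr_gt0.
  have -> : (s / c) `^ b = ((c / s) `^ b)^-1.
    by rewrite -powRN -[in RHS]mulN1r powRrM powR_inv1 ?invf_div// ltW.
  rewrite ler_pdivlMr ?powR_gt0// expRN mulrC ler_pdivrMr ?expR_gt0//.
  by rewrite powR_le_expR// ltW.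
have -> : (b / c) `^ b * (s `^ (a + b - 1) * expR (- s)) =
  s `^ (a - 1) * (expR (- s) * (b `^ b * (s / c) `^ b)).
  have -> : a + b - 1 = (a - 1) + b by ring.
  rewrite powRD ?(gt_eqF s0) ?implybT// !powRM ?invr_ge0 ?(ltW b0) ?(ltW c0) ?(ltW s0)//.
  ring.
by rewrite ler_wpM2l ?powR_ge0// ler_wpM2l ?expR_ge0.
Qed.

Lemma bessel_kernel_integrable0 a c : 0 < a -> 0 <= c ->
  leb.-integrable `]0, +oo[ (EFin \o bessel_kernel a c).
Proof.
move=> a0 c0; apply: (le_integrable _ _ _ (gamma_integrable a0)) => //.
  by apply/measurable_EFinP; exact: measurable_bessel_kernel.
move=> s; rewrite /= in_itv/= andbT => s0; rewrite lee_fin.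
rewrite ger0_norm ?bessel_kernel_ge0// ger0_norm ?mulr_ge0 ?powR_ge0 ?expR_ge0//.
exact: bessel_kernel_le_gamma.
Qed.

Lemma bessel_kernel_integrable a c : 0 < c ->
  leb.-integrable `]0, +oo[ (EFin \o bessel_kernel a c).
Proof.
move=> c0; pose b := 1 + `|a|.
have b0 : 0 < b by rewrite /b ltr_pwDl.
have ab0 : 0 < a + b.
  by rewrite /b addrCA ltr_pwDl// -lerBlDl sub0r -normrN ler_norm.
apply: (le_integrable _ _ _ (integrableZl _ ((b / c) `^ b) (gamma_integrable ab0))) => //.
  by apply/measurable_EFinP; exact: measurable_bessel_kernel.
move=> s; rewrite /= in_itv/= andbT => s0; rewrite lee_fin.
rewrite ger0_norm ?bessel_kernel_ge0// ger0_norm ?mulr_ge0 ?powR_ge0 ?expR_ge0//.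
exact: bessel_kernel_le_shift.
Qed.

Lemma bessel_integral0 a : bessel_integral a 0 = Gamma a.
Proof.
by apply: eq_Rintegral => s _; rewrite /bessel_kernel mul0r subr0.
Qed.

Lemma is_derive_bessel_kernel a c s : 0 < s ->
  is_derive c 1 (fun c => bessel_kernel a c s) (- bessel_kernel (a - 1) c s).
Proof.
move=> s0.
have d1 : is_derive c 1 (fun x : R => - s - x / s) (- s^-1).
  by apply: is_derive_eq; rewrite /GRing.scale/=; ring.
have d2 := @is_derive1_comp _ expR _ c _ _ (is_derive_expR _) d1.
have d3 := is_deriveZ (s `^ (a - 1)) d2.
apply: (is_derive_eq d3).
rewrite /GRing.scale/= /bessel_kernel.
rewrite [in RHS]powRB ?(gt_eqF s0) ?implybT// powRr1 ?ltW//.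
ring.
Qed.

(** Differentiation under the integral sign; on ]c / 2, 2 c[ the derivatives are dominated
    by the kernel at [c / 2]. *)
Lemma is_derive_bessel_integral a c : 0 < c ->
  is_derive c 1 (bessel_integral a) (- bessel_integral (a - 1) c).
Proof.
move=> c0.
have I0 (x : R) : (`]c / 2, 2 * c[%classic : set R) x -> 0 < x.
  by rewrite /= in_itv/= => /andP[+ _]; apply: lt_trans; rewrite divr_gt0.
have Ic : (`]c / 2, 2 * c[%classic : set R) c.
  by rewrite /= in_itv/=; apply/andP; split; lra.
have dE x y : (`]c / 2, 2 * c[%classic : set R) x -> (`]0, +oo[%classic : set R) y ->
    is_derive x 1 (fun c => bessel_kernel a c y) (- bessel_kernel (a - 1) x y).
  by move=> _; rewrite /= in_itv/= andbT; exact: is_derive_bessel_kernel.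
have int1 x : (`]c / 2, 2 * c[%classic : set R) x ->
    leb.-integrable `]0, +oo[ (EFin \o bessel_kernel a x).
  by move/I0; exact: bessel_kernel_integrable.
have int2 : leb.-integrable `]0, +oo[ (EFin \o bessel_kernel (a - 1) (c / 2)).
  by apply: bessel_kernel_integrable; rewrite divr_gt0.
have der x y : (`]c / 2, 2 * c[%classic : set R) x -> (`]0, +oo[%classic : set R) y ->
    derivable (fun c => bessel_kernel a c y) x 1.
  by move=> Ix Iy; have := dE _ _ Ix Iy; move=> ?; exact: ex_derive.
have ub x y : (`]c / 2, 2 * c[%classic : set R) x -> (`]0, +oo[%classic : set R) y ->
    `|partial1of2 (bessel_kernel a) x y| <= bessel_kernel (a - 1) (c / 2) y.
  move=> Ix Iy; rewrite partial1of2E (@derive_val _ _ _ _ _ _ _ (dE _ _ Ix Iy)).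
  rewrite normrN ger0_norm ?bessel_kernel_ge0// ler_wpM2l ?powR_ge0// ler_expR.
  move: Iy Ix; rewrite /= !in_itv/= andbT => y0 /andP[cx _].
  by rewrite lerB// ler_pM2r ?invr_gt0// ltW.
have mpos : measurable (`]0%R, +oo[%classic : set (measurableTypeR R)) by exact: measurable_itv.
split.
  exact: (derivable_under_integral mpos Ic int1 der (fun y => bessel_kernel_ge0 _ _ _) int2 ub).
rewrite -derive1E.
rewrite (differentiation_under_integral mpos Ic int1 der (fun y => bessel_kernel_ge0 _ _ _) int2 ub).
transitivity (\int[leb]_(y in `]0%R, +oo[) (-1 * bessel_kernel (a - 1) c y)).
  apply: eq_Rintegral => y /set_mem Iy.
  by rewrite partial1of2E (@derive_val _ _ _ _ _ _ _ (dE _ _ Ic Iy)) mulN1r.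
by rewrite RintegralZl ?mulN1r//; exact: bessel_kernel_integrable.
Qed.

Lemma bessel_kernel_continuous_param a s (x : R) :
  {for x, continuous (fun x : R => bessel_kernel a (Num.max x 0) s)}.
Proof.
rewrite /bessel_kernel.
apply: (@continuousM _ R (cst _)); first exact: cst_continuous.
apply: continuous_comp; last exact: continuous_expR.
apply: continuousB; first exact: cst_continuous.
apply: continuousM; last exact: cst_continuous.
by apply: continuous_max; [exact: cvg_id|exact: cst_continuous].
Qed.

(** For [0 < a] the kernel at [c = 0] is an integrable majorant, so continuity reaches the
    end point [c = 0]; [Num.max] extends the function to the left of it. *)
Lemma bessel_integral_continuous a : 0 < a ->
  continuous (fun c => bessel_integral a (Num.max c 0)).
Proof.
move=> a0 c.
have Ic : c \in (`]c - 1, c + 1[%classic : set R).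
  by rewrite inE/= in_itv/=; apply/andP; split; lra.
have m0 x : (0 : R) <= Num.max x 0 by rewrite le_max lexx orbT.
apply: (@continuity_under_integral _ _ _ leb (fun c s => bessel_kernel a (Num.max c 0) s)
  (`]0%R, +oo[%classic : set (measurableTypeR R)) _ (c - 1) (c + 1) _ _
  _ (gamma_integrable a0) _ c Ic) => //.
- by move=> x _; exact: bessel_kernel_integrable0.
- by apply: aeW => s _ x _; exact: bessel_kernel_continuous_param.
- move=> x _; apply: aeW => s; rewrite /= in_itv/= andbT => s0.
  by rewrite ger0_norm ?bessel_kernel_ge0//; exact: bessel_kernel_le_gamma.
Qed.

(** Substitute [c / s] for [s]. *)
Lemma bessel_integral_symmetry a c : 0 < c ->
  bessel_integral a c = c `^ a * bessel_integral (- a) c.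
Proof.
move=> c0.
have dF (x : R) : 0 < x -> is_derive x 1 (fun r => c / r) (- c / x ^+ 2).
  move=> x0; have h : id x != 0 by rewrite /= gt_eqF.
  have d := is_deriveZ c (@is_deriveV _ id x _ _ h (is_derive_id _ (1 : R))).
  by apply: (is_derive_eq d); rewrite /GRing.scale/= mulr1 mulrN mulNr.
have dFE (x : R) : 0 < x -> derive1 (fun r : R => c / r) x = - c / x ^+ 2.
  by move=> x0; rewrite derive1E; have := dF x x0; move=> ?; exact: derive_val.
have cF' (x : R) : 0 < x -> {for x, continuous (derive1 (fun r : R => c / r))}.
  move=> x0; apply: (@near_eq_continuous (fun r => - c / r ^+ 2)).
    near=> y; rewrite dFE//; near: y.
    exact: lt_nbhsr.
  apply: (@continuousM _ R (cst (- c))); first exact: cst_continuous.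
  apply: continuousV; first by rewrite gt_eqF// exprn_gt0.
  exact: exprn_continuous.
have cF (x : R) : 0 < x -> {for x, continuous (fun r : R => c / r)}.
  by move=> x0; exact: is_derive_continuous (dF x x0).
have sub n : (\int[leb]_(x in pos_exhaustion c n) (bessel_kernel a c x)%:E =
    \int[leb]_(x in pos_exhaustion c n) (c `^ a * bessel_kernel (- a) c x)%:E)%E.
  rewrite /pos_exhaustion.
  have [ab|ab] := leP (c / n.+1%:R) n.+1%:R; last first.
    by rewrite set_itv_ge ?integral_set0// bnd_simp -ltNge.
  have pos (x : R) : x \in `[c / n.+1%:R, n.+1%:R] -> 0 < x.
    by move=> xn; exact: (@pos_exhaustion_gt0 c n).
  have h := @integration_by_substitution_decreasing _ (fun r => c / r)
    (bessel_kernel a c) _ _ ab.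
  rewrite invf_div mulrCA divff ?gt_eqF// mulr1 in h.
  rewrite h; first last.
  - by apply: within_continuousW => s /pos; exact: bessel_kernel_continuous.
  - split => [x xn||].
    + by apply: ex_derive; apply: dF; apply: pos; apply: subset_itv_oo_cc.
    + apply: cvg_at_right_filter; apply: cF; apply: pos.
      by rewrite in_itv/= lexx.
    + apply: cvg_at_left_filter; apply: cF; apply: pos.
      by rewrite in_itv/= lexx andbT.
  - apply: cvgP; apply: cvg_at_left_filter; apply: cF'.
    by apply: pos; rewrite in_itv/= lexx andbT.
  - apply: cvgP; apply: cvg_at_right_filter; apply: cF'.
    by apply: pos; rewrite in_itv/= lexx.
  - by move=> x xn; apply: cF'; apply: pos; apply: subset_itv_oo_cc.
  - move=> x y /pos x0 /pos y0 xy.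
    by rewrite ltr_pM2l// ltf_pV2.
  apply: eq_integral => x /set_mem /pos x0; congr EFin.
  rewrite /= !fctE dFE// /bessel_kernel.
  have -> : - (c / x) - c / (c / x) = - x - c / x by rewrite invf_div mulrCA divff ?gt_eqF// mulr1 addrC.
  rewrite powRM ?invr_ge0 ?(ltW c0) ?(ltW x0)// -powR_inv1 ?(ltW x0)// -powRrM.
  have -> : - (- c / x ^+ 2) = c * x `^ (- 2).
    by rewrite mulNr opprK powR_invn// ltW.
  have -> : c `^ a = c `^ (a - 1) * c.
    by rewrite -{3}(powRr1 (ltW c0)) -powRD ?(gt_eqF c0) ?implybT// subrK.
  have -> : x `^ (- a - 1) = x `^ (-1 * (a - 1)) * x `^ (- 2).
    by rewrite -powRD ?(gt_eqF x0) ?implybT//; congr (_ `^ _); ring.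
  by ring.
have mk b (r : R) : measurable_fun (`]0, +oo[ : set R) (fun x => r * bessel_kernel b c x).
  by apply: measurable_funM => //; exact: measurable_bessel_kernel.
have h1 := cvg_pos_exhaustion c0 (measurable_bessel_kernel a c) (fun s _ => bessel_kernel_ge0 a c s).
have h2 := cvg_pos_exhaustion c0 (mk (- a) (c `^ a))
  (fun s _ => mulr_ge0 (powR_ge0 _ _) (bessel_kernel_ge0 (- a) c s)).
rewrite (_ : (fun n => _) = (fun n => \int[leb]_(x in pos_exhaustion c n)
  (bessel_kernel a c x)%:E)%E) in h2; last by apply/funext => n; rewrite sub.
have e : (\int[leb]_(x in `]0%R, +oo[) (bessel_kernel a c x)%:E =
   \int[leb]_(x in `]0%R, +oo[) (c `^ a * bessel_kernel (- a) c x)%:E)%E.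
  by rewrite -(cvg_lim _ h1)// -(cvg_lim _ h2).
rewrite /bessel_integral /Rintegral e -[in LHS]/(Rintegral _ _ _) RintegralZl//.
exact: bessel_kernel_integrable.
Unshelve. all: by end_near. Qed.

End bessel_integrability.

(** * The time weights *)

Lemma is_derive1M (R : realType) (f g : R -> R) (x df dg : R) :
  is_derive x 1 f df -> is_derive x 1 g dg ->
  is_derive x 1 (fun y => f y * g y) (df * g x + f x * dg).
Proof.
move=> hf hg; apply: (is_derive_eq (is_deriveM hf hg)).
by rewrite /GRing.scale/= addrC [g x * df]mulrC.
Qed.

Lemma is_derive1Ml (R : realType) (c : R) (f : R -> R) (x df : R) :
  is_derive x 1 f df -> is_derive x 1 (fun y => c * f y) (c * df).
Proof.
move=> hf; apply: (is_derive_eq (is_derive1M (is_derive_cst c x (1 : R)) hf)).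
by rewrite mul0r add0r.
Qed.

Lemma is_derive1_expR (R : realType) (f : R -> R) (x df : R) :
  is_derive x 1 f df -> is_derive x 1 (fun y => expR (f y)) (df * expR (f x)).
Proof.
move=> hf; apply: (is_derive_eq (@is_derive1_comp _ expR f x _ _ (is_derive_expR _) hf)).
by rewrite mulrC.
Qed.

Lemma is_derive1N (R : realType) (f : R -> R) (x df : R) :
  is_derive x 1 f df -> is_derive x 1 (fun y => - f y) (- df).
Proof. by move=> hf; exact: is_deriveN. Qed.

Lemma is_derive1B (R : realType) (f g : R -> R) (x df dg : R) :
  is_derive x 1 f df -> is_derive x 1 g dg ->
  is_derive x 1 (fun y => f y - g y) (df - dg).
Proof. by move=> hf hg; exact: is_deriveB. Qed.

Lemma gt0_Rintegral d (T : measurableType d) (R : realType)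
    (mu : {measure set T -> \bar R}) (D : set T) (f : T -> R) :
  measurable D -> mu.-integrable D (EFin \o f) -> (forall x, D x -> 0 <= f x) ->
  ~ {ae mu, forall x, D x -> f x = 0} -> 0 < \int[mu]_(x in D) f x.
Proof.
move=> mD intf f0; apply: contra_notT.
rewrite -leNgt => int0.
have e0 : (\int[mu]_(x in D) `|(EFin \o f) x| = 0)%E.
  have -> : (\int[mu]_(x in D) `|(EFin \o f) x| = \int[mu]_(x in D) (f x)%:E)%E.
    by apply: eq_integral => x /set_mem Dx /=; rewrite ger0_norm ?f0.
  have fin := integrable_fin_num mD intf.
  apply/eqP; rewrite eq_le integral_ge0 ?andbT; last by move=> x Dx; rewrite lee_fin f0.
  by rewrite -(fineK fin) lee_fin.
have := (ae_eq_integral_abs mu mD (measurable_int mu intf)).1 e0.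
by apply: filterS => x /= h Dx; have [] := h Dx.
Qed.

Lemma integrable_mulr d (T : measurableType d) (R : realType)
    (mu : {measure set T -> \bar R}) (D : set T) (f : T -> R) (r : R) :
  measurable D -> mu.-integrable D (EFin \o f) ->
  mu.-integrable D (EFin \o (fun x => f x * r)).
Proof.
move=> mD i; have := integrableZr mD r i.
by apply: eq_integrable => // x _ /=; rewrite EFinM.
Qed.

(** The distance travelled up to time [t] at speed [t^m]: the cone is
    [enorm x <= 1 + horizon m t]. *)
Definition horizon (R : realType) (m t : R) : R := t `^ (m + 1) / (m + 1).

(** For [0 <= t], [2 sqrt (weight_arg t) = horizon t], the argument of the Bessel function.
    The maximum makes the weights continuous functions on the whole line. *)
Definition weight_arg (R : realType) (m t : R) : R :=
  (Num.max t 0) `^ (2 * (m + 1)) / (2 * (m + 1)) ^+ 2.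

(** A positive decaying solution of [w'' = t^(2 m) w]; [coweight] is [- w']. *)
HB.lock Definition weight (R : realType) (m t : R) : R :=
  bessel_integral (2 * (m + 1))^-1 (weight_arg m t).

HB.lock Definition coweight (R : realType) (m t : R) : R :=
  (2 * (m + 1)) `^ (m / (m + 1)) * bessel_integral (1 - (2 * (m + 1))^-1) (weight_arg m t).

Section weights.
Context (R : realType).
Local Notation leb := (@lebesgue_measure R).

Lemma le_of_is_derive_ge0 (f df : R -> R) (a b : R) : a <= b ->
  (forall x, a <= x -> x <= b -> is_derive x 1 f (df x)) ->
  (forall x, a <= x -> x <= b -> 0 <= df x) -> f a <= f b.
Proof.
move=> ab df1 df0.
have [||c cab e] := @MVT_segment _ f df a b ab.
- by move=> x; rewrite in_itv/= => /andP[h1 h2]; apply: df1; exact: ltW.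
- apply: within_continuousW => x; rewrite /= in_itv/= => /andP[h1 h2].
  exact: is_derive_continuous (df1 x h1 h2).
- move: cab; rewrite in_itv/= => /andP[ac cb].
  by rewrite -subr_ge0 e mulr_ge0 ?subr_ge0// df0.
Qed.

Lemma ge_of_is_derive_le0 (f df : R -> R) (a b : R) : a <= b ->
  (forall x, a <= x -> x <= b -> is_derive x 1 f (df x)) ->
  (forall x, a <= x -> x <= b -> df x <= 0) -> f b <= f a.
Proof.
move=> ab df1 df0; rewrite -lerN2.
apply: (@le_of_is_derive_ge0 (fun x => - f x) (fun x => - df x)) => // x ax xb.
  by have := df1 x ax xb; move=> ?; exact: is_deriveN.
by rewrite oppr_ge0 df0.
Qed.

Lemma le0_of_le_div (x K T0 : R) : (forall T, T0 <= T -> x <= K / T) -> x <= 0.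
Proof.
move=> h; rewrite leNgt; apply/negP => x0.
pose T := Num.max (Num.max T0 1) (`|K| / x + 1).
have T1 : 1 <= T by rewrite /T !le_max lexx orbT.
have T2 : T0 <= T by rewrite /T !le_max lexx.
have T3 : `|K| / x + 1 <= T by rewrite /T !le_max lexx orbT.
have := h _ T2; rewrite ler_pdivlMr ?(lt_le_trans _ T1)// => h1.
have h2 : x * (`|K| / x + 1) <= K by apply: le_trans h1; rewrite ler_pM2l.
have h3 : x * (`|K| / x + 1) = `|K| + x by field; rewrite gt_eqF.
rewrite h3 in h2; have := ler_norm K; lra.
Qed.

Context (m : R) (m0 : 0 <= m).

Local Notation horizon := (horizon m).
Local Notation weight_arg := (weight_arg m).
Local Notation weight := (weight m).
Local Notation coweight := (coweight m).

Let q : R := 2 * (m + 1).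
Let q0 : 0 < q. Proof. by rewrite /q mulr_gt0// ltr_wpDl. Qed.
Let q2 : 2 <= q. Proof. by rewrite /q mulrDr mulr1 lerDr mulr_ge0. Qed.
Let nu0 : 0 < q^-1. Proof. by rewrite invr_gt0. Qed.
Let nu1 : 0 < 1 - q^-1.
Proof. by rewrite subr_gt0 invf_lt1//; apply: lt_le_trans q2; rewrite ltr1n. Qed.

Lemma weight_arg_ge0 t : 0 <= weight_arg t.
Proof. by rewrite /weight_arg divr_ge0 ?powR_ge0// exprn_ge0// ltW. Qed.

Lemma weight_arg_gt0 t : 0 < t -> 0 < weight_arg t.
Proof.
move=> t0; rewrite /weight_arg divr_gt0 ?exprn_gt0// powR_gt0//.
by rewrite lt_max t0.
Qed.

Lemma weight_argE t : 0 < t -> weight_arg t = t `^ q / q ^+ 2.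
Proof. by move=> t0; rewrite /weight_arg (max_idPl (ltW t0)). Qed.

Lemma weight_arg0 t : t <= 0 -> weight_arg t = 0.
Proof. by move=> t0; rewrite /weight_arg (max_idPr t0) powR0 ?mul0r// gt_eqF. Qed.

Lemma powR_max0_continuous (r : R) (x : R) : 0 < r ->
  {for x, continuous (fun t : R => Num.max t 0 `^ r)}.
Proof.
move=> r0.
have [x0|x0|->] := ltgtP x 0.
- apply: (@near_eq_continuous _ (cst 0)); last exact: cst_continuous.
  near=> y; rewrite /= (max_idPr _) ?powR0 ?gt_eqF//; apply: ltW; near: y.
  exact: lt_nbhsl.
- apply: (@near_eq_continuous _ (fun t => t `^ r)); last exact: powR_continuous_pos.
  near=> y; rewrite (max_idPl _)//; apply: ltW; near: y; exact: lt_nbhsr.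
- rewrite /prop_for /continuous_at maxxx powR0 ?gt_eqF//.
  apply/cvgrPdist_le => e e0.
  have h : \forall y \near (0 : R), `|y| <= e `^ r^-1 by apply: nbhs0_le; exact: powR_gt0.
  apply: filterS h => y h.
  rewrite sub0r normrN ger0_norm ?powR_ge0//.
  have -> : e = (e `^ r^-1) `^ r by rewrite -powRrM mulVf ?powRr1 ?gt_eqF// ltW.
  apply: ge0_ler_powR; rewrite ?nnegrE ?powR_ge0 ?(ltW r0) ?le_max ?lexx ?orbT//.
  by rewrite ge_max powR_ge0 andbT; apply: le_trans (ler_norm _) h.
Unshelve. all: by end_near. Qed.

Lemma weight_arg_continuous (t : R) : {for t, continuous weight_arg}.
Proof.
apply: (@continuousM _ _ _ (cst _)); last exact: cst_continuous.
exact: powR_max0_continuous.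
Qed.

Lemma bessel_weight_arg_continuous a (t : R) : 0 < a ->
  {for t, continuous (fun t => bessel_integral a (weight_arg t))}.
Proof.
move=> a0.
rewrite (_ : (fun t => _) = (fun c => bessel_integral a (Num.max c 0)) \o weight_arg).
  apply: continuous_comp; first exact: weight_arg_continuous.
  exact: bessel_integral_continuous.
by apply/funext => s /=; rewrite (max_idPl (weight_arg_ge0 s)).
Qed.

Lemma weight_continuous (t : R) : {for t, continuous weight}.
Proof. rewrite weight.unlock; exact: bessel_weight_arg_continuous. Qed.

Lemma coweight_continuous (t : R) : {for t, continuous coweight}.
Proof.
rewrite coweight.unlock.
apply: (@continuousM _ _ (cst _)); first exact: cst_continuous.
exact: bessel_weight_arg_continuous.
Qed.

Lemma bessel_integral_gt0 (a c : R) : 0 < a -> 0 <= c -> 0 < bessel_integral a c.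
Proof.
move=> a0 c0; apply: gt0_Rintegral => //.
- exact: bessel_kernel_integrable0.
- by move=> s _; exact: bessel_kernel_ge0.
- move=> h; have hn : leb.-negligible (`]0%R, +oo[%classic : set (measurableTypeR R)).
    apply: negligibleS h => s; rewrite /= in_itv/= andbT => s0 /(_ s0).
    by apply/eqP; rewrite mulf_neq0 ?gt_eqF ?powR_gt0 ?expR_gt0.
  have mp : measurable (`]0%R, +oo[%classic : set (measurableTypeR R)) by exact: measurable_itv.
  have := (negligibleP leb mp).1 hn.
  have e : leb (`]0%R, +oo[%classic : set (measurableTypeR R)) = +oo%E.
    by have := lebesgue_measure_itv (`]0, +oo[ : interval R); rewrite /= ltry.
  by move=> h0; have := etrans (esym e) h0.
Qed.

Lemma weight_gt0 t : 0 < weight t.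
Proof. by rewrite weight.unlock; exact: bessel_integral_gt0 (weight_arg_ge0 t). Qed.

Lemma coweight_gt0 t : 0 < coweight t.
Proof.
by rewrite coweight.unlock mulr_gt0 ?powR_gt0// bessel_integral_gt0// weight_arg_ge0.
Qed.

Lemma is_derive_weight_arg (t : R) : 0 < t ->
  is_derive t 1 weight_arg (t `^ (2 * m + 1) / q).
Proof.
move=> t0.
have d1 := is_derive_powR_pos q t0.
have d2 := is_deriveM d1 (is_derive_cst (q ^- 2 : R) t (1 : R)).
have d3 : is_derive t 1 (fun t => t `^ q / q ^+ 2) (t `^ (2 * m + 1) / q).
  apply: (is_derive_eq d2).
  have -> : q - 1 = 2 * m + 1 by rewrite /q; ring.
  by rewrite /GRing.scale/= mulr0 add0r; field; rewrite gt_eqF.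
apply: (near_eq_is_derive _ d3).
near=> y; apply/esym; apply: weight_argE; near: y; exact: lt_nbhsr.
Unshelve. all: by end_near. Qed.

Lemma is_derive_bessel_weight_arg a (t : R) : 0 < t ->
  is_derive t 1 (fun t => bessel_integral a (weight_arg t))
    (- (t `^ (2 * m + 1) / q * bessel_integral (a - 1) (weight_arg t))).
Proof.
move=> t0.
have d2 := @is_derive1_comp _ (bessel_integral a) _ t _ _
   (is_derive_bessel_integral a (weight_arg_gt0 t0)) (is_derive_weight_arg t0).
by apply: (is_derive_eq d2); rewrite mulNr mulrC.
Qed.

(** Differentiation lowers the exponent [q^-1] to [q^-1 - 1], and the symmetry turns it into
    the exponent [1 - q^-1] of [coweight]. *)
Lemma is_derive_weight (t : R) : 0 < t -> is_derive t 1 weight (- coweight t).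
Proof.
move=> t0; rewrite weight.unlock coweight.unlock.
apply: (is_derive_eq (is_derive_bessel_weight_arg q^-1 t0)).
congr (- _); rewrite bessel_integral_symmetry ?weight_arg_gt0// opprB mulrA -/q.
congr (_ * _).
rewrite weight_argE// powRM ?powR_ge0 ?invr_ge0 ?exprn_ge0 ?(ltW q0)//.
rewrite -!powR_invn ?(ltW q0)// -!powRrM.
have -> : t `^ (2 * m + 1) / q = t `^ (2 * m + 1) * q `^ (-1) by rewrite powR_inv1 ?(ltW q0).
rewrite mulrACA -!powRD ?(gt_eqF t0) ?(gt_eqF q0) ?implybT//.
have m1 : m + 1 != 0 by rewrite gt_eqF// ltr_wpDl.
have -> : 2 * m + 1 + q * (q^-1 - 1) = 0 by rewrite /q; field.
rewrite powRr0 mul1r; congr (_ `^ _).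
by rewrite /q; field.
Qed.

Lemma is_derive_coweight (t : R) : 0 < t ->
  is_derive t 1 coweight (- (t `^ (2 * m) * weight t)).
Proof.
move=> t0; rewrite weight.unlock coweight.unlock.
have d := is_deriveZ (q `^ (m / (m + 1))) (is_derive_bessel_weight_arg (1 - q^-1) t0).
apply: (is_derive_eq d); rewrite /GRing.scale/= mulrN; congr (- _).
have -> : 1 - q^-1 - 1 = - q^-1 by ring.
rewrite -/q (@bessel_integral_symmetry _ q^-1) ?weight_arg_gt0//.
rewrite !mulrA; congr (_ * _).
rewrite weight_argE// powRM ?powR_ge0 ?invr_ge0 ?exprn_ge0 ?(ltW q0)//.
rewrite -!powR_invn ?(ltW q0)// -!powRrM.
rewrite mulfV ?gt_eqF//.
have -> : q `^ (m / (m + 1)) * t `^ (2 * m + 1) / q = q `^ (m / (m + 1)) * t `^ (2 * m + 1) * q `^ (-1) by rewrite powR_inv1 ?(ltW q0).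
have m1 : m + 1 != 0 by rewrite gt_eqF// ltr_wpDl.
have -> : q `^ (m / (m + 1)) * t `^ (2 * m + 1) * q `^ (-1) =
  q `^ (m / (m + 1)) * q `^ (-1) * t `^ (2 * m + 1) by ring.
rewrite [in RHS]mulrA -!powRD ?(gt_eqF t0) ?(gt_eqF q0) ?implybT//.
rewrite [RHS]mulrC; congr (_ `^ _ * _).
by rewrite /q; field.
Qed.

(** Both integrals are values of Gamma at [t = 0]: this is where [a_coef] comes from. *)
Lemma coweight0 : coweight 0 = a_coef m * weight 0.
Proof.
rewrite coweight.unlock weight.unlock weight_arg0// !bessel_integral0 /a_coef.
have m1 : m + 1 != 0 by rewrite gt_eqF// ltr_wpDl.
have -> : 2^-1 + m / (2 * (m + 1)) = 1 - (2 * (m + 1))^-1 by field.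
have -> : 2^-1 - m / (2 * (m + 1)) = (2 * (m + 1))^-1 by field.
rewrite divfK// gt_eqF// -bessel_integral0.
exact: bessel_integral_gt0.
Qed.

Lemma is_derive_horizon (t : R) : 0 < t -> is_derive t 1 horizon (t `^ m).
Proof.
move=> t0.
have m1 : m + 1 != 0 by rewrite gt_eqF// ltr_wpDl.
have d2 := is_deriveM (is_derive_powR_pos (m + 1) t0) (is_derive_cst ((m + 1)^-1 : R) t (1 : R)).
apply: (is_derive_eq d2); rewrite /GRing.scale/= mulr0 add0r addrK.
by rewrite mulrA mulVf// mul1r.
Qed.

Lemma coweight_nincr (s t : R) : 0 < s -> s <= t -> coweight t <= coweight s.
Proof.
move=> s0 st; apply: (ge_of_is_derive_le0 st) => x sx xt.
  by apply: is_derive_coweight; exact: lt_le_trans sx.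
by rewrite oppr_le0 mulr_ge0 ?powR_ge0 ?(ltW (weight_gt0 x)).
Qed.

Lemma bessel_integral_le_div (a c : R) : 0 < a -> 0 < c ->
  bessel_integral a c <= bessel_integral (a + 1) 0 / c.
Proof.
move=> a0 c0.
have ig : leb.-integrable `]0, +oo[ (EFin \o bessel_kernel (a + 1) 0).
  by apply: bessel_kernel_integrable0 => //; rewrite addr_gt0.
rewrite /bessel_integral -RintegralZr//.
apply: le_Rintegral => //.
- exact: bessel_kernel_integrable.
- exact: integrable_mulr.
- move=> s; rewrite /= in_itv/= andbT => s0.
  have := @bessel_kernel_le_shift _ a 1 c s ltr01 c0 s0.
  by rewrite powRr1 ?divr_ge0 ?(ltW c0)// div1r [c^-1 * _]mulrC [bessel_kernel (a + 1) _ _]/bessel_kernel mul0r subr0.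
Qed.

Lemma weight_decay : exists K : R, forall T : R, 1 <= T -> T `^ m * weight T <= K / T.
Proof.
exists (bessel_integral (q^-1 + 1) 0 * q ^+ 2) => T T1.
have T0 : 0 < T by exact: lt_le_trans T1.
have h := bessel_integral_le_div nu0 (weight_arg_gt0 T0).
apply: (@le_trans _ _ (T `^ m * (bessel_integral (q^-1 + 1) 0 / weight_arg T))).
  by rewrite weight.unlock ler_wpM2l ?powR_ge0.
have B0 : 0 <= bessel_integral (q^-1 + 1) 0.
  by apply: ltW; apply: bessel_integral_gt0 => //; rewrite addr_gt0.
have -> : T `^ m * (bessel_integral (q^-1 + 1) 0 / weight_arg T) =
    bessel_integral (q^-1 + 1) 0 * q ^+ 2 * (T `^ m / T `^ q).
  by rewrite weight_argE// invf_div; ring.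
rewrite ler_wpM2l ?(mulr_ge0 B0) ?exprn_ge0 ?(ltW q0)//.
rewrite -powRB ?(gt_eqF T0) ?implybT// -[leRHS]powR_inv1 ?(ltW T0)//.
by apply: ler_powR => //; rewrite /q; have m0_ := m0; lra.
Qed.

(** The energy [coweight^2 - t^(2 m) weight^2] is nonincreasing, and its second term tends to 0
    at infinity, so it is nonnegative. *)
Lemma weight_le_coweight (t : R) : 0 < t -> t `^ m * weight t <= coweight t.
Proof.
move=> t0; have [K hK] := weight_decay.
pose E s := coweight s * coweight s - (s `^ m * weight s) * (s `^ m * weight s).
have p2 (s : R) : 0 < s -> s `^ (2 * m) = s `^ m * s `^ m.
  by move=> s0; rewrite -powRD ?(gt_eqF s0) ?implybT//; congr (_ `^ _); ring.
have dE (s : R) : 0 < s -> is_derive s 1 E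
    (- (2 * m * s `^ m * s `^ (m - 1) * weight s ^+ 2)).
  move=> s0.
  have d1 := is_derive_coweight s0; have d2 := is_derive_weight s0.
  have d3 := is_derive_powR_pos m s0.
  have d23 := is_derive1M d3 d2.
  apply: (is_derive_eq (is_derive1B (is_derive1M d1 d1) (is_derive1M d23 d23))).
  rewrite p2//.
  ring.
have Emono T : t <= T -> E T <= E t.
  move=> tT; apply: (ge_of_is_derive_le0 tT) => x tx xT.
    by apply: dE; exact: lt_le_trans tx.
  by rewrite oppr_le0 !mulr_ge0 ?powR_ge0 ?exprn_ge0 ?(ltW (weight_gt0 x)).
have E0 : 0 <= E t.
  rewrite -oppr_le0; apply: (@le0_of_le_div _ (K ^+ 2) (Num.max t 1)) => T.
  rewrite ge_max => /andP[tT T1]; have T0 : 0 < T by exact: lt_le_trans T1.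
  apply: (@le_trans _ _ (- E T)); first by rewrite lerN2 Emono.
  rewrite /E opprB -!expr2; apply: (@le_trans _ _ ((T `^ m * weight T) ^+ 2)).
    by rewrite gerBl sqr_ge0.
  have h0 : 0 <= T `^ m * weight T by rewrite mulr_ge0 ?powR_ge0 ?(ltW (weight_gt0 T)).
  have h := hK _ T1.
  apply: (@le_trans _ _ ((K / T) ^+ 2)).
    by rewrite ler_sqr ?nnegrE//; exact: le_trans h.
  rewrite exprMn ler_wpM2l ?sqr_ge0// exprVn lef_pV2 ?posrE ?exprn_gt0//.
  by rewrite expr2 ler_peMl// ltW.
rewrite -ler_sqr ?nnegrE ?(ltW (coweight_gt0 t))//.
  by rewrite -subr_ge0 !expr2.
by rewrite mulr_ge0 ?powR_ge0 ?(ltW (weight_gt0 t)).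
Qed.

(** The function [expR (- (m + 1) horizon) (coweight - (m + 1) t^m weight)] is nondecreasing
    on [1, +oo[ and bounded above by a function that tends to 0, hence it is nonpositive. *)
Lemma coweight_le_weight (t : R) : 1 <= t -> coweight t <= (m + 1) * t `^ m * weight t.
Proof.
move=> t1; have t0 : 0 < t by exact: lt_le_trans t1.
pose h s := expR (- ((m + 1) * horizon s)) * (coweight s - (m + 1) * (s `^ m * weight s)).
have p2 (s : R) : 0 < s -> s `^ (2 * m) = s `^ m * s `^ m.
  by move=> s0; rewrite -powRD ?(gt_eqF s0) ?implybT//; congr (_ `^ _); ring.
have dh (s : R) : 0 < s -> is_derive s 1 h
    (expR (- ((m + 1) * horizon s)) * weight s *
     (((m + 1) ^+ 2 - 1) * s `^ (2 * m) - m * (m + 1) * s `^ (m - 1))).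
  move=> s0.
  have d1 := is_derive_coweight s0; have d2 := is_derive_weight s0.
  have d3 := is_derive_powR_pos m s0.
  have d5 := is_derive1_expR (is_derive1N (is_derive1Ml (m + 1) (is_derive_horizon s0))).
  have d6 := is_derive1B d1 (is_derive1Ml (m + 1) (is_derive1M d3 d2)).
  apply: (is_derive_eq (is_derive1M d5 d6)).
  rewrite p2//.
  ring.
have hmono T : t <= T -> h t <= h T.
  move=> tT; apply: (le_of_is_derive_ge0 tT) => x tx xT.
    by apply: dh; exact: lt_le_trans tx.
  have x1 : 1 <= x by exact: le_trans tx.
  rewrite mulr_ge0 ?mulr_ge0 ?expR_ge0 ?(ltW (weight_gt0 x))//.
  have e : x `^ (m - 1) <= x `^ (2 * m) by apply: ler_powR => //; have m0_ := m0; lra.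
  have e0 := powR_ge0 x (2 * m).
  have mm : 0 <= m * (m + 1) by rewrite mulr_ge0// addr_ge0.
  have := ler_wpM2l mm e; have := mulr_ge0 m0 e0; nra.
have h0 : h t <= 0.
  apply: (@le0_of_le_div _ (coweight t) t) => T tT.
  have T1 : 1 <= T by exact: le_trans tT.
  have T0 : 0 < T by exact: lt_le_trans T1.
  apply: (le_trans (hmono _ tT)); rewrite /h.
  apply: (@le_trans _ _ (expR (- ((m + 1) * horizon T)) * coweight t)).
    rewrite ler_wpM2l ?expR_ge0//; apply: (@le_trans _ _ (coweight T)); last exact: coweight_nincr.
    by rewrite gerBl !mulr_ge0 ?powR_ge0 ?(ltW (weight_gt0 T)) ?addr_ge0.
  rewrite mulrC ler_wpM2l ?(ltW (coweight_gt0 t))//.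
  have m1 : m + 1 != 0 by rewrite gt_eqF// ltr_wpDl.
  rewrite /horizon mulrCA divff// mulr1 expRN lef_pV2 ?posrE ?expR_gt0//.
  apply: (@le_trans _ _ (T `^ (m + 1))).
    by apply: le1r_powR => //; have m0_ := m0; lra.
  by apply: le_trans (expR_ge1Dx _); rewrite lerDr.
move: h0; rewrite /h pmulr_rle0 ?expR_gt0// subr_le0 mulrA//.
Qed.

(** The derivative of [coweight * weight * expR (2 horizon)] is minus a square times an
    exponential. *)
Lemma coweight_weight_decay (t : R) : 1 <= t ->
  coweight t * weight t <= coweight 1 * weight 1 * expR (2 * horizon 1) * expR (- (2 * horizon t)).
Proof.
move=> t1.
pose P s := coweight s * weight s * expR (2 * horizon s).
have p2 (s : R) : 0 < s -> s `^ (2 * m) = s `^ m * s `^ m.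
  by move=> s0; rewrite -powRD ?(gt_eqF s0) ?implybT//; congr (_ `^ _); ring.
have dP (s : R) : 0 < s -> is_derive s 1 P
    (- (expR (2 * horizon s) * (coweight s - s `^ m * weight s) ^+ 2)).
  move=> s0.
  have d1 := is_derive_coweight s0; have d2 := is_derive_weight s0.
  have d5 := is_derive1_expR (is_derive1Ml 2 (is_derive_horizon s0)).
  apply: (is_derive_eq (is_derive1M (is_derive1M d1 d2) d5)).
  rewrite p2//.
  ring.
have : P t <= P 1.
  apply: (ge_of_is_derive_le0 t1) => x x1 _.
    by apply: dP; exact: lt_le_trans x1.
  by rewrite oppr_le0 mulr_ge0 ?expR_ge0// sqr_ge0.
by rewrite expRN ler_pdivlMr ?expR_gt0.
Qed.

End weights.

(** * Comparison inequalities in time *)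

Section comparison.
Context (R : realType).
Local Notation leb := (@lebesgue_measure R).

(** The right-hand side [Y] of the integral inequality satisfies [Y' = k W^p >= k Y^p], so
    [- Y^(1 - p) / (p - 1) - K] is nondecreasing. Working with [Y] asks only continuity
    of [W]. *)
Lemma blowup_integral_inequality (W k K : R -> R) (p a b : R) :
  1 < p -> a < b ->
  (forall t, a <= t -> t <= b -> 0 < W t) ->
  {within `[a, b], continuous W} ->
  (forall t, a <= t -> t <= b -> 0 <= k t) ->
  {within `[a, b], continuous k} ->
  {within `[a, b], continuous K} ->
  (forall t, a < t -> t < b -> is_derive t 1 K (k t)) ->
  (forall t, a < t -> t <= b ->
     \int[leb]_(s in `[a, t]) (k s * W s `^ p) <= W t - W a) ->
  K b - K a <= W a `^ (1 - p) / (p - 1).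
Proof.
move=> p1 ab W0 cW k0 ck cK dK hW.
pose f s := k s * W s `^ p.
have p0 : 0 < p - 1 by rewrite subr_gt0.
have cf : {within `[a, b], continuous f}.
  apply/subspace_continuousP => x xab; apply: cvgM.
    by move/subspace_continuousP : ck; exact.
  have [ax xb] : a <= x /\ x <= b by move: xab; rewrite /= in_itv/= => /andP[].
  apply: (@cvg_comp _ _ _ W (fun y => y `^ p) _ (nbhs (W x))).
    by move/subspace_continuousP : cW; exact.
  exact: powR_continuous_pos (W0 _ ax xb).
have intf : leb.-integrable `[a, b] (EFin \o f).
  by apply: continuous_compact_integrable => //; exact: segment_compact.
pose Y s := W a + \int[leb]_(x in `[a, s]) f x.
have f0 t : a <= t -> t <= b -> 0 <= f t.
  by move=> at_ tb; rewrite mulr_ge0 ?k0// powR_ge0.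
have YW t : a <= t -> t <= b -> Y t <= W t.
  move=> at_ tb; rewrite /Y.
  have [->|ta] := eqVneq t a; first by rewrite set_itv1 Rintegral_set1 addr0.
  by rewrite addrC -lerBrDr hW// lt_neqAle eq_sym ta.
have YWa t : a <= t -> t <= b -> W a <= Y t.
  move=> at_ tb; rewrite lerDl; apply: Rintegral_ge0 => x; rewrite /= in_itv/= => /andP[ax xt].
  by apply: f0 => //; exact: le_trans tb.
have Y0 t : a <= t -> t <= b -> 0 < Y t.
  by move=> at_ tb; apply: lt_le_trans (YWa _ at_ tb); apply: W0 => //; exact: ltW.
have cY : {within `[a, b], continuous Y}.
  apply/subspace_continuousP => x xab; apply: cvgD; first exact: cvg_cst.
  have := @parameterized_integral_continuous R a b f (ltW ab) intf.
  by move/subspace_continuousP; exact.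
have dY t : a < t -> t < b -> is_derive t 1 Y (f t).
  move=> at_ tb.
  have ct : {for t, continuous f}.
    move: cf => /(continuous_within_itvP _ ab) [h _ _].
    by apply: h; rewrite in_itv/= at_ tb.
  have [d1 d2] := @continuous_FTC1_closed R f a t b tb intf at_ ct.
  have d3 : is_derive t 1 (fun x => \int[leb]_(t in `[a, x]) f t) (f t).
    by split; [exact: d1|rewrite -derive1E; exact: d2].
  by have := is_deriveD (is_derive_cst (W a) t (1 : R)) d3; rewrite add0r.
pose h s := - (Y s `^ (1 - p) / (p - 1)) - K s.
have dh t : a < t -> t < b -> is_derive t 1 h (f t * Y t `^ (- p) - k t).
  move=> at_ tb.
  have Yt := Y0 t (ltW at_) (ltW tb).
  have d1 := @is_derive1_comp _ (fun y => y `^ (1 - p)) Y t _ _ (is_derive_powR_pos (1 - p) Yt) (dY t at_ tb).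
  have d2 := is_derive1B (is_derive1Ml (- (p - 1)^-1) d1) (dK t at_ tb).
  have -> : h = fun y => - (p - 1)^-1 * ((fun y => y `^ (1 - p)) \o Y) y - K y.
    by apply/funext => y; rewrite /h /= mulNr mulrC.
  apply: (is_derive_eq d2).
  have -> : 1 - p - 1 = - p by ring.
  by field; rewrite gt_eqF.
have ch : {within `[a, b], continuous h}.
  apply/subspace_continuousP => x xab.
  have [ax xb] : a <= x /\ x <= b by move: xab; rewrite /= in_itv/= => /andP[].
  apply: cvgB; last by move/subspace_continuousP : cK; exact.
  apply: cvgN; apply: cvgM; last exact: cvg_cst.
  apply: (@cvg_comp _ _ _ Y (fun y => y `^ (1 - p)) _ (nbhs (Y x))).
    by move/subspace_continuousP : cY; exact.
  exact: powR_continuous_pos (Y0 _ ax xb).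
have [|c cab e] := @MVT R h (fun t => f t * Y t `^ (- p) - k t) a b ab _ ch.
  by move=> x; rewrite in_itv/= => /andP[ax xb]; exact: dh.
move: cab; rewrite in_itv/= => /andP[ac cb].
have [ac' cb'] := (ltW ac, ltW cb).
have hab : 0 <= h b - h a.
  rewrite e mulr_ge0 ?subr_ge0 ?(ltW ab)// /f -mulrA ler_peMr ?k0//.
  rewrite powRN ler_pdivlMr ?powR_gt0 ?Y0// mul1r.
  by apply: ge0_ler_powR; rewrite ?nnegrE ?(ltW (Y0 _ _ _)) ?(ltW (W0 _ _ _)) ?YW//; lra.
move: hab; rewrite /h.
have -> : Y a = W a by rewrite /Y set_itv1 Rintegral_set1 addr0.
have : 0 <= Y b `^ (1 - p) / (p - 1) by rewrite divr_ge0 ?powR_ge0// ltW.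
set A := Y b `^ _ / _; set B := W a `^ _ / _; lra.
Qed.

Section lower_bound.
Context (m : R) (m0 : 0 <= m).
Local Notation weight := (weight m).
Local Notation coweight := (coweight m).

Lemma coweight_weight_small (e : R) : 0 < e ->
  exists2 t0, 1 <= t0 & forall t, t0 <= t -> coweight t * weight t <= e.
Proof.
move=> e0.
have [C C0 hC] : exists2 C, 0 < C &
    forall t, 1 <= t -> coweight t * weight t <= C * expR (- (2 * horizon m t)).
  exists (coweight 1 * weight 1 * expR (2 * horizon m 1)).
    apply: mulr_gt0 (expR_gt0 _).
    exact: mulr_gt0 (coweight_gt0 m0 1) (weight_gt0 m0 1).
  by move=> t; exact: coweight_weight_decay.
have m1 : 0 < m + 1 by rewrite ltr_wpDl.
exists (Num.max 1 (C * (m + 1) / (2 * e))); first by rewrite le_max lexx.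
move=> t; rewrite ge_max => /andP[t1 tC].
have t0 : 0 < t by exact: lt_le_trans t1.
apply: (le_trans (hC t t1)).
rewrite expRN ler_pdivrMr ?expR_gt0//.
apply: (@le_trans _ _ (e * (2 * horizon m t))); last first.
  rewrite ler_wpM2l ?(ltW e0)//; apply: le_trans (expR_ge1Dx _).
  by rewrite lerDr.
apply: (@le_trans _ _ (e * (2 * (t / (m + 1))))).
  move: tC; rewrite ler_pdivrMr ?mulr_gt0// => tC.
  have -> : e * (2 * (t / (m + 1))) = t * (2 * e) / (m + 1) by ring.
  by rewrite ler_pdivlMr.
rewrite ler_wpM2l ?(ltW e0)// ler_wpM2l// /horizon ler_wpM2r ?invr_ge0 ?(ltW m1)//.
by apply: le1r_powR => //; have m0_ := m0; lra.
Qed.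

(** The quotient [V / weight] has derivative [W / weight^2], with [W] nondecreasing, whereas
    [coweight <= (m + 1) t^m weight] makes the derivative of [1 / (coweight weight)] at least
    [1 / ((1 - d) weight^2)], for [d = 1 / ((m + 1)^2 + 1)]. Integrating from time 1,
    [coweight V <= (1 - d) W + coweight weight V(1) / weight(1)], where the last term is small
    for large times: the velocity term keeps a fixed share of [W]. The bound of [V 0] by [C1 W]
    makes the time [t0] the same for all solutions. *)
Lemma weight_velocity_lower_bound (C1 : R) : 0 <= C1 ->
  exists2 t0, 1 <= t0 & exists2 d, 0 < d &
  forall (U V : R -> R) (tau : R),
  let W t := weight t * U t + coweight t * V t in
  (forall t, 0 < t -> t < tau -> is_derive t 1 V (U t)) ->
  V t @[t --> 0^'+] --> V 0 ->
  (forall s t, 0 < s -> s <= t -> t < tau -> W s <= W t) ->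
  (forall t, 0 < t -> t < tau -> 0 < W t /\ V 0 <= C1 * W t) ->
  forall t, t0 <= t -> t < tau -> d * W t <= weight t * U t.
Proof.
move=> C10.
pose d := ((m + 1) ^+ 2 + 1)^-1.
have M0 : 0 < (m + 1) ^+ 2 + 1 by rewrite ltr_wpDl ?sqr_ge0.
have d0 : 0 < d by rewrite invr_gt0.
have dE : d * ((m + 1) ^+ 2) = 1 - d by rewrite /d; field; rewrite gt_eqF.
pose C2 := C1 / weight 0 + (weight 1 ^+ 2)^-1.
have w0 t : 0 < weight t by exact: weight_gt0.
have l0 t : 0 < coweight t by exact: coweight_gt0.
have C20 : 0 < C2.
  by rewrite /C2 ltr_wpDl ?divr_ge0 ?(ltW (w0 _))// invr_gt0 exprn_gt0.
have e0 : 0 < d / (2 * C2) by rewrite divr_gt0// mulr_gt0.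
have [t0 t01 ht0] := coweight_weight_small e0.
exists t0 => //; exists (d / 2); first by rewrite divr_gt0.
move=> U V tau W dV V0 Wmono Wp t tt0 ttau.
have t1 : 1 <= t by exact: le_trans tt0.
have tp : 0 < t by exact: lt_le_trans t1.
have Wt0 := (Wp t tp ttau).1.
pose r s := V s / weight s.
have rE s : r s = V s / weight s by [].
have dr s : 0 < s -> s < tau -> is_derive s 1 r (W s / weight s ^+ 2).
  move=> s0 st.
  have h : weight s != 0 by rewrite gt_eqF.
  have d1 := @is_deriveV _ weight s _ _ h (is_derive_weight m0 s0).
  apply: (is_derive_eq (is_derive1M (dV s s0 st) d1)).
  by rewrite /GRing.scale/= /W; field.
clearbody r.
have wmono s : 0 < s -> s <= 1 -> weight 1 <= weight s.
  move=> s0 s1; apply: (ge_of_is_derive_le0 s1) => x sx _.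
    by apply: is_derive_weight => //; exact: lt_le_trans sx.
  by rewrite oppr_le0 ltW.
(* Up to time 1 the weight stays above [weight 1], so the mean value theorem bounds [r 1]. *)
have r1 : r 1 <= C2 * W t.
  have cr : {within `[0, 1], continuous r}.
    apply/continuous_within_itvP => //; split.
    - move=> x; rewrite in_itv/= => /andP[x0 x1].
      apply: is_derive_continuous (dr x x0 _).
      by apply: lt_trans ttau; exact: lt_le_trans t1.
    - rewrite rE (_ : r = fun s => V s / weight s); last by apply/funext.
      apply: cvgM => //; apply: cvgV; first by rewrite gt_eqF.
      by apply: cvg_at_right_filter; exact: weight_continuous.
    - apply: cvg_at_left_filter; apply: is_derive_continuous (dr 1 _ _) => //.
      exact: le_lt_trans ttau.
  have [|c] := @MVT R r (fun s => W s / weight s ^+ 2) 0 1 ltr01 _ cr.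
    move=> x; rewrite in_itv/= => /andP[x0 x1]; apply: dr => //.
    by apply: lt_trans ttau; exact: lt_le_trans t1.
  rewrite in_itv/= => /andP[c0 c1]; rewrite subr0 mulr1 => e.
  have -> : r 1 = r 0 + W c / weight c ^+ 2 by rewrite -e addrC subrK.
  have -> : C2 * W t = C1 / weight 0 * W t + (weight 1 ^+ 2)^-1 * W t by rewrite -mulrDl.
  apply: lerD.
    rewrite rE mulrAC ler_wpM2r ?invr_ge0 ?(ltW (w0 _))//.
    exact: (Wp t tp ttau).2.
  have ct : c <= t by apply: ltW; exact: lt_le_trans t1.
  rewrite mulrC ler_pM ?invr_ge0 ?exprn_ge0 ?(ltW (w0 _))//.
  - exact: (ltW (Wp c c0 (le_lt_trans ct ttau)).1).
  - rewrite lef_pV2 ?posrE ?exprn_gt0// ler_sqr ?nnegrE ?(ltW (w0 _))//.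
    by apply: wmono => //; exact: ltW.
  - exact: Wmono.
pose P s := coweight s * weight s.
have PE s : P s = coweight s * weight s by [].
have P0 s : 0 < P s by rewrite mulr_gt0.
pose h s := r s - (1 - d) * W t * (P s)^-1.
have dh s : 0 < s -> s < tau -> is_derive s 1 h (W s / weight s ^+ 2 -
   (1 - d) * W t * ((weight s ^+ 2)^-1 + s `^ (2 * m) / coweight s ^+ 2)).
  move=> s0 st.
  have nP : P s != 0 by rewrite gt_eqF.
  have d1 := @is_deriveV _ P s _ _ nP (is_derive1M (is_derive_coweight m0 s0) (is_derive_weight m0 s0)).
  apply: (is_derive_eq (is_derive1B (dr s s0 st) (is_derive1Ml ((1 - d) * W t) d1))).
  rewrite /GRing.scale/= /P; field.
  by rewrite !gt_eqF.
(* [h] compares [V / weight] with the multiple of [1 / P] that dominates its growth. *)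
have hmono : h t <= h 1.
  apply: (ge_of_is_derive_le0 t1) => x x1 xt.
    by apply: dh; [exact: lt_le_trans x1|exact: le_lt_trans ttau].
  have x0 : 0 < x by exact: lt_le_trans x1.
  have WW : W x <= W t by exact: Wmono.
  apply: (@le_trans _ _ (W t * ((weight x ^+ 2)^-1 - (1 - d) *
     ((weight x ^+ 2)^-1 + x `^ (2 * m) / coweight x ^+ 2)))).
    rewrite mulrBr -[(1 - d) * W t]mulrC -mulrA lerD2r.
    by rewrite ler_wpM2r ?invr_ge0 ?exprn_ge0 ?(ltW (w0 _)).
  rewrite pmulr_rle0//.
  have L : coweight x ^+ 2 <= (m + 1) ^+ 2 * (x `^ (2 * m) * weight x ^+ 2).
    have -> : x `^ (2 * m) = (x `^ m) ^+ 2 by rewrite mulrC powRrM powR_mulrn ?powR_ge0.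
    rewrite -!exprMn mulrA ler_sqr ?nnegrE ?(ltW (l0 _))//; first exact: coweight_le_weight.
    by rewrite !mulr_ge0 ?addr_ge0 ?powR_ge0 ?(ltW (w0 _)).
  have W2 : 0 < weight x ^+ 2 by rewrite exprn_gt0.
  have L2 : 0 < coweight x ^+ 2 by rewrite exprn_gt0.
  have : d / weight x ^+ 2 <= (1 - d) * (x `^ (2 * m) / coweight x ^+ 2).
    rewrite -dE mulrA ler_pdivlMr// mulrAC ler_pdivrMr// -!mulrA ler_wpM2l ?(ltW d0)//.
    by rewrite mulrA -expr2; exact: L.
  by lra.
have : coweight t * V t <= (1 - d) * W t + P t * r 1.
  have -> : coweight t * V t = P t * r t by rewrite PE rE; field; rewrite gt_eqF.
  rewrite -lerBlDr -mulrBr; move: hmono; rewrite /h => hm.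
  have hP1 : 0 <= (1 - d) * W t * (P 1)^-1.
    have d1 : 0 <= 1 - d by rewrite -dE mulr_ge0 ?sqr_ge0// ltW.
    by apply: divr_ge0 (ltW (P0 1)); apply: mulr_ge0 d1 (ltW Wt0).
  have -> : (1 - d) * W t = P t * ((1 - d) * W t * (P t)^-1).
    by field; rewrite gt_eqF.
  by rewrite ler_wpM2l ?(ltW (P0 _))//; lra.
have := ht0 t tt0; rewrite -PE => hP.
have : P t * r 1 <= d / (2 * C2) * (C2 * W t).
  apply: (@le_trans _ _ (P t * (C2 * W t))); first by rewrite ler_wpM2l// ltW.
  by rewrite ler_wpM2r// mulr_ge0// ltW.
have -> : d / (2 * C2) * (C2 * W t) = d / 2 * W t by field; rewrite gt_eqF.
set A := weight t * U t; set B := coweight t * V t.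
have : W t = A + B by [].
move: (P t * r 1) (W t) => x w; lra.
Qed.

End lower_bound.

End comparison.

(** * Smooth functions *)

Section Ck_calculus.
Context (R : realType) (V : normedModType R).
Implicit Types (f g : V -> R) (U : set V).

Lemma is_derive_lineP f (x v : V) (df : R) :
  is_derive x v f df <-> is_derive (0 : R) 1 (fun h : R => f (h *: v + x)) df.
Proof.
have e : (fun h : R => h^-1 *: ((f \o shift x) (h *: v) - f x)) =
    (fun h : R => h^-1 *: (((fun h : R => f (h *: v + x)) \o shift 0) (h *: (1 : R)) -
       (fun h : R => f (h *: v + x)) 0)).
  by apply/funext => h /=; rewrite addr0 scale0r add0r [_%:A]mulr1.
by split => -[d1 d2]; split; move: d1 d2; rewrite /derivable /derive e.
Qed.

Lemma is_derive_comp1 (F : R -> R) f (x v : V) (dF df : R) :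
  is_derive (f x) 1 F dF -> is_derive x v f df -> is_derive x v (F \o f) (dF * df).
Proof.
move=> hF /is_derive_lineP hf; apply/is_derive_lineP.
apply: (@is_derive1_comp _ F (fun h : R => f (h *: v + x))) => //.
by rewrite scale0r add0r.
Qed.

Lemma Ck_onW U k f : Ck_on U k.+1 f -> Ck_on U k f.
Proof.
elim: k f => [f [c _] //|k IH f [c d]]; split => // v.
by have [d1 d2] := d v; split => //; exact: IH.
Qed.

Lemma Ck_on_subset U U' k f : U' `<=` U -> Ck_on U k f -> Ck_on U' k f.
Proof.
move=> UU; elim: k f => [f [c _]|k IH f [c d]]; split => //; try by move=> x /UU; exact: c.
by move=> v; have [d1 d2] := d v; split => [x /UU|]; [exact: d1|exact: IH].
Qed.

Lemma Ck_on_eq U k f g : open U -> (forall x, U x -> f x = g x) ->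
  Ck_on U k f -> Ck_on U k g.
Proof.
move=> oU; elim: k f g => [|k IH] f g fg [c d]; split.
- move=> x Ux; have nU : nbhs x U by exact: open_nbhs_nbhs.
  rewrite /prop_for /continuous_at -(fg _ Ux); apply: cvg_trans (c _ Ux).
  by apply: near_eq_cvg; apply: filterS nU => y /fg.
- by [].
- move=> x Ux; have nU : nbhs x U by exact: open_nbhs_nbhs.
  rewrite /prop_for /continuous_at -(fg _ Ux); apply: cvg_trans (c _ Ux).
  by apply: near_eq_cvg; apply: filterS nU => y /fg.
- move=> v; have [d1 d2] := d v; split.
    move=> x Ux; have nU : nbhs x U by exact: open_nbhs_nbhs.
    apply: near_eq_derivable (d1 _ Ux).
    by apply: filterS nU => y /fg.
  apply: IH d2 => x Ux; have nU : nbhs x U by exact: open_nbhs_nbhs.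
  apply: near_eq_derive.
  by apply: filterS nU => y /fg.
Qed.

Lemma Ck_on_cst U k (c : R) : open U -> Ck_on U k (fun=> c).
Proof.
move=> oU; elim: k c => [|k IH] c; split => //; try by move=> x _; exact: cst_continuous.
move=> v; split; first by move=> x _; exact: derivable_cst.
by apply: (@Ck_on_eq _ _ (fun=> 0) _ oU) => // x _; rewrite derive_cst.
Qed.

Lemma Ck_onD U k f g : open U ->
  Ck_on U k f -> Ck_on U k g -> Ck_on U k (fun x => f x + g x).
Proof.
move=> oU; elim: k f g => [|k IH] f g [cf df] [cg dg]; split => //.
- by move=> x Ux; apply: continuousD; [exact: cf|exact: cg].
- by move=> x Ux; apply: continuousD; [exact: cf|exact: cg].
move=> v; have [d1 d2] := df v; have [e1 e2] := dg v; split.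
  by move=> x Ux; apply: derivableD; [exact: d1|exact: e1].
apply: (Ck_on_eq oU _ (IH _ _ d2 e2)) => x Ux.
by rewrite deriveD; [|exact: d1|exact: e1].
Qed.

Lemma Ck_onM U k f g : open U ->
  Ck_on U k f -> Ck_on U k g -> Ck_on U k (fun x => f x * g x).
Proof.
move=> oU; elim: k f g => [|k IH] f g hf hg;
  have [cf df] := hf; have [cg dg] := hg; split => //.
- by move=> x Ux; apply: continuousM; [exact: cf|exact: cg].
- by move=> x Ux; apply: continuousM; [exact: cf|exact: cg].
move=> v; have [d1 d2] := df v; have [e1 e2] := dg v; split.
  by move=> x Ux; apply: derivableM; [exact: d1|exact: e1].
apply: (Ck_on_eq oU _ (Ck_onD oU (IH _ _ (Ck_onW hf) e2) (IH _ _ (Ck_onW hg) d2))) => x Ux.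
by rewrite deriveM; [|exact: d1|exact: e1].
Qed.

Lemma Ck_on_sum U k n (f : 'I_n -> V -> R) : open U ->
  (forall i, Ck_on U k (f i)) -> Ck_on U k (fun x => \sum_(i < n) f i x).
Proof.
move=> oU; elim: n f => [|n IH] f hf.
  by apply: (Ck_on_eq oU _ (Ck_on_cst k 0 oU)) => x _; rewrite big_ord0.
apply: (Ck_on_eq oU _ (Ck_onD oU (hf ord0) (IH _ (fun i => hf (lift ord0 i))))) => x _.
by rewrite big_ord_recl.
Qed.

Lemma Ck_on_comp U (I : set R) k (F : R -> R) f : open U ->
  Ck_on I k F -> (forall x, U x -> I (f x)) -> Ck_on U k f -> Ck_on U k (F \o f).
Proof.
move=> oU; elim: k F f => [|k IH] F f [cF dF] UI hf; have [cf df] := hf; split => //.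
- by move=> x Ux; apply: continuous_comp; [exact: cf|exact/cF/UI].
- by move=> x Ux; apply: continuous_comp; [exact: cf|exact/cF/UI].
move=> v; have [d1 d2] := df v; have [e1 e2] := dF 1.
have h x : U x -> is_derive x v (F \o f) ('D_1 F (f x) * 'D_v f x).
  move=> Ux; apply: is_derive_comp1; first by apply: derivableP; exact/e1/UI.
  by apply: derivableP; exact: d1.
split; first by move=> x /h [].
apply: (Ck_on_eq oU _ (Ck_onM oU (IH _ _ e2 UI (Ck_onW hf)) d2)) => x Ux.
by have [_ ->] := h x Ux.
Qed.

Lemma Ck_on_linear k f : continuous f ->
  (forall (h : R) x v, f (h *: v + x) = h * f v + f x) -> Ck_on setT k f.
Proof.
move=> cf lf.
have d x v : is_derive x v f (f v).
  apply/is_derive_lineP.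
  rewrite (_ : (fun h => _) = (fun h => f x + f v * h)); last first.
    by apply/funext => h; rewrite lf addrC mulrC.
  by apply: is_derive_eq; rewrite add0r mul1r [_%:A]mulr1.
case: k => [|k]; split => //; try by move=> x _; exact: cf.
move=> v; split; first by move=> x _; have := d x v => -[].
apply: (Ck_on_eq openT _ (Ck_on_cst k (f v) openT)) => x _.
by have [_ ->] := d x v.
Qed.

End Ck_calculus.

Section Ck_real.
Context (R : realType).
Implicit Types (F dF : R -> R) (I : set R).

(** Each concrete function below is shown smooth in this way: its derivative is an expression
    in functions already known to be C^k. *)
Lemma Ck_on_primitive I k F dF : open I ->
  (forall x, I x -> is_derive x 1 F (dF x)) -> Ck_on I k dF -> Ck_on I k.+1 F.
Proof.
move=> oI d hd; split.
  by move=> x Ix; exact: is_derive_continuous (d x Ix).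
have dv x v : I x -> is_derive x v F (dF x * v).
  move=> Ix; exact: (@is_derive_comp1 R R F id x v (dF x) v (d x Ix) (is_derive_id _ _)).
move=> v; split; first by move=> x Ix; have [] := dv x v Ix.
apply: (Ck_on_eq oI _ (Ck_onM oI hd (Ck_on_cst k v oI))) => x Ix.
by have [_ ->] := dv x v Ix.
Qed.

Lemma Ck0_of_is_derive I F dF : open I ->
  (forall x, I x -> is_derive x 1 F (dF x)) -> Ck_on I 0 F.
Proof. by move=> oI d; split => // x Ix; exact: is_derive_continuous (d x Ix). Qed.

Lemma smooth_expR : smooth_on setT (@expR R).
Proof.
elim => [|k IH]; first by split => // x _; exact: continuous_expR.
exact: (Ck_on_primitive openT (fun x _ => is_derive_expR x) IH).
Qed.

Lemma open_gt0 : open [set x : R | 0 < x].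
Proof. exact: open_gt. Qed.

Lemma smooth_powR (a : R) : smooth_on [set x : R | 0 < x] (fun x => x `^ a).
Proof.
move=> k; elim: k a => [|k IH] a.
  by split => // x; exact: powR_continuous_pos.
apply: (Ck_on_primitive open_gt0 (fun x => @is_derive_powR_pos R a x)).
by apply: Ck_onM (IH _); [exact: open_gt0|apply: Ck_on_cst; exact: open_gt0].
Qed.

(** Each weight is, up to a smooth factor, the derivative of the other, so both gain one order
    at a time. *)
Lemma smooth_weight (m : R) : 0 <= m ->
  smooth_on [set x : R | 0 < x] (weight m) /\ smooth_on [set x : R | 0 < x] (coweight m).
Proof.
move=> m0.
suff h k : Ck_on [set x : R | 0 < x] k (weight m) /\ Ck_on [set x : R | 0 < x] k (coweight m).
  by split => k; have [] := h k.
have o := open_gt0.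
elim: k => [|k [IH1 IH2]].
  by split; split => // x _; [exact: weight_continuous|exact: coweight_continuous].
have cN f : Ck_on [set x : R | 0 < x] k f -> Ck_on [set x : R | 0 < x] k (fun x => - f x).
  move=> hf; apply: (Ck_on_eq o _ (Ck_onM o (Ck_on_cst k (-1) o) hf)) => x _.
  by rewrite mulN1r.
split.
  apply: (Ck_on_primitive o (fun x => @is_derive_weight R m m0 x)).
  exact: cN.
apply: (Ck_on_primitive o (fun x => @is_derive_coweight R m m0 x)).
by apply: cN; apply: Ck_onM IH1 => //; exact: smooth_powR.
Qed.

End Ck_real.

Section bump.
Context (R : realType).

(** The function [x^-k expR (- 1 / x)] extended by 0. The derivative of a member of the family
    is a combination of members, so smoothness is proved for all [k] at once. *)
Definition flat (k : nat) (x : R) : R := if 0 < x then x^-1 ^+ k * expR (- x^-1) else 0.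

Lemma flat_le0 k x : x <= 0 -> flat k x = 0.
Proof. by rewrite /flat leNgt => /negbTE ->. Qed.

Lemma flat_gt0 k x : 0 < x -> flat k x = x^-1 ^+ k * expR (- x^-1).
Proof. by rewrite /flat => ->. Qed.

Lemma flat_ge0 k x : 0 <= flat k x.
Proof.
rewrite /flat; case: ifPn => // x0; rewrite mulr_ge0 ?expR_ge0// exprn_ge0// invr_ge0.
exact: ltW.
Qed.

Lemma flat_sqr k x : `|flat k x| <= (k.+2)`!%:R * x ^+ 2.
Proof.
rewrite ger0_norm ?flat_ge0//; have [x0|x0] := leP x 0.
  by rewrite flat_le0// mulr_ge0 ?sqr_ge0.
rewrite flat_gt0//.
have y0 : 0 < x^-1 by rewrite invr_gt0.
have h := @expR_ge1Dxn R x^-1 k.+1 (ltW y0).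
rewrite expRN ler_pdivrMr ?expR_gt0//.
apply: (@le_trans _ _ ((k.+2)`!%:R * x ^+ 2 * (x^-1 ^+ k.+2 / (k.+2)`!%:R))).
  have -> : (k.+2)`!%:R * x ^+ 2 * (x^-1 ^+ k.+2 / (k.+2)`!%:R) =
     x^-1 ^+ k * (x * x^-1) ^+ 2 * ((k.+2)`!%:R / (k.+2)`!%:R).
    by rewrite -addn2 exprD exprMn; ring.
  by rewrite divff ?gt_eqF// divff ?expr1n ?mulr1// pnatr_eq0 -lt0n fact_gt0.
rewrite ler_wpM2l ?(mulr_ge0 _ (sqr_ge0 _))//.
by apply: le_trans h; rewrite lerDr.
Qed.

Lemma is_derive_quadratic0 (f : R -> R) (C : R) :
  (forall x, `|f x| <= C * x ^+ 2) -> is_derive (0 : R) 1 f 0.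
Proof.
move=> hf; apply/is_derive1_caratheodory.
have f0 : f 0 = 0.
  by apply/eqP; rewrite -normr_le0; apply: le_trans (hf 0) _; rewrite expr0n mulr0.
have C0 : 0 <= C by apply: le_trans (normr_ge0 (f 1)) _; apply: le_trans (hf 1) _; rewrite expr1n mulr1.
exists (fun x => f x / x); split; last by rewrite invr0 mulr0.
  move=> z; rewrite f0 !subr0; have [->|z0] := eqVneq z 0; first by rewrite f0 mulr0.
  by rewrite divfK.
rewrite /prop_for /continuous_at invr0 mulr0.
apply/cvgrPdist_le => e e0.
have h : \forall y \near (0 : R), `|y| <= e / (C + 1).
  by apply: nbhs0_le; rewrite divr_gt0// ltr_wpDl.
apply: filterS h => y h; rewrite sub0r normrN.
have [->|y0] := eqVneq y 0; first by rewrite invr0 mulr0 normr0 ltW.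
rewrite normrM normfV ler_pdivrMr ?normr_gt0//.
apply: (le_trans (hf y)); rewrite -real_normK ?num_real// expr2 mulrA ler_wpM2r//.
move: h; rewrite ler_pdivlMr ?ltr_wpDl// => h.
apply: le_trans h; rewrite mulrC ler_wpM2l// lerDl//.
Qed.

Lemma is_derive_flat k (x : R) : is_derive x 1 (flat k) (flat k.+2 x - k%:R * flat k.+1 x).
Proof.
have [x0|x0|->] := ltgtP x 0; last 1 first.
- rewrite !flat_le0 ?lexx// mulr0 subr0.
  exact: is_derive_quadratic0 (flat_sqr k).
- rewrite !flat_le0 ?(ltW x0)// mulr0 subr0.
  apply: (near_eq_is_derive _ (is_derive_cst 0 x (1 : R))).
  by near=> y; rewrite flat_le0//; apply: ltW; near: y; exact: lt_nbhsl.
- rewrite !flat_gt0//.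
  have xn : id x != 0 by rewrite gt_eqF.
  have d1 := @is_deriveV _ id x _ _ xn (is_derive_id _ (1 : R)).
  have d3 := is_derive1_expR (is_derive1N d1).
  have d2 := is_deriveX k d1.
  have d4 := is_derive1M d2 d3.
  rewrite (_ : _ - _ = (k%:R * x^-1 ^+ k.-1) *: (- x^-2 *: 1) * expR (- x^-1) +
     (GRing.inv ^+ k) x * (- (- x^-2 *: 1) * expR (- x^-1))); last first.
    rewrite /GRing.scale/= mulr1 opprK fctE.
    case: {d2 d4} k => [|k]; first by rewrite !mul0r add0r subr0 expr0 mul1r exprVn.
    have -> : x ^- 2 = x^-1 * x^-1 by rewrite -exprVn expr2.
    by rewrite -[k.+1.-1]/k !exprS; ring.
  apply: (near_eq_is_derive _ d4).
  near=> y; rewrite flat_gt0 ?fctE//; near: y; exact: lt_nbhsr.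
Unshelve. all: by end_near. Qed.

Lemma smooth_flat k : smooth_on setT (flat k).
Proof.
move=> j; elim: j k => [|j IH] k.
  exact: (Ck0_of_is_derive openT (fun x _ => is_derive_flat k x)).
apply: (Ck_on_primitive openT (fun x _ => is_derive_flat k x)).
apply: (Ck_on_eq openT _ (Ck_onD openT (IH k.+2)
  (Ck_onM openT (Ck_on_cst j (- k%:R) openT) (IH k.+1)))) => x _.
by rewrite mulNr.
Qed.

Lemma flat_nd x y : x <= y -> flat 0 x <= flat 0 y.
Proof.
move=> xy; have [x0|x0] := leP x 0; first by rewrite (flat_le0 _ x0) flat_ge0.
have y0 : 0 < y by exact: lt_le_trans xy.
by rewrite !flat_gt0// !expr0 !mul1r ler_expR lerN2 lef_pV2.
Qed.

(** It is 1 where [flat 0] vanishes, and it vanishes once [flat 0] has passed its value at 1. *)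
Definition step (x : R) : R := flat 0 (1 - flat 0 x / flat 0 1) / flat 0 1.

Let f1 : 0 < flat 0 1.
Proof. by rewrite flat_gt0// expr0 mul1r expR_gt0. Qed.

Lemma step_le0 x : x <= 0 -> step x = 1.
Proof. by move=> x0; rewrite /step (flat_le0 _ x0) mul0r subr0 divff ?gt_eqF. Qed.

Lemma step_ge1 x : 1 <= x -> step x = 0.
Proof.
move=> x1; rewrite /step (@flat_le0 _ (1 - _)) ?mul0r//.
by rewrite subr_le0 ler_pdivlMr// mul1r flat_nd.
Qed.

Lemma step_ge0 x : 0 <= step x.
Proof. by rewrite /step divr_ge0 ?flat_ge0. Qed.

Lemma step_le1 x : step x <= 1.
Proof.
rewrite /step ler_pdivrMr// mul1r flat_nd// gerBl divr_ge0 ?flat_ge0//.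
Qed.

Lemma smooth_step : smooth_on setT step.
Proof.
move=> k.
have h : Ck_on setT k (fun x => 1 + (- (flat 0 1)^-1) * flat 0 x).
  apply: Ck_onD (Ck_on_cst _ _ openT) _; first exact: openT.
  by apply: Ck_onM (Ck_on_cst _ _ openT) (smooth_flat 0 k); exact: openT.
have h2 := Ck_on_comp openT (smooth_flat 0 k) (fun x _ => I) h.
apply: (Ck_on_eq openT _ (Ck_onM openT h2 (Ck_on_cst k (flat 0 1)^-1 openT))) => x _ /=.
by rewrite /step mulNr [_^-1 * _]mulrC.
Qed.

End bump.

(** * Test functions *)

Section precomposition.
Context (R : realType) (V V' : normedModType R) (L : V -> V').
Hypothesis cL : continuous L.
Hypothesis linL : forall (h : R) x v, L (h *: v + x) = h *: L v + L x.

Lemma is_derive_precomp (f : V' -> R) x v (df : R) :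
  is_derive (L x) (L v) f df -> is_derive x v (f \o L) df.
Proof.
move=> /is_derive_lineP d; apply/is_derive_lineP.
rewrite (_ : (fun h => _) = (fun h : R => f (h *: L v + L x)))//.
by apply/funext => h /=; rewrite linL.
Qed.

Lemma Ck_on_precomp k (f : V' -> R) : Ck_on setT k f -> Ck_on setT k (f \o L).
Proof.
elim: k f => [|k IH] f [cf df]; split => //.
- by move=> x _; apply: continuous_comp; [exact: cL|exact: cf].
- by move=> x _; apply: continuous_comp; [exact: cL|exact: cf].
have d x v : is_derive x v (f \o L) ('D_(L v) f (L x)).
  by apply: is_derive_precomp; apply: derivableP; exact: (df (L v)).1.
move=> v; split; first by move=> x _; have [] := d x v.
apply: (Ck_on_eq openT _ (IH _ (df (L v)).2)) => x _.
by have [_ ->] := d x v.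
Qed.

End precomposition.

Section compact_support.
Context (R : realType) (V : normedModType R).

Lemma derive_outside_compact (f : V -> R) (K : set V) v x :
  compact K -> (forall y, ~ K y -> f y = 0) -> ~ K x -> 'D_v f x = 0.
Proof.
move=> cK f0 nKx.
have oK : open (~` K) by apply: closed_openC; exact: compact_closed.
rewrite (@near_eq_derive _ _ _ f (cst 0)) ?derive_cst//.
have : nbhs x (~` K) by exact: open_nbhs_nbhs.
by apply: filterS => y /f0.
Qed.

Lemma compactly_supported_derive (f : V -> R) v :
  compactly_supported_in setT f -> compactly_supported_in setT ('D_v f).
Proof.
move=> [K [cK _ f0]]; exists K; split => // x _ nKx.
by apply: derive_outside_compact cK _ nKx => y nKy; exact: f0.
Qed.

Lemma smooth_derive (f : V -> R) v : smooth_on setT f -> smooth_on setT ('D_v f).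
Proof. by move=> sf k; have [_ /(_ v)[]] := sf k.+1. Qed.

Lemma smooth_derivable (f : V -> R) x v : smooth_on setT f -> derivable f x v.
Proof. by move=> sf; have [_ /(_ v)[d _]] := sf 1%N; exact: d. Qed.

Lemma smooth_continuous (f : V -> R) : smooth_on setT f -> continuous f.
Proof. by move=> sf x; have [c _] := sf 0%N; exact: c. Qed.

End compact_support.

Section spatial.
Context (R : realType) (n : nat).
Local Notation E := 'rV[R]_n.+1.

Definition sqnorm (x : E) : R := \sum_(i < n.+1) x ord0 i ^+ 2.

(** A positive function equal to its own Laplacian. *)
Definition plane_exp (x : E) : R := expR (x ord0 ord0).

Definition cutoff_exp (r : R) (x : E) : R := plane_exp x * step (sqnorm x - r ^+ 2).

Definition box (r : R) : set E := [set x | forall i, `[- r, r]%classic (x ord0 i)].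

Lemma smooth_coord (i : 'I_n.+1) : smooth_on setT (fun x : E => x ord0 i).
Proof.
by move=> k; apply: Ck_on_linear => [|h x v]; [exact: coord_continuous|rewrite !mxE].
Qed.

Lemma smooth_plane_exp : smooth_on setT plane_exp.
Proof.
by move=> k; apply: (Ck_on_comp openT (@smooth_expR R k) _ (smooth_coord ord0 k)).
Qed.

Lemma smooth_sqnorm : smooth_on setT sqnorm.
Proof.
move=> k; apply: Ck_on_sum; first exact: openT.
move=> i; apply: (Ck_on_eq openT _ (Ck_onM openT (smooth_coord i k) (smooth_coord i k))) => x _.
by rewrite expr2.
Qed.

Lemma smooth_cutoff_exp r : smooth_on setT (cutoff_exp r).
Proof.
move=> k; apply: Ck_onM (smooth_plane_exp k) _; first exact: openT.
apply: (Ck_on_comp openT (@smooth_step R k)) => //.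
by apply: Ck_onD (smooth_sqnorm k) (Ck_on_cst k _ openT); exact: openT.
Qed.

Lemma plane_exp_gt0 x : 0 < plane_exp x. Proof. exact: expR_gt0. Qed.

Lemma cutoff_exp_ge0 r x : 0 <= cutoff_exp r x.
Proof. by rewrite mulr_ge0 ?step_ge0// ltW// plane_exp_gt0. Qed.

Lemma cutoff_exp_le r x : cutoff_exp r x <= plane_exp x.
Proof. by rewrite ler_piMr ?step_le1// ltW// plane_exp_gt0. Qed.

Lemma cutoff_exp_in r x : sqnorm x <= r ^+ 2 -> cutoff_exp r x = plane_exp x.
Proof. by move=> h; rewrite /cutoff_exp step_le0 ?mulr1// subr_le0. Qed.

Lemma cutoff_exp_out r x : r ^+ 2 + 1 <= sqnorm x -> cutoff_exp r x = 0.
Proof. by move=> h; rewrite /cutoff_exp step_ge1 ?mulr0// lerBrDl. Qed.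

Lemma coord_sqr_le (x : E) (i : 'I_n.+1) : x ord0 i ^+ 2 <= sqnorm x.
Proof.
by rewrite /sqnorm (bigD1 i)//= lerDl sumr_ge0// => j _; exact: sqr_ge0.
Qed.

Lemma sqnorm_box r x : 0 <= r -> sqnorm x <= r ^+ 2 -> box r x.
Proof.
move=> r0 h i; rewrite /= in_itv/= -ler_norml.
rewrite -ler_sqr ?nnegrE// real_normK ?num_real//.
exact: le_trans (coord_sqr_le x i) h.
Qed.

Lemma cutoff_exp_box r x : 0 <= r -> ~ box (r + 1) x -> cutoff_exp r x = 0.
Proof.
move=> r0 nb; apply: cutoff_exp_out; rewrite leNgt; apply/negP => h.
apply: nb; apply: sqnorm_box; first by rewrite addr_ge0.
by apply: (le_trans (ltW h)); nra.
Qed.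

Lemma compact_box r : compact (box r).
Proof. by apply: (@rV_compact R n.+1 (fun=> `[- r, r]%classic)) => i; exact: segment_compact. Qed.

Lemma compactly_supported_cutoff_exp r : 0 <= r ->
  compactly_supported_in setT (cutoff_exp r).
Proof.
move=> r0; exists (box (r + 1)); split => //; first exact: compact_box.
by move=> x _; exact: cutoff_exp_box.
Qed.

Lemma derive_plane_exp v x : 'D_v plane_exp x = v ord0 ord0 * plane_exp x.
Proof.
have d : is_derive x v (fun x : E => x ord0 ord0) (v ord0 ord0).
  apply/is_derive_lineP.
  rewrite (_ : (fun h => _) = (fun h => x ord0 ord0 + v ord0 ord0 * h)); last first.
    by apply/funext => h; rewrite !mxE addrC mulrC.
  by apply: is_derive_eq; rewrite add0r mul1r [_%:A]mulr1.
have [_ ->] := is_derive_comp1 (is_derive_expR _) d.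
by rewrite mulrC.
Qed.

(** Inside the ball the cutoff factor is locally 1. *)
Lemma laplacian_cutoff_exp r x : sqnorm x < r ^+ 2 ->
  \sum_(i < n.+1) 'D_(basis_rV R i) ('D_(basis_rV R i) (cutoff_exp r)) x = cutoff_exp r x.
Proof.
move=> hx.
have oB : open [set y : E | sqnorm y < r ^+ 2].
  rewrite (_ : mkset _ = sqnorm @^-1` [set t | t < r ^+ 2])//.
  apply: open_comp; last exact: open_lt.
  by move=> y _; exact: smooth_continuous smooth_sqnorm y.
have near1 y : sqnorm y < r ^+ 2 -> \near y, cutoff_exp r y = plane_exp y.
  move=> hy; have : nbhs y [set y : E | sqnorm y < r ^+ 2] by exact: open_nbhs_nbhs.
  by apply: filterS => z hz; rewrite cutoff_exp_in// ltW.
have D1 v y : sqnorm y < r ^+ 2 -> 'D_v (cutoff_exp r) y = v ord0 ord0 * plane_exp y.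
  by move=> hy; rewrite (near_eq_derive _ (near1 y hy)) derive_plane_exp.
have D2 v : 'D_v ('D_v (cutoff_exp r)) x = v ord0 ord0 * (v ord0 ord0 * plane_exp x).
  rewrite (@near_eq_derive _ _ _ _ (fun y => v ord0 ord0 * plane_exp y)).
    have := @deriveMl R E plane_exp (v ord0 ord0) x v.
    move=> ->; first by rewrite derive_plane_exp.
    exact: smooth_derivable smooth_plane_exp.
  have : nbhs x [set y : E | sqnorm y < r ^+ 2] by exact: open_nbhs_nbhs.
  by apply: filterS => z hz; exact: D1.
rewrite big_ord_recl big1 ?addr0; last first.
  by move=> i _; rewrite D2 /basis_rV mxE/= mul0r.
by rewrite D2 /basis_rV !mxE !eqxx !mul1r cutoff_exp_in// ltW.
Qed.

End spatial.

Section spacetime_test.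
Context (R : realType) (n : nat) (m : R) (m0 : 0 <= m).
Local Notation E := 'rV[R]_n.+1.

Definition time_step (a d t : R) : R := step ((t - a) / d).

Definition test_psi (a d r : R) (z : R * E) : R :=
  weight m z.1 * time_step a d z.1 * cutoff_exp r z.2.

Lemma smooth_time_step a d : smooth_on setT (time_step a d).
Proof.
move=> k; apply: (Ck_on_comp openT (@smooth_step R k)) => //.
apply: Ck_onM (Ck_on_cst k _ openT); first exact: openT.
apply: Ck_onD (Ck_on_cst k _ openT); first exact: openT.
by apply: Ck_on_linear => // x; exact: cvg_id.
Qed.

Lemma is_derive_time_step a d (t : R) :
  is_derive t 1 (time_step a d) ('D_1 (time_step a d) t).
Proof. by apply: derivableP; exact: smooth_derivable (smooth_time_step a d). Qed.

Lemma time_step_le a d t : 0 < d -> t <= a -> time_step a d t = 1.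
Proof. by move=> d0 ta; rewrite /time_step step_le0// pmulr_lle0 ?invr_gt0// subr_le0. Qed.

Lemma time_step_ge a d t : 0 < d -> a + d <= t -> time_step a d t = 0.
Proof. by move=> d0 ta; rewrite /time_step step_ge1// ler_pdivlMr// mul1r lerBrDl. Qed.

Definition weight_step a d (t : R) : R := weight m t * time_step a d t.

Definition weight_step' a d (t : R) : R :=
  - coweight m t * time_step a d t + weight m t * 'D_1 (time_step a d) t.

Lemma is_derive_weight_step a d (t : R) : 0 < t ->
  is_derive t 1 (weight_step a d) (weight_step' a d t).
Proof. by move=> t0; apply: is_derive1M (is_derive_weight m0 t0) (is_derive_time_step a d t). Qed.

Lemma dt_test_psi a d r t x : 0 < t ->
  dt (test_psi a d r) (t, x) = weight_step' a d t * cutoff_exp r x.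
Proof.
move=> t0; rewrite /dt; apply: derive_val.
apply/is_derive_lineP.
rewrite (_ : (fun h => _) = (fun h : R => weight_step a d (h *: (1 : R) + t) * cutoff_exp r x)).
  have := is_derive_weight_step a d t0; move/is_derive_lineP => h1.
  by apply: (is_derive_eq (is_derive1M h1 (is_derive_cst _ _ _))); rewrite mulr0 addr0.
by apply/funext => h; rewrite /test_psi /= scaler0 add0r.
Qed.

Lemma dx_test_psi a d r t x i :
  dx i (test_psi a d r) (t, x) = weight_step a d t * 'D_(basis_rV R i) (cutoff_exp r) x.
Proof.
rewrite /dx; apply: derive_val; apply/is_derive_lineP.
rewrite (_ : (fun h => _) = (fun h : R => weight_step a d t *
    cutoff_exp r (h *: basis_rV R i + x))).
  have h := derivableP (@smooth_derivable R E _ x (basis_rV R i) (@smooth_cutoff_exp R n r)).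
  exact: is_derive1Ml ((is_derive_lineP _ _ _ _).1 h).
by apply/funext => h; rewrite /test_psi /= scaler0 add0r.
Qed.

Let fst_cont : continuous (fst : (R * E)%type -> R). Proof. by move=> z; exact: cvg_fst. Qed.
Let snd_cont : continuous (snd : (R * E)%type -> E). Proof. by move=> z; exact: cvg_snd. Qed.

Lemma smooth_slice (h : R -> R) (f : E -> R) :
  smooth_on setT h -> smooth_on setT f ->
  smooth_on setT (fun z : R * E => h z.1 * f z.2).
Proof.
move=> sh sf k; apply: Ck_onM openT _ _.
  exact: (Ck_on_precomp fst_cont _ (sh k)).
exact: (Ck_on_precomp snd_cont _ (sf k)).
Qed.

Lemma open_time_pos (T : \bar R) : open (time_pos T).
Proof.
rewrite (_ : time_pos T = [set t | 0 < t] `&` [set t | (t%:E < T)%E])//.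
apply: openI; first exact: open_gt.
case: T => [T||].
- by rewrite (_ : mkset _ = [set t : R | t < T]); [exact: open_lt|apply/seteqP; split => t /=; rewrite lte_fin].
- by rewrite (_ : mkset _ = setT); [exact: openT|apply/seteqP; split => t //= _; exact: ltry].
- by rewrite (_ : mkset _ = set0); [exact: open0|apply/seteqP; split => t //=].
Qed.

Lemma open_slab_pos (T : \bar R) : open (@slab_pos R n.+1 T).
Proof.
rewrite (_ : slab_pos T = (fst : (R * E)%type -> R) @^-1` time_pos T).
  apply: open_comp; last exact: open_time_pos.
  by move=> z _; exact: fst_cont.
by apply/seteqP; split => [[t x] []//|[t x] /= ?].
Qed.

(** The weight is smooth for positive times only, but its derivative [- coweight] extends
    continuously to time 0, which is all that a test function must satisfy there. *)
Lemma test_function_test_psi (T : \bar R) a d r : 0 <= a -> 0 < d -> 0 <= r ->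
  ((a + d)%:E < T)%E -> test_function T (test_psi a d r).
Proof.
move=> a0 d0 r0 adT.
pose B (z : R * E) := time_step a d z.1 * cutoff_exp r z.2.
have sB : smooth_on setT B.
  by apply: smooth_slice; [exact: smooth_time_step|exact: smooth_cutoff_exp].
have cw (f : R -> R) : continuous f -> continuous (fun z : R * E => f z.1).
  move=> cf z; apply: (@continuous_comp _ _ _ fst f); first exact: fst_cont.
  exact: cf.
have cW : continuous (weight m) by move=> t; exact: weight_continuous.
have cC : continuous (coweight m) by move=> t; exact: coweight_continuous.
have PE : test_psi a d r = fun z => weight m z.1 * B z.
  by apply/funext => z; rewrite /test_psi /B mulrA.
have smoothP : smooth_on (@slab_pos R n.+1 T) (test_psi a d r).
  move=> k; rewrite PE; apply: (@Ck_onM _ _ _ k (fun z => weight m z.1) B (@open_slab_pos T)); last first.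
    exact: Ck_on_subset (sB k).
  apply: (@Ck_on_comp _ _ _ [set t | 0 < t] k (weight m) fst) => //.
  - exact: open_slab_pos.
  - exact: (smooth_weight m0).1.
  - by move=> [t x] [[]].
  - by apply: (@Ck_on_subset _ _ setT) => //; exact: Ck_on_linear.
split => //; first split.
- apply: continuous_subspaceT; rewrite PE => z.
  by apply: continuousM; [exact: cw|exact: smooth_continuous].
- exact: smoothP.
- move=> v.
  pose h (z : R * E) := - coweight m z.1 * v.1 * B z + weight m z.1 * 'D_v B z.
  have ch (z : R * E) : {for z, continuous h}.
    apply: continuousD.
      apply: continuousM; last exact: smooth_continuous.
      apply: (@continuousM _ _ (fun z : R * E => - coweight m z.1) (cst v.1)); last exact: cst_continuous.
      by apply: continuousN; exact: cw.
    apply: (@continuousM _ _ (fun z : R * E => weight m z.1)); first exact: cw.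
    by apply: smooth_continuous; exact: smooth_derive.
  exists h; split; first by apply: continuous_subspaceT => z; exact: ch.
  rewrite /h.
  move=> [t x] [[t0 _] _]; rewrite PE /=.
  have d1 : is_derive (t, x) v (weight m \o fst) (- coweight m t * v.1).
    apply: is_derive_comp1; first exact: is_derive_weight.
    by apply: (@is_derive_precomp _ _ _ fst _ id).
  have d2 := derivableP (@smooth_derivable R _ _ (t, x) v sB).
  have [_ ->] := is_deriveM d1 d2.
  by rewrite /GRing.scale/= addrC [B _ * _]mulrC.
- exists (`[0, a + d]%classic `*` box (r + 1)); split.
  + by apply: compact_setX; [exact: segment_compact|exact: compact_box].
  + move=> [t x] [/=]; rewrite in_itv/= => /andP[t0 tad] _; split => //; split => //.
    by apply: le_lt_trans adT; rewrite lee_fin.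
  + move=> [t x] [[/= t0 _] _] nK; rewrite /test_psi /=.
    have [tad|tad] := leP t (a + d); last by rewrite time_step_ge ?(ltW tad)// mulr0 mul0r.
    rewrite cutoff_exp_box ?mulr0// => bx; apply: nK; split => //=.
    by rewrite in_itv/= t0 tad.
Qed.

End spacetime_test.

(** * Mass of the plane exponential on a ball *)

Section cone_integral.
Context (R : realType).
Local Notation leb := (@lebesgue_measure R).

Lemma integral_lebesgue_rVS n (F : 'rV[R]_n.+1 -> \bar R) :
  measurable_fun setT F -> (forall x, (0 <= F x)%E) ->
  (\int[lebesgue_rV R n.+1]_x F x =
   \int[leb]_a \int[lebesgue_rV R n]_y F (rV_cons (a, y)))%E.
Proof.
move=> mF F0.
rewrite /= /lebesgue_rV_step ge0_integral_pushforward//; first last.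
  exact: measurable_rV_cons.
rewrite preimage_setT fubini_tonelli1//; last by move=> x; exact: F0.
by apply: measurableT_comp => //; exact: measurable_rV_cons.
Qed.

Lemma measurable_sqnorm n : measurable_fun setT (@sqnorm R n).
Proof.
rewrite /sqnorm; apply: measurable_sum => i.
by apply: measurable_funX; exact: measurable_coord.
Qed.

Lemma measurable_plane_exp n : measurable_fun setT (@plane_exp R n).
Proof. by apply: measurableT_comp => //; exact: measurable_coord. Qed.

Definition eball n (r : R) : set 'rV[R]_n.+1 := [set x | sqnorm x <= r ^+ 2].

Lemma measurable_eball n (r : R) : measurable (@eball n r).
Proof.
rewrite -[X in measurable X]setTI.
exact: (measurable_sqnorm measurableT (measurable_itv `]-oo, r ^+ 2])).
Qed.

Definition ball_const n : R := 2 * Num.sqrt (n`!%:R) * Num.sqrt 8 ^+ n.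

Lemma sqrt_pow_le_expR n (s : R) : 0 <= s ->
  Num.sqrt s ^+ n <= Num.sqrt (n`!%:R) * expR (s / 2).
Proof.
move=> s0.
rewrite -ler_sqr ?nnegrE ?exprn_ge0 ?sqrtr_ge0 ?mulr_ge0 ?expR_ge0//.
rewrite exprMn sqr_sqrtr// exprAC sqr_sqrtr//.
rewrite -expRM_natl -[2%:R * _]mulrC divfK//.
case: n => [|n]; first by rewrite expr0 mul1r -expR0 ler_expR.
have h := @expR_ge1Dxn R s n s0.
have f0 : 0 < n.+1`!%:R :> R by rewrite ltr0n fact_gt0.
by rewrite mulrC -ler_pdivrMr//; apply: le_trans h; rewrite lerDr.
Qed.

Lemma sqnorm_cons n (a : R) (y : 'rV[R]_n) :
  sqnorm (rV_cons (a, y)) = a ^+ 2 + \sum_(i < n) y ord0 i ^+ 2.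
Proof.
rewrite /sqnorm big_ord_recl /rV_cons; congr (_ ^+ 2 + _).
  by rewrite mxE unlift_none.
by apply: eq_bigr => i _; rewrite mxE liftK.
Qed.

Lemma lebesgue_rV_cube n (s : R) : 0 <= s ->
  lebesgue_rV R n [set y | forall i, `[- s, s]%classic (y ord0 i)] = ((2 * s) ^+ n)%:E.
Proof.
move=> s0; rewrite (@lebesgue_rV_box R n (fun=> `[- s, s]%classic))//.
rewrite (eq_bigr (fun=> (2 * s)%:E)).
  by rewrite prodEFin big_const_ord iter_mulr_1.
move=> i _; have := lebesgue_measure_itv (`[- s, s] : interval R).
rewrite /= lte_fin.
have [h|h] := ltP (- s) s.
  by move=> ->; rewrite -EFinB opprK -mulr2n mulr_natl.
move=> ->; have -> : s = 0 by move: h; lra.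
by rewrite mulr0.
Qed.

Lemma measurable_cube n (s : R) :
  measurable [set y : 'rV[R]_n | forall i, `[- s, s]%classic (y ord0 i)].
Proof.
rewrite (_ : mkset _ = \bigcap_(i in [set: 'I_n])
    ((fun x : 'rV[R]_n => x ord0 i) @^-1` `[- s, s]%classic)); last first.
  by apply/seteqP; split => x /=; [move=> h i _; exact: h|move=> h i; exact: h].
apply: fin_bigcap_measurable => // i _.
by rewrite -[X in measurable X]setTI; apply: measurable_coord.
Qed.

(** Slice the ball along the first coordinate: the slice at height [a] lies in a cube of side
    [2 sqrt (r^2 - a^2) <= sqrt (8 r (r - a))], and the excess over [sqrt r ^+ n] is paid by
    [expR ((r - a) / 2)]. The resulting order [r^(n/2) expR r], in dimension [n + 1], is the true
    one, and the critical exponent depends on it. *)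
Lemma plane_exp_ball n (r : R) : 0 < r ->
  (\int[lebesgue_rV R n.+1]_(x in eball r) (plane_exp x)%:E
    <= (ball_const n * Num.sqrt r ^+ n * expR r)%:E)%E.
Proof.
move=> r0.
pose B := @eball n r.
have mB : measurable B by exact: measurable_eball.
rewrite integral_mkcond -/B.
have mF : measurable_fun setT ((fun x => (plane_exp x)%:E) \_ B).
  apply/(measurable_restrictT _ mB)/measurable_EFinP/measurable_funTS.
  exact: measurable_plane_exp.
have F0 x : (0 <= ((fun x => (plane_exp x)%:E) \_ B) x)%E.
  by apply: erestrict_ge0 => {}x _; rewrite lee_fin ltW// plane_exp_gt0.
rewrite (integral_lebesgue_rVS mF F0).
pose K : R := Num.sqrt 8 ^+ n * Num.sqrt r ^+ n * Num.sqrt (n`!%:R) * expR (r / 2).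
have K0 : 0 <= K by rewrite /K !mulr_ge0 ?exprn_ge0 ?sqrtr_ge0 ?expR_ge0.
have mFc : measurable_fun setT (((fun x => (plane_exp x)%:E) \_ B) \o @rV_cons R n).
  by apply: measurableT_comp => //; exact: measurable_rV_cons.
apply: (@le_trans _ _ (\int[leb]_a ((fun a => (K * expR (a / 2))%:E) \_ `[(- r)%R, r]) a)%E).
  have mI : measurable (`[(- r)%R, r]%classic : set (measurableTypeR R)) by exact: measurable_itv.
  apply: ge0_le_integral => //.
  - by move=> a _; apply: integral_ge0 => y _; exact: F0.
  - exact: (@measurable_fun_fubini_tonelli_F _ _ _ _ _ (lebesgue_rV R n) _ mFc (fun z => F0 _)).
  - apply/(measurable_restrictT _ mI)/measurable_EFinP/measurable_funTS.
    apply: measurable_funM => //; apply: measurableT_comp => //.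
    by apply: measurable_funM.
  move=> a _; rewrite [in leRHS]patchE.
  have [aI|aI] := boolP (a \in `[(- r)%R, r]%classic); last first.
    rewrite integral0_eq// => y _; rewrite patchE memNset//.
    rewrite /B /eball /= sqnorm_cons => h; move: aI; rewrite notin_setE /= in_itv/= -ler_norml.
    apply; rewrite -ler_sqr ?nnegrE ?(ltW r0)// real_normK ?num_real//.
    by apply: le_trans h; rewrite lerDl sumr_ge0// => j _; exact: sqr_ge0.
  move: aI; rewrite inE/= in_itv/= => /andP[ra ar].
  pose s := Num.sqrt (r ^+ 2 - a ^+ 2).
  have s2 : 0 <= r ^+ 2 - a ^+ 2 by nra.
  have s0 : 0 <= s by exact: sqrtr_ge0.
  pose Q := [set y : 'rV[R]_n | forall i, `[- s, s]%classic (y ord0 i)].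
  have mQ : measurable Q by exact: measurable_cube.
  apply: (@le_trans _ _ (\int[lebesgue_rV R n]_(y in Q) (expR a)%:E)%E).
    rewrite [leRHS]integral_mkcond; apply: ge0_le_integral => //.
    - by apply: (measurableT_comp mFc); exact: measurable_pair1.
    - by apply/(measurable_restrictT _ mQ)/measurable_cst.
    move=> y _; rewrite !patchE; case: ifPn => [|_]; last by case: ifPn => // _; rewrite lee_fin expR_ge0.
    rewrite inE /B /eball /= sqnorm_cons => h.
    have -> : plane_exp (rV_cons (a, y)) = expR a by rewrite /plane_exp /rV_cons mxE unlift_none.
    rewrite mem_set// => i; rewrite /= in_itv/= -ler_norml /s.
    rewrite -[leLHS]ger0_norm// -sqrtr_sqr ler_sqrt// real_normK ?num_real//.
    move: h; rewrite (bigD1 i)//= => h.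
    have : 0 <= \sum_(j < n | j != i) y ord0 j ^+ 2 by apply: sumr_ge0 => j _; exact: sqr_ge0.
    move: h; set X := \sum_(_ < _ | _) _; lra.
  rewrite integral_cst// [X in (_ * X)%E](lebesgue_rV_cube n s0) -EFinM lee_fin.
  have h2s : 2 * s <= Num.sqrt 8 * Num.sqrt r * Num.sqrt (r - a).
    rewrite -[leLHS]ger0_norm ?mulr_ge0// -sqrtr_sqr -!sqrtrM ?mulr_ge0 ?(ltW r0)//.
    rewrite ler_sqrt ?mulr_ge0 ?(ltW r0) ?subr_ge0// exprMn sqr_sqrtr//; nra.
  have hn : (2 * s) ^+ n <= (Num.sqrt 8 * Num.sqrt r) ^+ n * (Num.sqrt (n`!%:R) * expR ((r - a) / 2)).
    apply: (@le_trans _ _ ((Num.sqrt 8 * Num.sqrt r * Num.sqrt (r - a)) ^+ n)).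
      by rewrite lerXn2r ?nnegrE ?mulr_ge0 ?sqrtr_ge0.
    rewrite [in leLHS]exprMn ler_wpM2l ?exprn_ge0 ?mulr_ge0 ?sqrtr_ge0//.
    by apply: sqrt_pow_le_expR; rewrite subr_ge0.
  apply: (@le_trans _ _ (expR a * ((Num.sqrt 8 * Num.sqrt r) ^+ n * (Num.sqrt (n`!%:R) * expR ((r - a) / 2))))).
    by rewrite ler_wpM2l ?expR_ge0.
  rewrite /K exprMn.
  have -> : expR a = expR (a / 2) * expR (a / 2) by rewrite -expRD; congr expR; field.
  have -> : expR ((r - a) / 2) = expR (r / 2) * (expR (a / 2))^-1 by rewrite -expRN -expRD; congr expR; field.
  have e0 := expR_gt0 (a / 2).
  rewrite le_eqVlt; apply/orP; left; apply/eqP; field; rewrite gt_eqF//.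
rewrite -integral_mkcond.
have rr : - r < r by rewrite gtrN.
have dG (x : R) : is_derive x 1 (fun a : R => 2 * K * expR (a / 2)) (K * expR (x / 2)).
  have d1 := is_derive1_expR (is_derive1M (is_derive_id x (1 : R)) (is_derive_cst (2^-1 : R) x (1 : R))).
  by apply: (is_derive_eq (is_derive1Ml (2 * K) d1)); rewrite /= mulr0 addr0 mul1r; move: {K0} K => K; field.
rewrite (@continuous_FTC2 _ (fun a => K * expR (a / 2)) (fun a => 2 * K * expR (a / 2)))//.
- rewrite -EFinB lee_fin /ball_const.
  have -> : expR r = expR (r / 2) * expR (r / 2) by rewrite -expRD; congr expR; field.
  apply: (@le_trans _ _ (2 * K * expR (r / 2))).
    by rewrite gerBl !mulr_ge0 ?expR_ge0.
  by rewrite le_eqVlt; apply/orP; left; apply/eqP; rewrite /K; ring.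
- apply: within_continuousW => x _; apply: continuousM; first exact: cst_continuous.
  apply: continuous_comp; last exact: continuous_expR.
  by apply: continuousM; [exact: cvg_id|exact: cst_continuous].
- split => [x _||].
  + by have [] := dG x.
  + by apply: cvg_at_right_filter; exact: is_derive_continuous (dG _).
  + by apply: cvg_at_left_filter; exact: is_derive_continuous (dG _).
- by move=> x _; rewrite derive1E; have [_ ->] := dG x.
Qed.

End cone_integral.

(** * Square integrable functions, null sets and weak derivatives *)

Section L2_tools.
Context d (T : measurableType d) (R : realType) (mu : {measure set T -> \bar R}).
Local Notation N2 w := ('N[mu]_2%:E [EFin \o w])%E.
Implicit Types (w v psi : T -> R) (D : set T).

Lemma L2_pairing w psi : measurable_fun setT w -> measurable_fun setT psi ->
  (N2 w < +oo)%E -> (N2 psi < +oo)%E ->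
  mu.-integrable setT (EFin \o (fun x => w x * psi x)) /\
  (`|\int[mu]_x (w x * psi x)|%:E <= N2 w * N2 psi)%E.
Proof.
move=> mw mp w2 p2.
have e : (2^-1 + 2^-1 : R) = 1 by field.
have h := hoelder mu mw mp (@ltr0n R 2) (@ltr0n R 2) e.
have fin : (N2 w * N2 psi < +oo)%E.
  by rewrite lte_mul_pinfty ?Lnorm_ge0// ge0_fin_numE ?Lnorm_ge0.
have mwp : measurable_fun setT (fun x => w x * psi x) by exact: measurable_funM.
have i : mu.-integrable setT (EFin \o (fun x => w x * psi x)).
  apply/integrableP; split; first exact/measurable_EFinP.
  by apply: le_lt_trans fin; apply: le_trans h; rewrite Lnorm1.
split => //.
apply: le_trans h; rewrite Lnorm1 EFin_normr_Rintegral//.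
by apply: le_abse_integral => //; exact/measurable_EFinP.
Qed.

Lemma L2_restrict_le D w v : measurable D ->
  measurable_fun setT w -> measurable_fun setT v ->
  {ae mu, forall x, D x -> `|w x| <= `|v x| } ->
  (N2 (w \_ D)%R <= N2 v)%E.
Proof.
move=> mD mw mv h.
have mwD : measurable_fun setT (w \_ D) by apply/(measurable_restrictT _ mD)/measurable_funTS.
rewrite unlock; apply: gt0_ler_poweR; rewrite ?invr_ge0// ?in_itv/= ?leey ?andbT.
- by apply: integral_ge0 => x _; rewrite lee_fin powR_ge0.
- by apply: integral_ge0 => x _; rewrite lee_fin powR_ge0.
apply: ae_ge0_le_integral => //=.
- apply/measurable_EFinP; apply: (measurableT_comp (measurable_powR _)).
  exact: measurableT_comp.
- apply/measurable_EFinP; apply: (measurableT_comp (measurable_powR _)).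
  exact: measurableT_comp.
apply: filterS h => x h _; rewrite lee_fin.
apply: ge0_ler_powR; rewrite ?nnegrE//.
rewrite patchE; case: ifPn => [|_]; first by rewrite inE.
by rewrite normr0.
Qed.

Lemma ae_zero_of_L2_limit D w : measurable D -> measurable_fun setT w ->
  (forall e : R, 0 < e -> exists v, [/\ measurable_fun setT v,
     {ae mu, forall x, D x -> v x = 0} & (N2 (v \- w)%R <= e%:E)%E]) ->
  {ae mu, forall x, D x -> w x = 0}.
Proof.
move=> mD mw h.
have mwD : measurable_fun setT (w \_ D) by apply/(measurable_restrictT _ mD)/measurable_funTS.
have N0 : N2 (w \_ D) = 0%E.
  apply/eqP; rewrite eq_le Lnorm_ge0 andbT; apply/lee_addgt0Pr => e e0.
  have [v [mv v0 hv]] := h e e0; rewrite add0e; apply: le_trans hv.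
  apply: L2_restrict_le => //; first exact: measurable_funB.
  by apply: filterS v0 => x v0 Dx /=; rewrite v0// sub0r normrN.
have mE : measurable_fun setT (EFin \o w \_ D) by exact/measurable_EFinP.
have p2 : (0 < 2%:E :> \bar R)%E by rewrite lte_fin.
have := Lnorm_eq0_eq0 mE p2 N0.
by apply: filterS => x /(_ I) /= + Dx; rewrite patchE mem_set// => -[].
Qed.

End L2_tools.

Section null_sets.

(** Otherwise the complements of the sets with property [P] would form, inside [K], a proper
    filter with a cluster point in [K]. *)
Lemma compact_induction (T : topologicalType) (P : set T -> Prop) (K : set T) :
  compact K -> P set0 -> (forall A B, A `<=` B -> P B -> P A) ->
  (forall A B, P A -> P B -> P (A `|` B)) ->
  (forall x, K x -> exists2 U, nbhs x U & P U) -> P K.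
Proof.
move=> cK P0 PS PU PK; apply: contrapT => nPK.
pose F : set_system T := [set B | P (K `\` B)].
have FF : ProperFilter F.
  split.
    by rewrite /F /= setD0.
  split.
  - by rewrite /F /= setDT.
  - by move=> A B; rewrite /F /= setDIr; exact: PU.
  - by move=> A B AB; rewrite /F /=; apply: PS; exact: setDS.
have FK : F K by rewrite /F /= setDv.
have [x [Kx clx]] := cK F FF FK.
have [U Ux PUU] := PK x Kx.
have FU : F (~` U) by rewrite /F /= setDE setCK; apply: PS PUU; exact: subIsetr.
by have [y [nUy Uy]] := clx _ _ FU Ux.
Qed.

(** The definition of the essential support is local; compactness and countable unions make it
    global. *)
Lemma null_off_ess_support (T : topologicalType) (R : realType) (null : set T -> Prop)
    (f : T -> R) (K : (set T)^nat) :
  null set0 -> (forall A B, A `<=` B -> null B -> null A) ->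
  (forall F : (set T)^nat, (forall k, null (F k)) -> null (\bigcup_k F k)) ->
  (forall j, compact (K j)) ->
  (forall j x, K j x -> ~ ess_support null f x) ->
  null ((\bigcup_j K j) `&` [set y | f y != 0]).
Proof.
move=> n0 nS nU cK hK; rewrite setI_bigcupl; apply: (nU) => j.
apply: (@compact_induction _ (fun B => null (B `&` [set y | f y != 0])) _ (cK j)).
- by rewrite set0I.
- by move=> A B AB; apply: nS; exact: setSI.
- move=> A B nA nB; rewrite setIUl.
  rewrite (_ : _ `|` _ = \bigcup_k (if k == 0%N then A `&` [set y | f y != 0]
    else B `&` [set y | f y != 0])).
    by apply: nU => k; case: ifP.
  apply/seteqP; split => [x [?|?]|x [k _]]; [by exists 0%N|by exists 1%N|].
  by case: ifP => _ ?; [left|right].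
- move=> x /hK /= /existsNP[U /not_implyP[nU' /contrapT hU]].
  by exists U.
Qed.

End null_sets.

Section euclidean_null.
Context (R : realType) (n : nat).
Local Notation E := 'rV[R]_n.+1.
Local Notation mu := (lebesgue_rV R n.+1).

Lemma enormE (x : E) : enorm x = Num.sqrt (sqnorm x).
Proof. by []. Qed.

Lemma enorm_continuous : continuous (@enorm R n.+1).
Proof.
move=> x; apply: (@continuous_comp _ _ _ (@sqnorm R n) Num.sqrt).
  exact: smooth_continuous (@smooth_sqnorm R n) x.
exact: sqrt_continuous.
Qed.

Lemma enorm_le_eball (x : E) (r : R) : 0 <= r -> (enorm x <= r) = (sqnorm x <= r ^+ 2).
Proof.
move=> r0; rewrite enormE -ler_sqr ?nnegrE ?sqrtr_ge0// sqr_sqrtr//.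
by apply: sumr_ge0 => i _; exact: sqr_ge0.
Qed.

Lemma box_nat (x : E) : exists k : nat, box k%:R x.
Proof.
exists (Num.truncn (enorm x)).+1; apply: sqnorm_box; first by [].
have h := ltW (truncnS_gt (enorm x)).
by rewrite -enorm_le_eball.
Qed.

Lemma null_off_unit_ball (f : E -> R) :
  ess_support mu.-negligible f `<=` [set x | enorm x <= 1] ->
  {ae mu, forall x, 1 < enorm x -> f x = 0}.
Proof.
move=> hf.
pose K j : set E := box j%:R `&` [set x | 1 + j.+1%:R^-1 <= enorm x].
have cK j : compact (K j).
  apply: compact_closedI; first exact: compact_box.
  rewrite (_ : mkset _ = @enorm R n.+1 @^-1` [set t | 1 + j.+1%:R^-1 <= t])//.
  apply: preimage_closed; last exact: closed_ge.
  by move=> x _; exact: enorm_continuous.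
have K1 j x : K j x -> 1 < enorm x.
  by move=> [_ /=]; apply: lt_le_trans; rewrite ltrDl invr_gt0.
have := @null_off_ess_support _ _ mu.-negligible f K (@negligible_set0 _ _ _ mu).
move=> /(_ (fun A B => @negligibleS _ _ _ mu B A)).
move=> /(_ (fun F hF => negligible_bigcup hF) cK).
have h2 j x : K j x -> ~ ess_support mu.-negligible f x.
  by move=> /K1 h /hf /=; rewrite leNgt h.
move=> /(_ h2); apply: negligibleS => x /= /not_implyP[x1 fx]; split; last exact/eqP.
have [k bk] := box_nat x.
pose j := maxn k (Num.truncn (enorm x - 1)^-1).
exists j => //; split.
  move=> i; have := bk i; rewrite /= !in_itv/= -!ler_norml => h; apply: le_trans h _.
  by rewrite ler_nat leq_maxl.
rewrite /= -lerBrDl -[leRHS]invrK lef_pV2 ?posrE ?invr_gt0 ?subr_gt0//.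
apply: (le_trans (ltW (truncnS_gt _))).
by rewrite ler_nat ltnS leq_maxr.
Qed.

Lemma measurable_derive (psi : E -> R) v : measurable_fun setT psi ->
  (forall x, derivable psi x v) -> measurable_fun setT ('D_v psi).
Proof.
move=> mp dp.
pose h (k : nat) x := (harmonic k)^-1 * (psi (harmonic k *: v + x) - psi x).
apply: (@measurable_fun_cvg _ _ _ setT h) => [k|x _].
  apply: measurable_funM; first exact: measurable_cst.
  apply: measurable_funB => //; apply: (measurableT_comp mp).
  apply: measurable_fun_coordP => i.
  rewrite (_ : (fun z => _) = (fun z : E => harmonic k * v ord0 i + z ord0 i)).
    by apply: measurable_funD => //; exact: measurable_coord.
  by apply/funext => z; rewrite !mxE.
have dx := dp x.
have /cvgr_dnbhsP := (dx : (fun h => h^-1 *: ((psi \o shift x) (h *: v) - psi x)) @ 0^' --> 'D_v psi x).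
apply; split; last exact: cvg_harmonic.
by move=> k; rewrite gt_eqF// /harmonic/= invr_gt0.
Qed.

Lemma bounded_box_supported (f : E -> R) (r : R) : 0 <= r -> continuous f ->
  (forall x, ~ box r x -> f x = 0) -> exists M : R, forall x, `|f x| <= M.
Proof.
move=> r0 cf f0.
have b0 : @box R n r !=set0.
  by exists 0 => i; rewrite /= mxE in_itv/= oppr_le0 r0.
have cn : {within @box R n r, continuous (fun x => `|f x|)}.
  apply: continuous_subspaceT => x; apply: continuous_comp; first exact: cf.
  exact: norm_continuous.
have [c _ hc] := EVT_max_rV b0 (@compact_box R n r) cn.
exists `|f c| => x; have [bx|nb] := pselect (box r x); first by apply: hc; rewrite inE.
by rewrite f0// normr0.
Qed.

Lemma L2_box (psi : E -> R) (M r : R) : 0 <= r -> measurable_fun setT psi ->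
  (forall x, `|psi x| <= M) -> (forall x, ~ box r x -> psi x = 0) ->
  ('N[mu]_2%:E [EFin \o psi] < +oo)%E.
Proof.
move=> r0 mp pM p0.
rewrite unlock; apply: poweR_lty => /=.
apply: (@le_lt_trans _ _ (\int[mu]_(x in box r) (M ^+ 2)%:E)%E).
  rewrite [leRHS]integral_mkcond; apply: ge0_le_integral => //=.
  - apply/measurable_EFinP; apply: (measurableT_comp (measurable_powR _)).
    exact: measurableT_comp.
  - by apply/(measurable_restrictT _ (@measurable_cube R n.+1 r))/measurable_cst.
  move=> x _; rewrite patchE; case: ifPn => [_|].
    rewrite lee_fin powR_mulrn//; apply: lerXn2r; rewrite ?nnegrE//.
    exact: le_trans (pM x).
  by rewrite notin_setE => /p0 ->; rewrite normr0 powR0.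
rewrite integral_cst; last exact: measurable_cube.
by rewrite [X in (_ * X)%E](lebesgue_rV_cube n.+1 r0) ltry.
Qed.

Lemma eq_ae_Rintegral (f g : E -> R) : measurable_fun setT f -> measurable_fun setT g ->
  {ae mu, forall x, f x = g x} -> \int[mu]_x f x = \int[mu]_x g x.
Proof.
move=> mf mg fg; congr fine; apply: ae_eq_integral => //; try exact/measurable_EFinP.
by apply: filterS fg => x -> .
Qed.

Lemma L2_le_sobolev (s : R) (w : E -> R) :
  ('N[mu]_2%:E [EFin \o w] <= sobolev_norm s w)%E.
Proof.
rewrite /sobolev_norm; set N := ('N[mu]_2%:E [EFin \o w])%E.
have N0 : (0 <= N)%E by exact: Lnorm_ge0.
have S0 : (0 <= sobolev_seminorm_sq s w)%E.
  rewrite /sobolev_seminorm_sq; case: ifP => // _; case: ifP => _.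
    by apply: sume_ge0 => i _; apply: expe_ge0; exact: Lnorm_ge0.
  apply: integral_ge0 => x _; apply: integral_ge0 => y _.
  by rewrite lee_fin divr_ge0 ?sqr_ge0 ?powR_ge0.
have N2 : (0 <= N ^+ 2)%E by exact: expe_ge0.
have NE : N = ((N ^+ 2) `^ 2^-1)%E.
  case: (N) N0 => [r r0||//].
    rewrite -EFin_expe poweR_EFin -powR_mulrn// -powRrM mulfV ?pnatr_eq0// powRr1//.
  by rewrite expe2 mulyy poweRyr// invr_eq0.
rewrite {1}NE; apply: gt0_ler_poweR; rewrite ?invr_ge0// ?in_itv/= ?leey ?andbT ?adde_ge0//.
exact: leeDl.
Qed.

Lemma in_sobolev_L2 (s : R) (w : E -> R) : in_sobolev s w ->
  measurable_fun setT w /\ ('N[mu]_2%:E [EFin \o w] < +oo)%E.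
Proof. by move=> [mw _ h]; split => //; apply: le_lt_trans h; exact: L2_le_sobolev. Qed.

Lemma measurable_cutoff_exp (r : R) : measurable_fun setT (@cutoff_exp R n r).
Proof.
apply: measurable_funM; first exact: measurable_plane_exp.
apply: measurableT_comp; last by apply: measurable_funB => //; exact: measurable_sqnorm.
apply: continuous_measurable_fun => x; exact: smooth_continuous (@smooth_step R) x.
Qed.

Lemma L2_smooth_box (psi : E -> R) (r : R) : 0 <= r -> measurable_fun setT psi ->
  smooth_on setT psi -> (forall x, ~ box r x -> psi x = 0) ->
  ('N[mu]_2%:E [EFin \o psi] < +oo)%E.
Proof.
move=> r0 mp sp off.
have [M hM] := bounded_box_supported r0 (smooth_continuous sp) off.
exact: L2_box r0 mp hM off.
Qed.

Lemma derive_off_box (psi : E -> R) (r : R) v :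
  (forall x, ~ box r x -> psi x = 0) -> forall x, ~ box r x -> 'D_v psi x = 0.
Proof. by move=> off x; apply: derive_outside_compact => //; exact: compact_box. Qed.

Lemma cutoff_exp_off_box (r : R) : 0 <= r ->
  forall x : E, ~ box (r + 1) x -> cutoff_exp r x = 0.
Proof. by move=> r0 x; exact: cutoff_exp_box. Qed.

Lemma L2_cutoff_exp (r : R) : 0 <= r ->
  ('N[mu]_2%:E [EFin \o cutoff_exp r] < +oo)%E.
Proof.
move=> r0; apply: (@L2_smooth_box _ (r + 1)); first by rewrite addr_ge0.
- exact: measurable_cutoff_exp.
- exact: smooth_cutoff_exp.
- exact: cutoff_exp_off_box.
Qed.

Lemma measurable_smooth_derive (psi : E -> R) v : smooth_on setT psi ->
  measurable_fun setT psi -> measurable_fun setT ('D_v psi).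
Proof.
by move=> sp mp; apply: measurable_derive => // x; exact: smooth_derivable sp.
Qed.

Lemma Rintegral_sum (I : Type) (s : seq I) (h : I -> E -> R) :
  (forall i, mu.-integrable setT (EFin \o h i)) ->
  mu.-integrable setT (EFin \o (fun x => \sum_(i <- s) h i x)) /\
  \int[mu]_x (\sum_(i <- s) h i x) = \sum_(i <- s) \int[mu]_x h i x.
Proof.
move=> ih; elim: s => [|i s [is_ IH]].
  rewrite big_nil; split.
    rewrite (_ : EFin \o _ = cst 0%E); first exact: integrable0.
    by apply/funext => x /=; rewrite big_nil.
  rewrite (_ : (fun x => _) = cst 0) ?Rintegral_cst ?mul0r//.
  by apply/funext => x; rewrite big_nil.
rewrite big_cons -IH -RintegralD//; split.
  rewrite (_ : EFin \o _ = (fun x => (h i x)%:E + (\sum_(j <- s) h j x)%:E)%E); last first.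
    by apply/funext => x /=; rewrite big_cons.
  exact: (integrableD measurableT (ih i) is_).
by apply: eq_Rintegral => x _; rewrite big_cons.
Qed.

(** The weak gradient of [w] is tested against the derivatives of the cutoff exponential, whose
    Laplacian is the function itself where [w] lives. *)
Lemma weak_laplacian (w : E -> R) (rho r : R) : 0 <= rho -> rho < r ->
  in_sobolev 1 w -> {ae mu, forall x, rho < enorm x -> w x = 0} ->
  let F x := \sum_(i < n.+1) weak_partial i w x * 'D_(basis_rV R i) (cutoff_exp r) x in
  mu.-integrable setT (EFin \o F) /\
  \int[mu]_x F x = - \int[mu]_x (w x * cutoff_exp r x).
Proof.
move=> rho0 rhor sw w0 F.
have r0 : 0 <= r by exact: le_trans (ltW rhor).
have sm := @smooth_cutoff_exp R n r.
have [mw w2] := in_sobolev_L2 sw.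
have wp i : in_L2 (weak_partial i w) /\ is_weak_partial i w (weak_partial i w).
  case: sw => _ /(_ erefl i) ex _.
  exact: (@xgetPex _ (fun=> 0) [set v | in_L2 v /\ is_weak_partial i w v] ex).
have r10 : 0 <= r + 1 by rewrite addr_ge0.
have mc := measurable_cutoff_exp r.
have mc1 i := @measurable_smooth_derive _ (basis_rV R i) sm mc.
have sm1 i := smooth_derive (basis_rV R i) sm.
have mc2 i := @measurable_smooth_derive _ (basis_rV R i) (sm1 i) (mc1 i).
have off1 i := @derive_off_box _ _ (basis_rV R i) (cutoff_exp_off_box r0).
have off2 i := @derive_off_box _ _ (basis_rV R i) (off1 i).
have int1 i : mu.-integrable setT (EFin \o (fun x => weak_partial i w x *
    'D_(basis_rV R i) (cutoff_exp r) x)).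
  have [[mi i2] _] := wp i.
  exact: (L2_pairing mi (mc1 i) i2 (L2_smooth_box r10 (mc1 i) (sm1 i) (off1 i))).1.
have int2 i : mu.-integrable setT (EFin \o (fun x => w x *
    'D_(basis_rV R i) ('D_(basis_rV R i) (cutoff_exp r)) x)).
  have sm2 := smooth_derive (basis_rV R i) (sm1 i).
  exact: (L2_pairing mw (mc2 i) w2 (L2_smooth_box r10 (mc2 i) sm2 (off2 i))).1.
have e i : \int[mu]_x (weak_partial i w x * 'D_(basis_rV R i) (cutoff_exp r) x) =
    - \int[mu]_x (w x * 'D_(basis_rV R i) ('D_(basis_rV R i) (cutoff_exp r)) x).
  have [_ ->] := wp i; first by rewrite opprK.
    exact: smooth_derive.
  exact/compactly_supported_derive/compactly_supported_cutoff_exp.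
split; first exact: (Rintegral_sum _ int1).1.
rewrite (Rintegral_sum _ int1).2 (eq_bigr _ (fun i _ => e i)) sumrN -(Rintegral_sum _ int2).2.
congr (- _); apply: eq_ae_Rintegral.
- by apply: measurable_sum => i; exact: measurable_funM.
- exact: measurable_funM.
apply: filterS w0 => x hx; rewrite -mulr_sumr.
have [xr|xr] := leP (enorm x) rho; last by rewrite hx// !mul0r.
congr (_ * _); apply: laplacian_cutoff_exp.
rewrite enorm_le_eball// in xr; apply: le_lt_trans xr _.
by rewrite ltrXn2r// nnegrE.
Qed.

End euclidean_null.

(** * Support of the solution at each time *)

Section cone_support.
Context (R : realType) (n : nat) (m : R).
Hypothesis m0 : 0 <= m.
Local Notation E := 'rV[R]_n.+1.
Local Notation mu := (lebesgue_rV R n.+1).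
Local Notation leb := (@lebesgue_measure R).
Local Notation vol := (spacetime_measure R n.+1).
Implicit Types (T : \bar R) (u ut : R -> E -> R).

(** Fubini for null sets. *)
Lemma negligible_section (A : set (measurableTypeR R * E)) :
  vol.-negligible A -> {ae leb, forall t : R, mu.-negligible [set x | A (t, x)]}.
Proof.
move=> [B [mB B0 AB]].
have h : (\int[leb]_t (mu (xsection B t)) = 0)%E by rewrite -[RHS]B0.
have mx := measurable_fun_xsection mu mB.
have h' : (\int[leb]_t `|mu (xsection B t)| = 0)%E.
  by rewrite -[RHS]h; apply: eq_integral => t _; rewrite gee0_abs.
move: h' => /(ae_eq_integral_abs _ measurableT mx).
apply: filterS => t /(_ I) /= ht.
exists (xsection B t); split => //; first exact: measurable_xsection.
by move=> x Ax; rewrite /xsection /= inE; exact: AB.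
Qed.

Lemma compact_cone_gap (tau : R) (j : nat) :
  compact [set z : R * E | [/\ z.1 \in `[0, tau], box j%:R z.2 &
    1 + horizon m (Num.max z.1 0) + j.+1%:R^-1 <= enorm z.2]].
Proof.
rewrite (_ : mkset _ = (`[0, tau]%classic `*` box j%:R) `&`
    (fun z : R * E => enorm z.2 - horizon m (Num.max z.1 0)) @^-1`
      [set y | 1 + j.+1%:R^-1 <= y]); last first.
  apply/seteqP; split => z /=.
    by move=> [? ? ?]; split => //; rewrite lerBrDr addrAC.
  by move=> [[? ?]]; rewrite lerBrDr addrAC => ?; split.
apply: compact_closedI; first by apply: compact_setX; [exact: segment_compact|exact: compact_box].
apply: preimage_closed; last exact: closed_ge.
move=> z _; apply: (@cvgB _ R).
  by apply: continuous_comp; [exact: cvg_snd|exact: enorm_continuous].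
apply: (@continuous_comp _ _ _ fst (fun t : R => horizon m (Num.max t 0))); first exact: cvg_fst.
rewrite /horizon; apply: (@continuousM _ _ (fun t : R => Num.max t 0 `^ (m + 1)) (cst _));
  last exact: cst_continuous.
by apply: powR_max0_continuous; rewrite ltr_wpDl.
Qed.

Lemma null_off_cone (T : \bar R) u (tau : R) : (tau%:E < T)%E ->
  solution_support T u `<=` cone m T ->
  vol.-negligible [set z : R * E | [/\ 0 <= z.1, z.1 <= tau,
    1 + horizon m z.1 < enorm z.2 & u z.1 z.2 != 0]].
Proof.
move=> tT hs.
pose K j : set (R * E) := [set z | [/\ z.1 \in `[0, tau], box j%:R z.2 &
    1 + horizon m (Num.max z.1 0) + j.+1%:R^-1 <= enorm z.2]].
have hK j z : K j z -> ~ ess_support vol.-negligible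
    ((fun z : R * E => u z.1 z.2) \_ (slab T)) z.
  move=> [z1 _ hz] sz.
  have sl : slab T z.
    by move: z1; rewrite in_itv/= => /andP[z0 zt]; split => //; split => //=;
      apply: le_lt_trans tT; rewrite lee_fin.
  have := hs z (conj sl sz); rewrite /cone /= => -[_].
  have z0 : 0 <= z.1 by move: z1; rewrite in_itv/= => /andP[].
  rewrite leNgt; move/negP; apply; apply: lt_le_trans hz.
  by rewrite max_l// ltrDl invr_gt0.
have := @null_off_ess_support _ _ vol.-negligible _ K (@negligible_set0 _ _ _ vol)
  (fun A B => @negligibleS _ _ _ vol B A) (fun F hF => negligible_bigcup hF)
  (@compact_cone_gap tau) hK.
apply: negligibleS => -[t x] /= [t0 tt xt ux]; split; last first.
  rewrite /= patchE mem_set//; split => //; split => //=.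
  by apply: le_lt_trans tT; rewrite lee_fin.
have [k bk] := box_nat x.
pose j := maxn k (Num.truncn (enorm x - (1 + horizon m t))^-1).
exists j => //; split; rewrite /= ?in_itv/= ?t0//.
  move=> i; have := bk i; rewrite /= !in_itv/= -!ler_norml => h; apply: le_trans h _.
  by rewrite ler_nat leq_maxl.
rewrite max_l// -lerBrDl -[leRHS]invrK lef_pV2 ?posrE ?invr_gt0 ?subr_gt0//.
apply: (le_trans (ltW (truncnS_gt _))).
by rewrite ler_nat ltnS leq_maxr.
Qed.

Lemma ae_witness (P : R -> Prop) (a b : R) : a < b ->
  {ae leb, forall t, P t} -> exists t, [/\ a < t, t < b & P t].
Proof.
move=> ab [B [mB B0 hB]]; apply: contrapT => nP.
have sub : `]a, b[%classic `<=` B.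
  move=> t /=; rewrite in_itv/= => /andP[at_ tb]; apply: hB => /= Pt.
  by apply: nP; exists t.
have L : leb `]a, b[%classic = (b - a)%:E.
  by rewrite /= lebesgue_measure_itv/= lte_fin ab.
have : ((b - a)%:E <= 0)%E.
  rewrite -L -B0; exact: (le_measure leb (mem_set (measurable_itv _)) (mem_set mB) sub).
by rewrite lee_fin leNgt subr_gt0 ab.
Qed.

Lemma measurable_enorm : measurable_fun setT (@enorm R n.+1).
Proof.
apply: (measurableT_comp _ (@measurable_sqnorm R n)).
by apply: continuous_measurable_fun; exact: sqrt_continuous.
Qed.

Lemma measurable_off_ball (r : R) : measurable [set x : E | r < enorm x].
Proof.
rewrite -[X in measurable X]setTI.
rewrite (_ : mkset _ = @enorm R n.+1 @^-1` `]r, +oo[%classic).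
  by apply: measurable_enorm => //; exact: measurable_itv.
by apply/seteqP; split => x /=; rewrite in_itv/= andbT.
Qed.

End cone_support.

Section solution.
Context (R : realType) (n : nat) (m p eps : R).
Local Notation E := 'rV[R]_n.+1.
Local Notation mu := (lebesgue_rV R n.+1).
Local Notation leb := (@lebesgue_measure R).
Local Notation vol := (spacetime_measure R n.+1).
Local Notation s := (1 - (m + 1)^-1).
Variables (f g : E -> R) (T : \bar R) (u ut : R -> E -> R).
Hypotheses (m0 : 0 <= m) (sol : energy_solution_with m p eps f g T u ut).
Hypotheses (hs : solution_support T u `<=` cone m T).
Hypotheses (f1 : ess_support mu.-negligible f `<=` [set x | enorm x <= 1]).
Hypotheses (g1 : ess_support mu.-negligible g `<=` [set x | enorm x <= 1]).

Let u_L2 t : time T t -> measurable_fun setT (u t) /\ ('N[mu]_2%:E [EFin \o u t] < +oo)%E.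
Proof. by move=> /(energy_cont sol).1; exact: in_sobolev_L2. Qed.

Let ut_L2 t : time T t -> measurable_fun setT (ut t) /\ ('N[mu]_2%:E [EFin \o ut t] < +oo)%E.
Proof. by move=> /(energy_cont_t sol).1; exact: in_sobolev_L2. Qed.

Let horizon0 : horizon m 0 = 0.
Proof. by rewrite /horizon powR0 ?mul0r// gt_eqF// ltr_wpDl. Qed.

Let horizon_le t t' : 0 <= t' -> t' <= t -> horizon m t' <= horizon m t.
Proof.
move=> t0 tt; rewrite /horizon ler_pM2r ?invr_gt0 ?ltr_wpDl//.
by apply: ge0_ler_powR; rewrite ?nnegrE ?addr_ge0//; exact: le_trans tt.
Qed.

(** The support condition in space-time says something about almost every time only. For a
    positive time, choose such a time just before it: the cone is smaller there, and [u] is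
    continuous in L^2. At time 0 the initial data decide. *)
Lemma solution_off_cone t : time T t ->
  {ae mu, forall x, 1 + horizon m t < enorm x -> u t x = 0}.
Proof.
move=> tT; have [t0 tT'] := tT.
move: t0; rewrite le_eqVlt => /predU1P[t0|t0].
  rewrite -t0 horizon0 addr0.
  have := energy_init sol; have := null_off_unit_ball f1.
  by apply: filterS2 => x h -> /h ->; rewrite mulr0.
apply: (ae_zero_of_L2_limit (measurable_off_ball _) (u_L2 tT).1) => e e0.
have e0' : (0 < e%:E)%E by rewrite lte_fin.
have [d /= d0 hd] := (energy_cont sol).2 _ tT _ (open_ereal_lt' e0').
have [t' [at' t't h]] : exists t', [/\ Num.max 0 (t - d) < t', t' < t &
    {ae mu, forall x, 1 + horizon m t' < enorm x -> u t' x = 0}].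
  have ab : Num.max 0 (t - d) < t by rewrite gt_max t0 ltrBlDr ltrDl.
  have [t' [at' t't h]] := ae_witness ab (negligible_section (null_off_cone m0 tT' hs)).
  exists t'; split => //; apply: negligibleS h => x /= /not_implyP[tx /eqP ux].
  by split => //; rewrite ltW//; move: at'; rewrite gt_max => /andP[].
move: at'; rewrite gt_max => /andP[t'0 t'd].
have t'T : time T t' by split; [exact: ltW|apply: lt_trans tT'; rewrite lte_fin].
exists (u t'); split; first exact: (u_L2 t'T).1.
  apply: filterS h => x hx tx; apply: hx; apply: le_lt_trans tx.
  by rewrite lerD2l; apply: horizon_le; exact: ltW.
apply: (le_trans (L2_le_sobolev 1 _)); apply: ltW; apply: hd => //=.
by rewrite /ball_ /= ltr_norml; apply/andP; split; lra.
Qed.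

(** The time derivative is an L^2 limit of difference quotients taken towards the past, which
    vanish outside the present cone. *)
Lemma solution_t_off_cone t : time T t ->
  {ae mu, forall x, 1 + horizon m t < enorm x -> ut t x = 0}.
Proof.
move=> tT; have [t0 tT'] := tT.
move: t0; rewrite le_eqVlt => /predU1P[t0|t0].
  rewrite -t0 horizon0 addr0.
  have := energy_init_t sol; have := null_off_unit_ball g1.
  by apply: filterS2 => x h -> /h ->; rewrite mulr0.
apply: (ae_zero_of_L2_limit (measurable_off_ball _) (ut_L2 tT).1) => e e0.
have e0' : (0 < e%:E)%E by rewrite lte_fin.
have [d /= d0 hd] := energy_derivative sol tT (open_ereal_lt' e0').
pose t' := Num.max (t / 2) (t - d / 2).
have t't : t' < t by rewrite gt_max; apply/andP; split; lra.
have t'0 : 0 < t' by rewrite lt_max; apply/orP; left; lra.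
have t'd : t - d < t' by rewrite lt_max; apply/orP; right; lra.
have t'T : time T t' by split; [exact: ltW|apply: lt_trans tT'; rewrite lte_fin].
clearbody t'.
exists (fun x => (u t' x - u t x) / (t' - t)); split.
- apply: measurable_funM => //; apply: measurable_funB; last exact: (u_L2 tT).1.
  exact: (u_L2 t'T).1.
- apply: filterS2 (solution_off_cone tT) (solution_off_cone t'T) => x h h' tx.
  rewrite h// h' ?subrr ?mul0r//; apply: le_lt_trans tx.
  by rewrite lerD2l; apply: horizon_le; exact: ltW.
apply: (le_trans (L2_le_sobolev s _)); apply: ltW; apply: hd => //=.
  by rewrite /ball_ /= ltr_norml; apply/andP; split; lra.
by rewrite lt_eqF.
Qed.

End solution.

(** * The weak form on the test functions *)

Lemma is_derive_of_quotient (R : realType) (V : R -> R) (t l : R) :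
  (forall e, 0 < e -> \forall t' \near t^', `|(V t' - V t) / (t' - t) - l| <= e) ->
  is_derive t 1 V l.
Proof.
move=> h.
have c : (fun y : R => y^-1 *: ((V \o shift t) (y *: (1 : R)) - V t)) @ 0^' --> l.
  apply/cvgrPdist_le => e e0.
  have [d /= d0 hd] := h e e0.
  exists d => //= y; rewrite /ball_/= sub0r normrN => yd y0.
  have := hd (y + t); rewrite /ball_/= opprD addrCA subrr addr0 normrN => /(_ yd).
  rewrite distrC /GRing.scale/= mulr1 addrK mulrC; apply.
  by rewrite -subr_eq0 addrK.
exact: (DeriveDef (cvgP _ c) (cvg_lim _ c)).
Qed.

Section pairing.
Context (R : realType) (n : nat) (r : R) (r0 : 0 <= r).
Local Notation E := 'rV[R]_n.+1.
Local Notation mu := (lebesgue_rV R n.+1).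
Local Notation chi := (@cutoff_exp R n r).

(** The cutoff makes this a bounded functional on L^2; on functions supported in the ball of
    radius [r] it is the integral against [plane_exp]. *)
Definition pairing (w : E -> R) : R := \int[mu]_x (w x * chi x).

Lemma pairing_integrable (s : R) w : in_sobolev s w ->
  mu.-integrable setT (EFin \o (fun x => w x * chi x)).
Proof.
move=> /in_sobolev_L2[mw w2].
exact: (L2_pairing mw (@measurable_cutoff_exp R n r) w2 (L2_cutoff_exp _ r0)).1.
Qed.

Lemma pairing_sobolev_le : exists2 C : R, 0 < C &
  forall (s e : R) w, measurable_fun setT w -> (sobolev_norm s w <= e%:E)%E ->
    `|pairing w| <= C * e.
Proof.
have c0 : (0 <= 'N[mu]_2%:E [EFin \o chi])%E by exact: Lnorm_ge0.
have cE : ('N[mu]_2%:E [EFin \o chi] = (fine ('N[mu]_2%:E [EFin \o chi]))%:E)%E.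
  by rewrite fineK// ge0_fin_numE//; exact: L2_cutoff_exp.
exists (fine ('N[mu]_2%:E [EFin \o chi]) + 1); first by rewrite ltr_wpDl// fine_ge0.
move=> s e w mw we.
have w2 := le_trans (L2_le_sobolev s w) we.
have := (L2_pairing mw (@measurable_cutoff_exp R n r) (le_lt_trans w2 (ltry e)) (L2_cutoff_exp _ r0)).2.
have we0 : (0 <= e%:E)%E by apply: le_trans w2; exact: Lnorm_ge0.
move=> h; rewrite -lee_fin; apply: (le_trans h).
apply: (le_trans (lee_pmul _ _ w2 (lexx _))) => //; first exact: Lnorm_ge0.
rewrite cE -EFinM lee_fin mulrC ler_pM//; first exact: fine_ge0.
by rewrite lerDl.
Qed.

Lemma pairingB s s' w v : in_sobolev s w -> in_sobolev s' v ->
  pairing (w \- v) = pairing w - pairing v.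
Proof.
move=> iw iv; rewrite /pairing -RintegralB//; [|exact: pairing_integrable iw|exact: pairing_integrable iv].
by apply: eq_Rintegral => x _; rewrite /= mulrBl.
Qed.

Lemma pairing_quotient s s' w v z h : in_sobolev s w -> in_sobolev s v -> in_sobolev s' z ->
  pairing (fun x => (w x - v x) / h - z x) = (pairing w - pairing v) / h - pairing z.
Proof.
move=> iw iv iz.
have iwv : mu.-integrable setT (EFin \o (fun x => (w x - v x) * chi x)).
  have := integrableB measurableT (pairing_integrable iw) (pairing_integrable iv).
  by apply: eq_integrable => // x _ /=; rewrite mulrBl.
have iq := integrable_mulr h^-1 measurableT iwv.
rewrite -(pairingB iw iv) /pairing -RintegralZr// -RintegralB//; last exact: pairing_integrable iz.
by apply: eq_Rintegral => x _ /=; ring.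
Qed.

End pairing.

Section functionals.
Context (R : realType) (n : nat) (m p eps : R).
Local Notation E := 'rV[R]_n.+1.
Local Notation mu := (lebesgue_rV R n.+1).
Local Notation leb := (@lebesgue_measure R).
Local Notation vol := (spacetime_measure R n.+1).
Local Notation s := (1 - (m + 1)^-1).
Variables (f g : E -> R) (T : \bar R) (u ut : R -> E -> R).
Hypotheses (m0 : 0 <= m) (sol : energy_solution_with m p eps f g T u ut).
Hypotheses (hs : solution_support T u `<=` cone m T).
Hypotheses (f1 : ess_support mu.-negligible f `<=` [set x | enorm x <= 1]).
Variable tau : R.
Hypotheses (tau0 : 0 < tau) (tauT : (tau%:E < T)%E).
(* Up to time [tau] the solution lives in the ball of radius [rho], strictly inside the ball of
   radius [r] where the cutoff exponential is the plane exponential. *)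
Local Notation rho := (1 + horizon m tau).
Local Notation r := (2 + horizon m tau).
Local Notation chi := (@cutoff_exp R n r).

Let horizon_ge0 t : 0 <= horizon m t.
Proof. by rewrite /horizon divr_ge0 ?powR_ge0// addr_ge0. Qed.

Let r0 : 0 <= r. Proof. by rewrite addr_ge0. Qed.

Definition pair_ut (t : R) : R := pairing r (ut t).
Definition pair_u (t : R) : R := pairing r (u t).

Lemma sobolev_pairing_continuous (s' : R) (w : R -> E -> R) : sobolev_continuous s' T w ->
  {within time T, continuous (fun t => pairing r (w t))}.
Proof.
move=> [iw cw]; apply/subspace_continuousP => t tT.
have [C C0 hC] := @pairing_sobolev_le R n r r0.
apply/cvgrPdist_le => e e0.
have eC : (0 < (e / C)%:E)%E by rewrite lte_fin divr_gt0.
have [d /= d0 hd] := cw _ tT _ (open_ereal_lt' eC).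
exists d => //= t' tt' t'T; rewrite distrC -(pairingB r0 (iw _ t'T) (iw _ tT)).
have -> : e = C * (e / C) by field; rewrite gt_eqF.
apply: (hC s'); last exact/ltW/hd.
by apply: measurable_funB; [have [] := iw _ t'T|have [] := iw _ tT].
Qed.

Lemma is_derive_pair_u t : 0 < t -> (t%:E < T)%E -> is_derive t 1 pair_u (pair_ut t).
Proof.
move=> t0 tT; have tT' : time T t by split => //; exact: ltW.
have [C C0 hC] := @pairing_sobolev_le R n r r0.
apply: is_derive_of_quotient => e e0.
have eC : (0 < (e / C)%:E)%E by rewrite lte_fin divr_gt0.
have [d /= d0 hd] := energy_derivative sol tT' (open_ereal_lt' eC).
have [d' /= d'0 hd'] : \forall t' \near t, time_pos T t'.
  by apply: open_nbhs_nbhs; split => //; exact: open_time_pos.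
exists (Num.min d d'); first by rewrite /= lt_min d0.
move=> t' /=; rewrite /ball_/= lt_min => /andP[td td'] t't.
have [t'0 t'T] := hd' _ td'.
have tT2 : time T t' by split => //; exact: ltW.
have iu := (energy_cont_s sol).1.
rewrite -(pairing_quotient r0 (t' - t) (iu _ tT2) (iu _ tT') ((energy_cont_t sol).1 _ tT')).
have -> : e = C * (e / C) by field; rewrite gt_eqF.
apply: (hC s); last exact/ltW/hd.
apply: measurable_funB; last by have [] := (energy_cont_t sol).1 _ tT'.
apply: measurable_funM => //; apply: measurable_funB; first by have [] := iu _ tT2.
by have [] := iu _ tT'.
Qed.

Lemma weak_laplacian_pair_u t : 0 < t -> t <= tau ->
  let F x := \sum_(i < n.+1) weak_partial i (u t) x * 'D_(basis_rV R i) chi x in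
  mu.-integrable setT (EFin \o F) /\ \int[mu]_x F x = - pair_u t.
Proof.
move=> t0 tt; have tT : time T t.
  by split; [exact: ltW|apply: le_lt_trans tauT; rewrite lee_fin].
apply: (@weak_laplacian R n (u t) rho).
- by rewrite addr_ge0.
- by rewrite ltrD2r ltr1n.
- exact: (energy_cont sol).1.
apply: filterS (solution_off_cone m0 sol hs f1 tT) => x h xr; apply: h.
apply: le_lt_trans xr; rewrite lerD2l /horizon ler_pM2r ?invr_gt0 ?ltr_wpDl//.
by apply: ge0_ler_powR; rewrite ?nnegrE ?addr_ge0//; exact: ltW.
Qed.

Section test.
Variables (a d : R).
Hypotheses (a0 : 0 <= a) (d0 : 0 < d) (adtau : a + d <= tau).

Local Notation b := (a + d).
Local Notation ws := (weight_step m a d).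
Local Notation ws' := (weight_step' m a d).
Local Notation ds := ('D_1 (@time_step R a d)).
Local Notation W := (fun t => weight m t * pair_ut t + coweight m t * pair_u t).

Let b0 : 0 < b. Proof. by rewrite ltr_wpDl. Qed.

Lemma Rintegral_time_pos (F : R -> R) (c : R) : (c%:E < T)%E ->
  (forall t, c < t -> F t = 0) ->
  \int[leb]_(t in time_pos T) F t = \int[leb]_(t in `]0, c]) F t.
Proof.
move=> cT F0; rewrite Rintegral_mkcond [RHS]Rintegral_mkcond.
apply: eq_Rintegral => t _; rewrite !patchE.
have [tc|tc] := leP t c; last by rewrite F0//; case: ifP; case: ifP.
congr (if _ then _ else _); apply/idP/idP; rewrite !inE /= in_itv/=.
  by move=> [-> _].
by move=> /andP[t0 _]; split => //; apply: le_lt_trans cT; rewrite lee_fin.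
Qed.

Let bT : (b%:E < T)%E. Proof. by apply: le_lt_trans tauT; rewrite lee_fin. Qed.

Lemma weak_rhs1 :
  \int[leb]_(t in time_pos T) \int[mu]_x (- ut t x * dt (test_psi m a d r) (t, x)) =
  \int[leb]_(t in `]0, b]) (- (ws' t * pair_ut t)).
Proof.
rewrite -(Rintegral_time_pos bT); last first.
  move=> t bt; rewrite /weight_step' time_step_ge ?(ltW bt)// mulr0 add0r.
  rewrite (_ : 'D_1 _ t = 0) ?mulr0 ?mul0r ?oppr0//.
  rewrite (@near_eq_derive _ _ _ _ (cst 0)) ?derive_cst//.
  near=> t'; apply: time_step_ge => //; apply: ltW; near: t'.
  by apply: open_nbhs_nbhs; split => //; exact: open_gt.
apply: eq_Rintegral => t; rewrite inE => -[t0 tT].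
have tT' : time T t by split => //; exact: ltW.
rewrite /pair_ut /pairing -mulNr -RintegralZl//; last first.
  exact: (pairing_integrable r0 ((energy_cont_t sol).1 _ tT')).
by apply: eq_Rintegral => x _; rewrite dt_test_psi//; ring.
Unshelve. all: by end_near. Qed.

Lemma weak_rhs2 :
  \int[leb]_(t in time_pos T) \int[mu]_x (t `^ (2 * m) *
     \sum_(i < n.+1) weak_partial i (u t) x * dx i (test_psi m a d r) (t, x)) =
  \int[leb]_(t in `]0, b]) (- (t `^ (2 * m) * ws t * pair_u t)).
Proof.
have ws0 t : b < t -> ws t = 0.
  by move=> bt; rewrite /weight_step time_step_ge ?(ltW bt)// mulr0.
rewrite -(Rintegral_time_pos bT); last by move=> t /ws0 ->; rewrite mulr0 mul0r oppr0.
apply: eq_Rintegral => t; rewrite inE => -[t0 tT].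
pose F x := \sum_(i < n.+1) weak_partial i (u t) x * 'D_(basis_rV R i) chi x.
transitivity (\int[mu]_x (t `^ (2 * m) * ws t * F x)).
  apply: eq_Rintegral => x _; rewrite -mulrA; congr (_ * _).
  by rewrite mulr_sumr; apply: eq_bigr => i _; rewrite dx_test_psi; ring.
have [tb|bt] := leP t b.
  have [iF eF] := weak_laplacian_pair_u t0 (le_trans tb adtau).
  by rewrite RintegralZl// eF mulrN.
rewrite ws0// mulr0 mul0r oppr0 (_ : (fun x => _) = cst 0) ?Rintegral_cst ?mul0r//.
by apply/funext => x; rewrite mul0r.
Qed.

Let itv_time : `[0, b]%classic `<=` time T.
Proof.
by move=> t /=; rewrite in_itv/= => /andP[t0 tb]; split => //; apply: le_lt_trans bT; rewrite lee_fin.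
Qed.

Let cU : {within `[0, b], continuous pair_ut}.
Proof. exact: continuous_subspaceW itv_time (sobolev_pairing_continuous (energy_cont_t sol)). Qed.

Let cV : {within `[0, b], continuous pair_u}.
Proof. exact: continuous_subspaceW itv_time (sobolev_pairing_continuous (energy_cont sol)). Qed.

Let cw : {within `[0, b], continuous (weight m)}.
Proof. by apply: continuous_subspaceT => t; exact: weight_continuous. Qed.

Let cl : {within `[0, b], continuous (coweight m)}.
Proof. by apply: continuous_subspaceT => t; exact: coweight_continuous. Qed.

Let cs : {within `[0, b], continuous (@time_step R a d)}.
Proof. by apply: continuous_subspaceT; apply: smooth_continuous; exact: smooth_time_step. Qed.

Let cds : {within `[0, b], continuous ds}.
Proof.
apply: continuous_subspaceT; apply: smooth_continuous; apply: smooth_derive.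
exact: smooth_time_step.
Qed.

Let cp : {within `[0, b], continuous (fun t : R => t `^ (2 * m))}.
Proof.
have [->|mn0] := eqVneq m 0.
  rewrite (_ : (fun t => _) = cst 1); first exact: cst_continuous.
  by apply/funext => t; rewrite mulr0 powRr0.
have m2 : 0 < 2 * m by rewrite mulr_gt0// lt_def mn0.
have : {within `[0, b], continuous (fun t : R => Num.max t 0 `^ (2 * m))}.
  by apply: continuous_subspaceT => t; exact: powR_max0_continuous.
apply: subspace_eq_continuous => t; rewrite inE /= in_itv/= => /andP[t0 _].
by rewrite /from_subspace max_l.
Qed.

Let cM (F G : R -> R) : {within `[0, b], continuous F} -> {within `[0, b], continuous G} ->
  {within `[0, b], continuous (fun t => F t * G t)}.
Proof. by move=> cF cG t; apply: cvgM; [exact: cF|exact: cG]. Qed.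

Let cD (F G : R -> R) : {within `[0, b], continuous F} -> {within `[0, b], continuous G} ->
  {within `[0, b], continuous (fun t => F t + G t)}.
Proof. by move=> cF cG t; apply: cvgD; [exact: cF|exact: cG]. Qed.

Let cN (F : R -> R) : {within `[0, b], continuous F} ->
  {within `[0, b], continuous (fun t => - F t)}.
Proof. by move=> cF t; apply: cvgN; exact: cF. Qed.

Let cC (c : R) : {within `[0, b], continuous (fun=> c)}.
Proof. by move=> t; exact: cvg_cst. Qed.

Let integrable_c (F : R -> R) : {within `[0, b], continuous F} ->
  leb.-integrable `[0, b] (EFin \o F).
Proof. by move=> cF; apply: continuous_compact_integrable => //; exact: segment_compact. Qed.

Let oc_cc (F : R -> R) : {within `[0, b], continuous F} ->
  \int[leb]_(t in `]0, b]) F t = \int[leb]_(t in `[0, b]) F t.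
Proof.
move=> cF; apply: Rintegral_itv_obnd_cbnd; apply: integrableS (integrable_c cF) => //.
exact: subset_itv_oc_cc.
Qed.

(** Let [W = weight U + coweight V]. The integrands add up to the derivative of
    [time_step * (coweight V - Wc)] minus [time_step' * (W - Wc)]. Subtracting a constant [Wc]
    from [W] leaves a remainder that is small when [W] is close to [Wc] on [a, a + d]. *)
Lemma weak_rhs (Wc : R) :
  \int[leb]_(t in time_pos T) \int[mu]_x (- ut t x * dt (test_psi m a d r) (t, x)) +
  \int[leb]_(t in time_pos T) \int[mu]_x (t `^ (2 * m) *
     \sum_(i < n.+1) weak_partial i (u t) x * dx i (test_psi m a d r) (t, x)) =
  Wc - coweight m 0 * pair_u 0 - \int[leb]_(t in `[0, b]) (ds t * (W t - Wc)).
Proof.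
have cws : {within `[0, b], continuous ws} by exact: cM.
have cws' : {within `[0, b], continuous ws'} by apply: cD; [apply: cM => //; exact: cN|exact: cM].
have c1 : {within `[0, b], continuous (fun t => - (ws' t * pair_ut t))} by apply: cN; exact: cM.
have c2 : {within `[0, b], continuous (fun t => - (t `^ (2 * m) * ws t * pair_u t))}.
  by apply: cN; do 2 apply: cM => //.
have c3 : {within `[0, b], continuous (fun t => ds t * (W t - Wc))}.
  by apply: cM => //; apply: cD => //; apply: cD; exact: cM.
rewrite weak_rhs1 weak_rhs2 !oc_cc// -RintegralD//; [|exact: integrable_c|exact: integrable_c].
pose F t := time_step a d t * (coweight m t * pair_u t - Wc).
pose f' t := ds t * (coweight m t * pair_u t - Wc) + time_step a d t *
  (- (t `^ (2 * m) * weight m t) * pair_u t + coweight m t * pair_ut t).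
have cF : {within `[0, b], continuous F}.
  by apply: cM => //; apply: cD => //; exact: cM.
have cf' : {within `[0, b], continuous f'}.
  apply: cD; apply: cM => //.
    by apply: cD => //; exact: cM.
  by apply: cD; [apply: cM => //; apply: cN; exact: cM|exact: cM].
have dF t : 0 < t -> t < b -> is_derive t 1 F (f' t).
  move=> t0 tb; apply: is_derive1M; first exact: is_derive_time_step.
  have tT : (t%:E < T)%E by apply: lt_trans bT; rewrite lte_fin.
  have h := is_derive1M (is_derive_coweight m0 t0) (is_derive_pair_u t0 tT).
  by apply: (is_derive_eq (is_derive1B h (is_derive_cst Wc t (1 : R)))); rewrite subr0.
have ftc : \int[leb]_(t in `[0, b]) f' t = F b - F 0.
  rewrite /Rintegral (@continuous_FTC2 _ f' F 0 b)//.
  - have /continuous_within_itvP [//|_ c0 cb] := cF.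
    split => // t; rewrite in_itv/= => /andP[t0 tb]; by have [] := dF t t0 tb.
  - move=> t; rewrite in_itv/= => /andP[t0 tb]; have := dF t t0 tb.
    by move=> h; rewrite derive1E derive_val.
have -> : Wc - coweight m 0 * pair_u 0 = F b - F 0.
  by rewrite /F time_step_ge// time_step_le//; ring.
rewrite -ftc -RintegralB//; [|exact: integrable_c|exact: integrable_c].
by apply: eq_Rintegral => t _; rewrite /f' /weight_step' /weight_step; ring.
Qed.

(** The derivative of the step is at most [M / d] and lives on an interval of length [d]. *)
Lemma weak_rhs_bound (Wc eta M : R) : (forall x : R, `|'D_1 (@step R) x| <= M) ->
  (forall t, a <= t -> t <= b -> `|W t - Wc| <= eta) ->
  `|\int[leb]_(t in `[0, b]) (ds t * (W t - Wc))| <= M * eta.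
Proof.
move=> hM hW.
have M0 : 0 <= M by exact: le_trans (hM 0).
have ab : a <= b by rewrite lerDl ltW.
have eta0 : 0 <= eta by apply: le_trans (hW a (lexx _) ab).
have dsE t : ds t = 'D_1 (@step R) ((t - a) / d) / d.
  have h1 : is_derive t 1 (fun t : R => (t - a) / d) d^-1.
    have h := is_derive1Ml d^-1 (is_derive1B (is_derive_id t (1 : R)) (is_derive_cst a t (1 : R))).
    rewrite (_ : (fun t => _) = (fun y => d^-1 * (id y - cst a y))).
      by apply: (is_derive_eq h); rewrite subr0 mulr1.
    by apply/funext => y; rewrite mulrC.
  have h2 : is_derive ((t - a) / d) 1 (@step R) ('D_1 (@step R) ((t - a) / d)).
    by apply: derivableP; exact: smooth_derivable (@smooth_step R).
  have h3 := @is_derive1_comp _ (@step R) (fun t : R => (t - a) / d) t _ _ h2 h1.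
  by have [_ e] := h3; exact: e.
have ds0 t : t < a -> ds t = 0.
  move=> ta; rewrite (@near_eq_derive _ _ _ (time_step a d) (cst 1)) ?derive_cst//.
  near=> t'; apply: time_step_le => //; apply: ltW; near: t'.
  by apply: open_nbhs_nbhs; split => //; exact: open_lt.
have ih : leb.-integrable `[a, b] (EFin \o (fun t => ds t * (W t - Wc))).
  apply: integrableS (integrable_c _) => //; first by apply: subset_itvr; rewrite bnd_simp.
  by apply: cM => //; apply: cD => //; apply: cD; exact: cM.
have -> : \int[leb]_(t in `[0, b]) (ds t * (W t - Wc)) =
    \int[leb]_(t in `[a, b]) (ds t * (W t - Wc)).
  rewrite Rintegral_mkcond [RHS]Rintegral_mkcond; apply: eq_Rintegral => t _.
  rewrite !patchE; have [at_|ta] := leP a t.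
    by congr (if _ then _ else _); apply/idP/idP; rewrite !inE/= !in_itv/= at_ ?(le_trans a0 at_).
  by rewrite ds0// mul0r; case: ifP; case: ifP.
apply: (le_trans (le_normr_Rintegral _ ih)) => //.
apply: (@le_trans _ _ (\int[leb]_(t in `[a, b]) (M * eta / d))).
  apply: le_Rintegral => //.
  - by apply: eq_integrable (integrable_norm ih).
  - by apply: continuous_compact_integrable; [exact: segment_compact|move=> t; exact: cvg_cst].
  move=> t; rewrite /= in_itv/= => /andP[at_ tb].
  rewrite normrM dsE normrM mulrAC ler_pM//; last first.
    by rewrite normfV (gtr0_norm d0).
  by rewrite ler_pM//; exact: hW.
rewrite Rintegral_cst//= lebesgue_measure_itv/= lte_fin ltrDl d0 -EFinB /=.
by rewrite le_eqVlt; apply/orP; left; apply/eqP; field; rewrite gt_eqF.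
Unshelve. all: by end_near. Qed.

End test.

End functionals.

(** * The source term *)

Section source.
Context (R : realType) (n : nat) (m p eps : R).
Local Notation E := 'rV[R]_n.+1.
Local Notation mu := (lebesgue_rV R n.+1).
Local Notation leb := (@lebesgue_measure R).
Local Notation vol := (spacetime_measure R n.+1).
Variables (f g : E -> R) (T : \bar R) (u ut : R -> E -> R).
Hypotheses (m0 : 0 <= m) (sol : energy_solution_with m p eps f g T u ut).
Variable r : R.
Hypothesis r0 : 0 <= r.
Local Notation chi := (@cutoff_exp R n r).

Definition source (t : R) : R := \int[mu]_x (`|ut t x| `^ p * chi x).

Lemma source_ge0 t : 0 <= source t.
Proof. by apply: Rintegral_ge0 => x _; rewrite mulr_ge0 ?powR_ge0 ?cutoff_exp_ge0. Qed.

Section test.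
Variables (a d : R).
Hypotheses (a0 : 0 <= a) (d0 : 0 < d) (adT : ((a + d)%:E < T)%E).
Local Notation ws := (weight_step m a d).

Let ws_ge0 t : 0 <= ws t.
Proof. by rewrite mulr_ge0 ?step_ge0// ltW// weight_gt0. Qed.

Let measurable_source t : time T t ->
  measurable_fun setT (fun x => `|ut t x| `^ p * chi x).
Proof.
move=> tT; have [mu_ _ _] := (energy_cont_t sol).1 _ tT.
apply: measurable_funM; last exact: measurable_cutoff_exp.
by apply: (measurableT_comp (measurable_powR _)); exact: measurableT_comp.
Qed.

(** At the times where the integrals diverge, both sides are 0. *)
Lemma Rintegral_source_test t : time T t ->
  \int[mu]_x (`|ut t x| `^ p * test_psi m a d r (t, x)) = ws t * source t.
Proof.
move=> tT.
rewrite /Rintegral (eq_integral (fun x => (ws t)%:E * (`|ut t x| `^ p * chi x)%:E)%E).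
  rewrite ge0_integralZl_EFin//.
  - set X := (\int[mu]_x (`|ut t x| `^ p * chi x)%:E)%E.
    rewrite (_ : source t = fine X)//; case: X => [y| |] //=.
      have [->|k0] := eqVneq (ws t) 0; first by rewrite mul0e mul0r.
      by rewrite mulr0 gt0_muley// lte_fin lt_def k0 ws_ge0.
    have [->|k0] := eqVneq (ws t) 0; first by rewrite mul0e mul0r.
    by rewrite mulr0 gt0_muleNy// lte_fin lt_def k0 ws_ge0.
  - by move=> x _; rewrite lee_fin mulr_ge0 ?powR_ge0 ?cutoff_exp_ge0.
  - by apply/measurable_EFinP; exact: measurable_source.
by move=> x _; rewrite -EFinM; congr EFin; rewrite /test_psi/=/weight_step; ring.
Qed.

Let h (z : R * E) : \bar R := (`|ut z.1 z.2| `^ p * test_psi m a d r z)%:E.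

Let measurable_slab_pos : measurable (@slab_pos R n.+1 T : set (measurableTypeR R * E)).
Proof.
apply: measurableX; last exact: measurableT.
by apply: open_measurable; exact: open_time_pos.
Qed.

Let ih : vol.-integrable setT (h \_ (@slab_pos R n.+1 T)).
Proof.
apply/(integrable_mkcond _ measurable_slab_pos); apply: (energy_integrable sol).
exact: test_function_test_psi.
Qed.

Let hE t x : time_pos T t -> (h \_ (@slab_pos R n.+1 T)) (t, x) = (`|ut t x| `^ p * test_psi m a d r (t, x))%:E.
Proof. by move=> tT; rewrite patchE mem_set. Qed.

(** Fubini, from the integrability in space-time that a solution provides. *)
Lemma source_test_integrable : leb.-integrable (time_pos T) (EFin \o (fun t => ws t * source t)).
Proof.
have := integrable_fubini_F ih.
set F := fubini_F _ _ => iF.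
have mF := measurable_int _ iF.
apply/(integrable_mkcond _ _).
  by apply: open_measurable; exact: open_time_pos.
rewrite (_ : _ \_ _ = EFin \o (fine \o F)).
  apply: (le_integrable _ _ _ iF) => //.
    by apply/measurable_EFinP; apply: measurableT_comp.
  by move=> t _ /=; case: (F t) => //= *; rewrite ?normr0 ?lee_fin ?leey.
apply/funext => t; rewrite patchE; case: ifPn.
  rewrite inE => tT /=; congr EFin; rewrite -Rintegral_source_test//.
    by congr fine; apply: eq_integral => x _; rewrite hE.
  by case: tT => /ltW.
move=> /negP; rewrite inE => ntT /=; rewrite /F /fubini_F integral0_eq// => x _.
by rewrite patchE memNset// => -[].
Qed.

Lemma ae_source_integrable : {ae leb, forall t : R, 0 < t -> t <= a ->
  mu.-integrable setT (EFin \o (fun x => `|ut t x| `^ p * chi x))}.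
Proof.
have := ae_integrable1 ih.
apply: filterS => t it t0 ta.
have tT : time_pos T t.
  by split => //; apply: lt_trans adT; rewrite lte_fin ltr_pwDr.
have ws0 : 0 < ws t by rewrite /weight_step time_step_le// mulr1 weight_gt0.
have := integrableZl measurableT (ws t)^-1 it.
apply: eq_integrable => // x _.
rewrite hE// -EFinM /=; congr EFin; rewrite /test_psi/= -/(weight_step m a d t).
by field; rewrite gt_eqF.
Qed.

Lemma weak_source :
  \int[leb]_(t in time_pos T) \int[mu]_x (`|ut t x| `^ p * test_psi m a d r (t, x)) =
  \int[leb]_(t in time_pos T) (ws t * source t).
Proof.
by apply: eq_Rintegral => t; rewrite inE => -[t0 tT]; apply: Rintegral_source_test; split => //; exact: ltW.
Qed.

End test.
End source.

(** * Energy balance *)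

Lemma le_Rintegral_subset d (T : measurableType d) (R : realType)
    (mu : {measure set T -> \bar R}) (A B : set T) (F : T -> R) :
  measurable A -> measurable B -> A `<=` B -> (forall x, B x -> 0 <= F x) ->
  mu.-integrable B (EFin \o F) ->
  \int[mu]_(x in A) F x <= \int[mu]_(x in B) F x.
Proof.
move=> mA mB AB F0 iF; apply: fine_le.
- by apply: integrable_fin_num => //; exact: integrableS iF.
- exact: integrable_fin_num.
apply: ge0_subset_integral => //; exact: measurable_int iF.
Qed.

Lemma derive_step_bounded (R : realType) : exists M : R, forall x : R, `|'D_1 (@step R) x| <= M.
Proof.
have cd : continuous ('D_1 (@step R)).
  by apply: smooth_continuous; apply: smooth_derive; exact: smooth_step.
have c1 : {within `[0, 1], continuous (fun x : R => `|'D_1 (@step R) x|)}.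
  by apply: continuous_subspaceT => x; apply: cvg_norm; exact: cd.
have [c _ hc] := EVT_max (@ler01 R) c1.
exists `|'D_1 (@step R) c| => x.
have [x0|x0] := ltP x 0.
  rewrite (@near_eq_derive _ _ _ (@step R) (cst (1 : R))) ?derive_cst ?normr0//.
  near=> y; apply: step_le0; apply: ltW; near: y.
  by apply: open_nbhs_nbhs; split => //; exact: open_lt.
have [x1|x1] := ltP 1 x.
  rewrite (@near_eq_derive _ _ _ (@step R) (cst (0 : R))) ?derive_cst ?normr0//.
  near=> y; apply: step_ge1; apply: ltW; near: y.
  by apply: open_nbhs_nbhs; split => //; exact: open_gt.
by apply: hc; rewrite in_itv/= x0.
Unshelve. all: by end_near. Qed.

Section energy_functional.
Context (R : realType) (n : nat) (m p eps : R).
Local Notation E := 'rV[R]_n.+1.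
Local Notation mu := (lebesgue_rV R n.+1).
Local Notation leb := (@lebesgue_measure R).
Local Notation s := (1 - (m + 1)^-1).
Variables (f g : E -> R) (T : \bar R) (u ut : R -> E -> R).
Hypotheses (m0 : 0 <= m) (sol : energy_solution_with m p eps f g T u ut).
Hypotheses (hs : solution_support T u `<=` cone m T).
Hypotheses (fs : in_sobolev 1 f) (gs : in_sobolev s g).
Hypotheses (f1 : ess_support mu.-negligible f `<=` [set x | enorm x <= 1]).
Variable tau : R.
Hypotheses (tau0 : 0 < tau) (tauT : (tau%:E < T)%E).
Local Notation r := (2 + horizon m tau).
Local Notation chi := (@cutoff_exp R n r).
Local Notation U := (pair_ut m ut tau).
Local Notation V := (pair_u m u tau).
Local Notation G := (source p ut r).

Definition energy_functional t := weight m t * U t + coweight m t * V t.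
Local Notation W := energy_functional.

Definition initial_energy := eps * weight m 0 * (a_coef m * pairing r f + pairing r g).

Let r0 : 0 <= r.
Proof. by rewrite addr_ge0// /horizon divr_ge0 ?powR_ge0// addr_ge0. Qed.

Lemma pair_u0 : V 0 = eps * pairing r f.
Proof.
rewrite /pair_u /pairing -RintegralZl//; last exact: (pairing_integrable r0 fs).
have T0 : time T 0 by split => //; apply: lt_trans tauT; rewrite lte_fin.
have [mu0 _ _] := (energy_cont sol).1 _ T0.
have [mf _ _] := fs.
apply: eq_ae_Rintegral.
- by apply: measurable_funM => //; exact: measurable_cutoff_exp.
- by apply: measurable_funM => //; apply: measurable_funM => //; exact: measurable_cutoff_exp.
by apply: filterS (energy_init sol) => x ->; rewrite mulrA.
Qed.

Lemma energy_functional_continuous : {within time T, continuous W}.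
Proof.
have cU : {within time T, continuous U}.
  exact: (sobolev_pairing_continuous m0 (energy_cont_t sol)).
have cV : {within time T, continuous V}.
  exact: (sobolev_pairing_continuous m0 (energy_cont sol)).
have cw : {within time T, continuous (weight m)}.
  by apply: continuous_subspaceT => x; exact: weight_continuous.
have cl : {within time T, continuous (coweight m)}.
  by apply: continuous_subspaceT => x; exact: coweight_continuous.
by move=> t; apply: cvgD; apply: cvgM; [exact: cw|exact: cU|exact: cl|exact: cV].
Qed.

(** The energy identity, read on a test function that follows the weight up to time [a] and drops
    to 0 before [a + d]. *)
Lemma source_test_energy (a d Wc eta M : R) : 0 <= a -> 0 < d -> a + d <= tau ->
  (forall x : R, `|'D_1 (@step R) x| <= M) ->
  (forall t, a <= t -> t <= a + d -> `|W t - Wc| <= eta) ->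
  `|\int[leb]_(t in time_pos T) (weight_step m a d t * G t) - (Wc - initial_energy)| <= M * eta.
Proof.
move=> a0 d0 adt hM hW.
have adT : ((a + d)%:E < T)%E by apply: le_lt_trans tauT; rewrite lee_fin.
have := energy_identity sol (test_function_test_psi n m0 a0 d0 r0 adT).
rewrite (weak_source m0 sol) (weak_rhs m0 sol hs f1 tau0 tauT a0 d0 adt Wc).
rewrite coweight0// pair_u0.
have -> : \int[mu]_x (g x * test_psi m a d r (0, x)) = weight m 0 * pairing r g.
  rewrite /pairing -RintegralZl//; last exact: (pairing_integrable r0 gs).
  by apply: eq_Rintegral => x _; rewrite /test_psi /= time_step_le//; ring.
set S := \int[leb]_(t in _) _; set D := \int[leb]_(t in _) _ => e.
have -> : S - (Wc - initial_energy) = - D.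
  rewrite /initial_energy; set X := pairing r f in e *; set Y := pairing r g in e *.
  clearbody X Y S D; lra.
by rewrite normrN; exact: (weak_rhs_bound m0 sol tauT a0 d0 adt hM hW).
Qed.

(** A step that drops just after [c] bounds the integral of the source from above, a step that
    drops just before [c] bounds it from below, and [energy_functional] is continuous at [c]. *)
Lemma energy_balance c : 0 < c -> c < tau ->
  leb.-integrable `]0, c] (EFin \o (fun t => weight m t * G t)) /\
  W c = initial_energy + \int[leb]_(t in `]0, c]) (weight m t * G t).
Proof.
move=> c0 ct.
have cT : (c%:E < T)%E by apply: lt_trans tauT; rewrite lte_fin.
have wG0 t : 0 <= weight m t * G t.
  by rewrite mulr_ge0 ?source_ge0// ltW// weight_gt0.
have mtp : measurable (time_pos T : set (measurableTypeR R)).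
  by apply: open_measurable; exact: open_time_pos.
have sub : `]0, c]%classic `<=` time_pos T.
  by move=> t /=; rewrite in_itv/= => /andP[t0 tc]; split => //; apply: le_lt_trans cT; rewrite lee_fin.
have ti a d : 0 <= a -> 0 < d -> a + d <= tau ->
    leb.-integrable (time_pos T) (EFin \o (fun t => weight_step m a d t * G t)).
  move=> a0 d0 adt; apply: (source_test_integrable m0 sol r0) => //.
  by apply: le_lt_trans tauT; rewrite lee_fin.
have wsE d t : 0 < d -> t <= c -> weight_step m c d t = weight m t.
  by move=> d0 tc; rewrite /weight_step time_step_le// mulr1.
have ic : leb.-integrable `]0, c] (EFin \o (fun t => weight m t * G t)).
  have d0 : 0 < tau - c by rewrite subr_gt0.
  have ctau : c + (tau - c) <= tau by rewrite addrC subrK.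
  have i1 := integrableS mtp (measurable_itv _) sub (ti c (tau - c) (ltW c0) d0 ctau).
  apply: eq_integrable i1 => // t; rewrite inE /= in_itv/= => /andP[_ tc].
  by rewrite wsE.
split => //.
set I := \int[leb]_(t in _) _.
have [M hM] := derive_step_bounded R.
have M0 : 0 <= M by exact: le_trans (hM 0).
have key e : 0 < e -> `|I - (W c - initial_energy)| <= e.
  move=> e0; pose eta := e / (M + 1).
  have eta0 : 0 < eta by rewrite divr_gt0// ltr_wpDl.
  have Me : M * eta <= e.
    by rewrite /eta mulrA ler_pdivrMr ?ltr_wpDl// mulrC ler_pM2l// lerDl.
  have [d [d0 dc dt hd]] : exists d, [/\ 0 < d, d <= c, c + d <= tau &
      forall t, c - d <= t -> t <= c + d -> `|W t - W c| <= eta].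
    have := (subspace_continuousP _ _).1 energy_functional_continuous c (conj (ltW c0) cT).
    move=> /cvgrPdist_le /(_ _ eta0)[del /= del0 hdel].
    pose d := Num.min (del / 2) (Num.min c (tau - c)).
    have d0 : 0 < d by rewrite !lt_min divr_gt0//= c0 subr_gt0.
    have dd : d <= del / 2 by rewrite ge_min lexx.
    have dc : d <= c by rewrite !ge_min lexx orbT.
    have dt : d <= tau - c by rewrite !ge_min lexx !orbT.
    clearbody d.
    exists d; split => //; first by rewrite addrC -lerBrDr.
    move=> t ct1 ct2; rewrite distrC; apply: hdel.
      by rewrite /ball_/= ltr_norml; apply/andP; split; lra.
    split; first by apply: le_trans ct1; rewrite subr_ge0.
    by apply: le_lt_trans tauT; rewrite lee_fin; lra.
  have up : I <= W c - initial_energy + e.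
    have := @source_test_energy c d (W c) eta M (ltW c0) d0 dt hM.
    have h t : c <= t -> t <= c + d -> `|W t - W c| <= eta.
      by move=> ? ?; apply: hd => //; lra.
    move=> /(_ h); set S := \int[leb]_(t in _) _ => hS.
    have IS : I <= S.
      have -> : I = \int[leb]_(t in `]0, c]) (weight_step m c d t * G t).
        by apply: eq_Rintegral => t; rewrite inE /= in_itv/= => /andP[_ tc]; rewrite wsE.
      apply: le_Rintegral_subset => //.
        move=> t _; rewrite mulr_ge0 ?source_ge0// /weight_step mulr_ge0 ?step_ge0//.
        by rewrite (ltW (weight_gt0 m0 t)).
      exact: ti (ltW c0) d0 dt.
    by move: hS; rewrite ler_norml => /andP[_ hS]; lra.
  have lo : W c - initial_energy - e <= I.
    have cd0 : 0 <= c - d by rewrite subr_ge0.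
    have cdt : c - d + d <= tau by rewrite subrK ltW.
    have := @source_test_energy (c - d) d (W c) eta M cd0 d0 cdt hM.
    have h t : c - d <= t -> t <= c - d + d -> `|W t - W c| <= eta.
      by move=> ? ?; apply: hd => //; lra.
    move=> /(_ h); set S := \int[leb]_(t in _) _ => hS.
    have IS : S <= I.
      have -> : S = \int[leb]_(t in `]0, c]) (weight_step m (c - d) d t * G t).
        apply: Rintegral_time_pos cT _ => t ct'; rewrite /weight_step time_step_ge ?mulr0 ?mul0r//.
        by rewrite subrK ltW.
      apply: le_Rintegral => //.
        exact: integrableS mtp (measurable_itv _) sub (ti (c - d) d cd0 d0 cdt).
      move=> t _; apply: ler_wpM2r; first exact: source_ge0.
      by rewrite /weight_step ler_piMr ?step_le1// ltW// weight_gt0.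
    by move: hS; rewrite ler_norml => /andP[hS _]; lra.
  by rewrite ler_norml; apply/andP; split; lra.
suff : I = W c - initial_energy by move=> ->; rewrite addrC subrK.
apply/eqP; rewrite -subr_eq0 -normr_le0; apply/ler_addgt0Pr => e e0.
by rewrite add0r key.
Qed.

End energy_functional.

(** * Lower bound for the source *)

(** Split the integrand as [(|w| psi^(1/p)) psi^(1/q)], the second factor being restricted to [D]. *)
Lemma holder_weighted d (T : measurableType d) (R : realType)
    (mu : {measure set T -> \bar R}) (D : set T) (w psi : T -> R) (p Phi : R) :
  1 < p -> measurable D -> measurable_fun setT w -> measurable_fun setT psi ->
  (forall x, 0 <= psi x) -> {ae mu, forall x, ~ D x -> w x = 0} ->
  mu.-integrable setT (EFin \o (fun x => w x * psi x)) ->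
  mu.-integrable setT (EFin \o (fun x => `|w x| `^ p * psi x)) ->
  0 <= Phi -> (\int[mu]_(x in D) (psi x)%:E <= Phi%:E)%E ->
  `|\int[mu]_x (w x * psi x)| `^ p <=
    \int[mu]_x (`|w x| `^ p * psi x) * Phi `^ (p - 1).
Proof.
move=> p1 mD mw mpsi psi0 wD iw iG Phi0 hPhi.
have p0 : 0 < p by exact: lt_trans p1.
have pn0 : p != 0 by rewrite gt_eqF.
have p1n0 : p - 1 != 0 by rewrite subr_eq0 gt_eqF.
pose q := p / (p - 1).
have q0 : 0 < q by rewrite divr_gt0// subr_gt0.
have qV : q^-1 = 1 - p^-1 by rewrite /q invf_div mulrBl divff// mul1r.
clearbody q.
have pq : p^-1 + q^-1 = 1 by rewrite qV addrC subrK.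
pose f x := `|w x| * psi x `^ p^-1.
pose h x := (psi \_ D) x `^ q^-1.
have mpsiD : measurable_fun setT (psi \_ D).
  by apply/(measurable_restrictT _ mD)/measurable_funTS.
have mf : measurable_fun setT f.
  apply: measurable_funM; first exact: measurableT_comp.
  exact: (measurableT_comp (measurable_powR _)).
have mh : measurable_fun setT h by exact: (measurableT_comp (measurable_powR _)).
have hol := hoelder mu mf mh p0 q0 pq.
set G := \int[mu]_x (`|w x| `^ p * psi x).
have G0 : 0 <= G by apply: Rintegral_ge0 => x _; rewrite mulr_ge0 ?powR_ge0.
have Nf : ('N[mu]_p%:E [EFin \o f] = (G `^ p^-1)%:E)%E.
  rewrite unlock /= -poweR_EFin; congr (_ `^ _)%E.
  rewrite /G /Rintegral fineK; last by exact: integrable_fin_num.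
  apply: eq_integral => x _; congr EFin.
  by rewrite ger0_norm ?mulr_ge0 ?powR_ge0// powRM ?powR_ge0// -powRrM mulVf// powRr1.
have Nh : ('N[mu]_q%:E [EFin \o h] <= (Phi `^ q^-1)%:E)%E.
  rewrite unlock /= -poweR_EFin; apply: gt0_ler_poweR; rewrite ?invr_ge0 ?(ltW q0)//.
  - by rewrite in_itv/= leey andbT; apply: integral_ge0 => x _; rewrite lee_fin powR_ge0.
  - by rewrite in_itv/= leey andbT lee_fin.
  apply: le_trans hPhi; rewrite [leRHS]integral_mkcond.
  rewrite le_eqVlt; apply/orP; left; apply/eqP; apply: eq_integral => x _.
  rewrite ger0_norm ?powR_ge0// -powRrM mulVf ?gt_eqF// /h !patchE.
  by case: ifP => _; rewrite powRr1.
have key : `|\int[mu]_x (w x * psi x)| <= G `^ p^-1 * Phi `^ q^-1.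
  rewrite -lee_fin EFin_normr_Rintegral//.
  apply: (le_trans (le_abse_integral mu measurableT (measurable_int _ iw))).
  apply: (@le_trans _ _ ('N[mu]_1 [EFin \o (f \* h)%R])%E).
    rewrite Lnorm1; apply: ae_ge0_le_integral => //=.
    - by apply/measurable_EFinP; apply: measurableT_comp => //; exact: measurable_funM.
    - by apply/measurable_EFinP; apply: measurableT_comp => //; exact: measurable_funM.
    apply: filterS wD => x wD _; rewrite lee_fin.
    have [Dx|nDx] := pselect (D x); last by rewrite wD// mul0r normr0.
    rewrite /f /h patchE mem_set// -mulrA -powRD ?pq ?oner_eq0// powRr1//.
    by rewrite !normrM normr_id.
  apply: (le_trans hol); rewrite Nf [leRHS]EFinM.
  by apply: lee_wpmul2l => //; rewrite lee_fin powR_ge0.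
apply: (@le_trans _ _ ((G `^ p^-1 * Phi `^ q^-1) `^ p)).
  by apply: ge0_ler_powR; rewrite ?nnegrE ?(ltW p0) ?mulr_ge0 ?powR_ge0.
rewrite powRM ?powR_ge0// -!powRrM mulVf// powRr1//.
rewrite le_eqVlt; apply/orP; left; apply/eqP; congr (_ * _ `^ _).
by rewrite qV; field.
Qed.

Section growth.
Context (R : realType) (n : nat) (m : R).
Hypothesis m0 : 0 <= m.

Definition cone_mass (t : R) : R :=
  ball_const R n * Num.sqrt (1 + horizon m t) ^+ n * expR (1 + horizon m t).

(** The weight is [O(t^(- m / 2) expR (- horizon))], because
    [t^m weight^2 <= coweight weight], and the mass of the ball of radius [1 + horizon] is
    [O(horizon^(n / 2) expR horizon)]: the exponentials cancel. *)
Lemma weight_cone_growth : exists2 C : R, 0 < C & forall t, 1 <= t ->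
  weight m t * cone_mass t <= C * t `^ (((m + 1) * n%:R - m) / 2).
Proof.
pose A := coweight m 1 * weight m 1 * expR (2 * horizon m 1).
have A0 : 0 < A by rewrite !mulr_gt0 ?coweight_gt0 ?weight_gt0 ?expR_gt0.
have b0 : 0 < ball_const R n by rewrite /ball_const !mulr_gt0 ?exprn_gt0 ?sqrtr_gt0 ?ltr0n ?fact_gt0.
exists (ball_const R n * Num.sqrt 2 ^+ n * expR 1 * Num.sqrt A).
  by rewrite !mulr_gt0 ?exprn_gt0 ?sqrtr_gt0 ?expR_gt0.
move=> t t1; have t0 : 0 < t by exact: lt_le_trans t1.
set z := horizon m t.
have z0 : 0 <= z by rewrite /z /horizon divr_ge0 ?powR_ge0// addr_ge0.
have w0 := weight_gt0 m0 t.
have h1 : weight m t * expR z <= Num.sqrt A * t `^ (- (m / 2)).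
  rewrite -ler_sqr ?nnegrE ?mulr_ge0 ?sqrtr_ge0 ?powR_ge0 ?expR_ge0 ?(ltW w0)//.
  rewrite !exprMn sqr_sqrtr ?(ltW A0)// -(powR_mulrn 2 (powR_ge0 t _)) -powRrM.
  have -> : - (m / 2) * 2%:R = - m by field.
  rewrite powRN -[leLHS]/(_ * _) ler_pdivlMr ?powR_gt0//.
  have hA := coweight_weight_decay m0 t1.
  have hB := weight_le_coweight m0 t0.
  have e2 : expR z ^+ 2 * expR (- (2 * z)) = 1.
    by rewrite -expRM_natl -expRD mulr_natl addrN expR0.
  have eA : A = A * expR (- (2 * z)) * expR z ^+ 2 by rewrite -mulrA [expR (- _) * _]mulrC e2 mulr1.
  rewrite [leRHS]eA; apply: (@le_trans _ _ (coweight m t * weight m t * expR z ^+ 2)).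
    rewrite (_ : _ * t `^ m = t `^ m * weight m t * weight m t * expR z ^+ 2); last by ring.
    by rewrite ler_wpM2r ?sqr_ge0// ler_wpM2r// ltW.
  by rewrite ler_wpM2r ?sqr_ge0.
have h2 : Num.sqrt (1 + z) ^+ n <= Num.sqrt 2 ^+ n * t `^ ((m + 1) * n%:R / 2).
  pose X := t `^ (m + 1).
  have X1 : 1 <= X.
    have := @ge0_ler_powR R (m + 1) _ 1 t; rewrite !nnegrE powR1; apply => //; last exact: ltW.
    by rewrite addr_ge0.
  have zX : z <= X.
    rewrite /z /horizon ler_pdivrMr ?ltr_wpDl// -[leLHS]mulr1.
    by apply: ler_pM; rewrite ?powR_ge0// lerDr.
  have -> : t `^ ((m + 1) * n%:R / 2) = Num.sqrt X ^+ n.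
    rewrite -powR12_sqrt ?powR_ge0// /X -powRrM -powR_mulrn ?powR_ge0// -powRrM.
    by congr (_ `^ _); field.
  rewrite -exprMn -sqrtrM//; apply: lerXn2r; rewrite ?nnegrE ?sqrtr_ge0//.
  by rewrite ler_wsqrtr//; clearbody X z; lra.
have -> : ((m + 1) * n%:R - m) / 2 = (m + 1) * n%:R / 2 + - (m / 2) by field.
rewrite powRD; last by rewrite (gt_eqF t0) implybT.
rewrite /cone_mass -/z expRD.
have Be : 0 <= ball_const R n * expR 1 by rewrite mulr_ge0 ?expR_ge0 ?(ltW b0).
have wz : 0 <= weight m t * expR z by rewrite mulr_ge0 ?expR_ge0 ?(ltW w0).
have := ler_wpM2l Be (ler_pM wz (exprn_ge0 n (sqrtr_ge0 _)) h1 h2).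
set S := Num.sqrt (1 + z) ^+ n; set S2 := Num.sqrt 2 ^+ n; set SA := Num.sqrt A.
by move=> h; apply: (le_trans _ (le_trans h _));
  rewrite le_eqVlt; apply/orP; left; apply/eqP; ring.
Qed.

End growth.

Section plane_mean.
Context (R : realType) (n : nat) (m : R).
Local Notation E := 'rV[R]_n.+1.
Local Notation mu := (lebesgue_rV R n.+1).
Local Notation s := (1 - (m + 1)^-1).

Definition plane_mean (w : E -> R) : R := \int[mu]_x (w x * plane_exp x).

Lemma pairing_plane_mean (w : E -> R) (r : R) : 1 <= r -> measurable_fun setT w ->
  {ae mu, forall x, 1 < enorm x -> w x = 0} -> pairing r w = plane_mean w.
Proof.
move=> r1 mw w0; apply: eq_ae_Rintegral.
- by apply: measurable_funM => //; exact: measurable_cutoff_exp.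
- by apply: measurable_funM => //; exact: measurable_plane_exp.
apply: filterS w0 => x w0; have [x1|x1] := leP (enorm x) 1; last by rewrite w0// !mul0r.
rewrite cutoff_exp_in//; rewrite enorm_le_eball// in x1; apply: (le_trans x1).
by rewrite expr1n expr_ge1// (le_trans _ r1).
Qed.

Variables (f g : E -> R).
Hypotheses (fs : in_sobolev 1 f) (gs : in_sobolev s g).
Hypotheses (f1 : ess_support mu.-negligible f `<=` [set x | enorm x <= 1]).
Hypotheses (g1 : ess_support mu.-negligible g `<=` [set x | enorm x <= 1]).
Hypothesis fg0 : {ae mu, forall x, 0 <= a_coef m * f x + g x}.
Hypothesis fgn0 : ~ {ae mu, forall x, a_coef m * f x + g x = 0}.

(** The data vanish outside the unit ball, so [a_coef m * f + g] cannot vanish almost everywhere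
    inside it. *)
Lemma data_mean_gt0 : 0 < a_coef m * plane_mean f + plane_mean g.
Proof.
have [mf _ _] := fs; have [mg _ _] := gs.
have f10 := null_off_unit_ball f1; have g10 := null_off_unit_ball g1.
rewrite -(@pairing_plane_mean f 1)// -(@pairing_plane_mean g 1)//.
have i1 := pairing_integrable (@ler01 R) fs.
have i2 := pairing_integrable (@ler01 R) gs.
have i1a : mu.-integrable setT (EFin \o (fun x => a_coef m * (f x * cutoff_exp 1 x))).
  by have := integrable_mulr (a_coef m) measurableT i1; apply: eq_integrable => // x _ /=; rewrite mulrC.
pose F x := `|a_coef m * f x + g x| * cutoff_exp 1 x.
have iF : mu.-integrable setT (EFin \o F).
  have := integrable_norm (integrableD measurableT i1a i2).
  apply: eq_integrable => // x _ /=; rewrite /F mulrA -mulrDl normrM; congr (_ * _)%:E.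
  by rewrite ger0_norm// cutoff_exp_ge0.
have -> : a_coef m * pairing 1 f + pairing 1 g = \int[mu]_x F x.
  rewrite /pairing -RintegralZl// -RintegralD//; apply: eq_ae_Rintegral.
  - apply: measurable_funD; last by apply: measurable_funM => //; exact: measurable_cutoff_exp.
    by apply: measurable_funM => //; apply: measurable_funM => //; exact: measurable_cutoff_exp.
  - by have /measurable_EFinP := measurable_int _ iF.
  by apply: filterS fg0 => x h; rewrite /F ger0_norm//; ring.
apply: gt0_Rintegral => //.
  by move=> x _; rewrite /F mulr_ge0 ?cutoff_exp_ge0.
move=> hF; apply: fgn0; move: hF.
have h : {ae mu, forall x, 1 < enorm x -> a_coef m * f x + g x = 0}.
  by apply: filterS2 f10 g10 => x hf hg x1; rewrite hf// hg// mulr0 addr0.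
apply: filterS2 h => x h /(_ I) hF.
have [x1|x1] := leP (enorm x) 1; last exact: h.
apply/eqP; rewrite -normr_eq0; move/eqP: hF; rewrite /F mulf_eq0 => /orP[//|].
rewrite cutoff_exp_in; last by rewrite -enorm_le_eball.
by rewrite (gt_eqF (plane_exp_gt0 x)).
Qed.

End plane_mean.

Lemma exists_later_time (R : realType) (T : \bar R) (b : R) : (b%:E < T)%E ->
  exists2 c : R, b < c & (c%:E < T)%E.
Proof.
case: T => [T||//]; last by move=> _; exists (b + 1); rewrite ?ltrDl// ltry.
by rewrite lte_fin => bT; exists ((b + T) / 2); rewrite ?lte_fin; lra.
Qed.

Section source_bound.
Context (R : realType) (n : nat) (m p eps : R).
Local Notation E := 'rV[R]_n.+1.
Local Notation mu := (lebesgue_rV R n.+1).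
Local Notation leb := (@lebesgue_measure R).
Local Notation s := (1 - (m + 1)^-1).
Variables (f g : E -> R) (T : \bar R) (u ut : R -> E -> R).
Hypotheses (m0 : 0 <= m) (p1 : 1 < p) (sol : energy_solution_with m p eps f g T u ut).
Hypotheses (hs : solution_support T u `<=` cone m T).
Hypotheses (f1 : ess_support mu.-negligible f `<=` [set x | enorm x <= 1]).
Hypotheses (g1 : ess_support mu.-negligible g `<=` [set x | enorm x <= 1]).
Variable tau : R.
Hypotheses (tau0 : 0 < tau) (tauT : (tau%:E < T)%E).
Local Notation r := (2 + horizon m tau).
Local Notation chi := (@cutoff_exp R n r).
Local Notation U := (pair_ut m ut tau).
Local Notation G := (source p ut r).

Let horizon_ge0 t : 0 <= horizon m t.
Proof. by rewrite /horizon divr_ge0 ?powR_ge0// addr_ge0. Qed.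

Let r0 : 0 <= r. Proof. by rewrite addr_ge0. Qed.

Lemma cone_mass_ge0 t : 0 <= cone_mass n m t.
Proof.
by rewrite /cone_mass /ball_const !mulr_ge0 ?exprn_ge0 ?sqrtr_ge0 ?expR_ge0.
Qed.

Lemma source_lower_bound : {ae leb, forall t : R, 0 < t -> t <= tau ->
  (weight m t * `|U t|) `^ p <= weight m t * G t * (weight m t * cone_mass n m t) `^ (p - 1)}.
Proof.
have [tau' tt' t'T] := exists_later_time tauT.
have d0 : 0 < tau' - tau by rewrite subr_gt0.
have adT : ((tau + (tau' - tau))%:E < T)%E by rewrite addrC subrK.
have [B [mB B0 hB]] := ae_source_integrable m0 sol r0 (ltW tau0) d0 adT.
suff key (t : R) : 0 < t -> t <= tau ->
    mu.-integrable setT (EFin \o (fun x => `|ut t x| `^ p * chi x)) ->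
    (weight m t * `|U t|) `^ p <= weight m t * G t * (weight m t * cone_mass n m t) `^ (p - 1).
  exists B; split => //; apply: subset_trans hB; apply: subsetC => t /= it t0 tt.
  by apply: key => //; exact: it.
move=> t0 tt it.
have tT : time T t.
  by split; [exact: ltW|apply: le_lt_trans tauT; rewrite lee_fin].
have iut := (energy_cont_t sol).1 _ tT.
have [mut _ _] := iut.
have w0 := weight_gt0 m0 t.
have r10 : 0 < 1 + horizon m t by rewrite ltr_wpDr.
have hD : (\int[mu]_(x in @eball R n (1 + horizon m t)) (chi x)%:E <= (cone_mass n m t)%:E)%E.
  apply: le_trans (plane_exp_ball n r10).
  apply: ge0_le_integral => //.
  - exact: measurable_eball.
  - by move=> x _; rewrite lee_fin cutoff_exp_ge0.
  - by apply/measurable_EFinP/measurable_funTS; exact: measurable_cutoff_exp.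
  - by apply/measurable_EFinP/measurable_funTS; exact: measurable_plane_exp.
  - by move=> x _; rewrite lee_fin cutoff_exp_le.
have wD : {ae mu, forall x, ~ @eball R n (1 + horizon m t) x -> ut t x = 0}.
  apply: filterS (solution_t_off_cone m0 sol hs f1 g1 tT) => x h nb; apply: h.
  by rewrite ltNge enorm_le_eball ?(ltW r10)//; apply/negP.
have h := holder_weighted p1 (measurable_eball _) mut (@measurable_cutoff_exp R n r)
  (cutoff_exp_ge0 r) wD (pairing_integrable r0 iut) it (cone_mass_ge0 t) hD.
rewrite powRM ?(ltW w0)// (powRM _ (ltW w0) (cone_mass_ge0 t)).
have -> : weight m t `^ p = weight m t * weight m t `^ (p - 1).
  rewrite -{2}(powRr1 (ltW w0)) -powRD; last by rewrite (gt_eqF w0) implybT.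
  by rewrite addrC subrK.
rewrite -[leLHS]mulrA -[leRHS]mulrA ler_pM2l// mulrCA ler_wpM2l ?powR_ge0//.
Qed.

End source_bound.

(** * Blow-up *)

Section blowup_time_bound.
Context (R : realType) (n : nat) (m p : R).
Local Notation E := 'rV[R]_n.+1.
Local Notation mu := (lebesgue_rV R n.+1).
Local Notation leb := (@lebesgue_measure R).
Local Notation s := (1 - (m + 1)^-1).
Variables (f g : E -> R).
Hypotheses (m0 : 0 <= m) (p1 : 1 < p).
Hypotheses (fs : in_sobolev 1 f) (gs : in_sobolev s g).
Hypotheses (f1 : ess_support mu.-negligible f `<=` [set x | enorm x <= 1]).
Hypotheses (g1 : ess_support mu.-negligible g `<=` [set x | enorm x <= 1]).
Local Notation I0 := (a_coef m * plane_mean f + plane_mean g).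
Hypothesis I0_gt0 : 0 < I0.

Section one_solution.
Variables (eps : R) (T : \bar R) (u ut : R -> E -> R).
Hypotheses (sol : energy_solution_with m p eps f g T u ut).
Hypotheses (hs : solution_support T u `<=` cone m T).
Variable tau : R.
Hypotheses (tau0 : 0 < tau) (tauT : (tau%:E < T)%E).
Local Notation r := (2 + horizon m tau).
Local Notation U := (pair_ut m ut tau).
Local Notation V := (pair_u m u tau).
Local Notation G := (source p ut r).
Local Notation W := (energy_functional m u ut tau).

Let r1 : 1 <= r.
Proof.
have : 0 <= horizon m tau by rewrite /horizon divr_ge0 ?powR_ge0// addr_ge0.
by lra.
Qed.

Lemma initial_energyE : initial_energy m eps f g tau = eps * weight m 0 * I0.
Proof.
have [mf _ _] := fs; have [mg _ _] := gs.
rewrite /initial_energy !pairing_plane_mean//; exact: null_off_unit_ball.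
Qed.

Lemma initial_pair_u : V 0 = eps * plane_mean f.
Proof.
have [mf _ _] := fs.
rewrite (pair_u0 m0 sol fs tau0 tauT) pairing_plane_mean//; exact: null_off_unit_ball.
Qed.

Let wG0 t : 0 <= weight m t * G t.
Proof. by rewrite mulr_ge0 ?source_ge0// ltW// weight_gt0. Qed.

Let balance c : 0 < c -> c < tau ->
  leb.-integrable `]0, c] (EFin \o (fun t => weight m t * G t)) /\
  W c = eps * weight m 0 * I0 + \int[leb]_(t in `]0, c]) (weight m t * G t).
Proof.
move=> c0 ct; rewrite -initial_energyE.
exact: (energy_balance m0 sol hs fs gs f1 tau0 tauT c0 ct).
Qed.

Lemma energy_functional_ge c : 0 < c -> c < tau -> eps * weight m 0 * I0 <= W c.
Proof.
move=> c0 ct; have [_ ->] := balance c0 ct.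
by rewrite lerDl; apply: Rintegral_ge0.
Qed.

Lemma energy_functional_increment a b : 0 < a -> a <= b -> b < tau ->
  W b - W a = \int[leb]_(t in `]a, b]) (weight m t * G t).
Proof.
move=> a0 ab bt.
have [ib ->] := balance (lt_le_trans a0 ab) bt.
have [_ ->] := balance a0 (le_lt_trans ab bt).
rewrite opprD addrACA subrr add0r Rintegral_itvB ?bnd_simp//.
exact: ltW.
Qed.

Lemma energy_functional_le a b : 0 < a -> a <= b -> b < tau -> W a <= W b.
Proof.
move=> a0 ab bt; rewrite -subr_ge0 energy_functional_increment//.
by apply: Rintegral_ge0.
Qed.

Lemma pair_u_cvg0 : V t @[t --> 0^'+] --> V 0.
Proof.
have c : {within `[0, tau], continuous V}.
  apply: (@continuous_subspaceW _ _ _ (time T)).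
    move=> t /=; rewrite in_itv/= => /andP[t0 tt]; split => //.
    by apply: le_lt_trans tauT; rewrite lee_fin.
  exact: (sobolev_pairing_continuous m0 (energy_cont sol)).
by have /continuous_within_itvP [] := c.
Qed.

End one_solution.

(** The energy functional [W] satisfies [W' >= c t^(- kappa (p - 1) / 2) W^p] in integrated form, with
    [kappa = (m + 1) n - m], from the time [t0] on; and [W] exceeds a multiple of [eps]. The primitive
    [K] is a power or a logarithm according to whether [p] is subcritical or critical. *)
Lemma blowup_time_bound : exists2 t0 : R, 1 <= t0 & exists2 c : R, 0 < c &
  forall (eps : R) (T : \bar R) u ut, 0 < eps ->
  energy_solution_with m p eps f g T u ut -> solution_support T u `<=` cone m T ->
  forall (b : R) (K : R -> R), t0 < b -> (b%:E < T)%E ->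
  (forall t : R, 0 < t -> is_derive t 1 K (t `^ (- (((m + 1) * n%:R - m) * (p - 1) / 2)))) ->
  K b - K t0 <= c * eps `^ (1 - p).
Proof.
pose w0 := weight m 0.
have w00 : 0 < w0 by exact: weight_gt0.
have p0 : 0 < p by exact: lt_trans p1.
pose C1 := `|plane_mean f| / (w0 * I0).
have C10 : 0 <= C1 by rewrite divr_ge0// ltW// mulr_gt0.
have [t0 t01 [d d0 hd]] := weight_velocity_lower_bound m0 C10.
have [C C0 hC] := weight_cone_growth n m0.
pose c0 := d `^ p * C `^ (1 - p).
have c00 : 0 < c0 by rewrite mulr_gt0 ?powR_gt0.
exists t0 => //; exists ((w0 * I0) `^ (1 - p) / (p - 1) / c0).
  by rewrite !divr_gt0 ?subr_gt0 ?powR_gt0// mulr_gt0.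
move=> eps T u ut eps0 sol hs b K t0b bT dK.
have [tau btau tauT] := exists_later_time bT.
have t00 : 0 < t0 by exact: lt_le_trans t01.
have tau0 : 0 < tau by apply: lt_trans btau; exact: lt_trans t0b.
pose W := energy_functional m u ut tau.
pose U := pair_ut m ut tau.
pose V := pair_u m u tau.
pose G := source p ut (2 + horizon m tau).
have W1 t : 0 < t -> t < tau -> eps * w0 * I0 <= W t.
  by move=> tt0 tt; exact: (energy_functional_ge sol hs tau0 tauT tt0 tt).
have W00 : 0 < eps * w0 * I0 by rewrite !mulr_gt0.
have W0 t : 0 < t -> t < tau -> 0 < W t.
  by move=> tt0 tt; exact: lt_le_trans (W1 t tt0 tt).
have tT t : t <= tau -> (t%:E < T)%E by move=> h; apply: le_lt_trans tauT; rewrite lee_fin.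
have hU t : t0 <= t -> t < tau -> d * W t <= weight m t * U t.
  apply: (hd U V tau).
  - by move=> t' t'0 t't; apply: (is_derive_pair_u m0 sol) => //; apply: tT; exact: ltW.
  - exact: (pair_u_cvg0 sol tau0 tauT).
  - move=> a c a0 ac ct; exact: (energy_functional_le sol hs tau0 tauT a0 ac ct).
  move=> t' t'0 t't; split; first exact: W0.
  rewrite /V (initial_pair_u sol tau0 tauT).
  apply: (@le_trans _ _ (C1 * (eps * w0 * I0))); last by rewrite ler_wpM2l// W1.
  rewrite (_ : C1 * _ = eps * `|plane_mean f|); first by rewrite ler_pM2l// ler_norm.
  by rewrite /C1; field; rewrite !gt_eqF.
(* The exponent that [weight_cone_growth] and Hoelder's inequality produce. *)
pose al := ((m + 1) * n%:R - m) * (p - 1) / 2.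
pose k t := c0 * t `^ (- al).
have hG : {ae leb, forall t : R, t0 < t -> t < tau -> k t * W t `^ p <= weight m t * G t}.
  have [B [mB B0 hB]] := source_lower_bound m0 p1 sol hs f1 g1 tau0 tauT.
  exists B; split => //; apply: subset_trans hB; apply: subsetC => t /= ht t0t tt.
  have tt0 : 0 < t by exact: lt_trans t0t.
  have t1 : 1 <= t by apply: (le_trans t01); exact: ltW.
  have Wt := W0 t tt0 tt.
  have hUt := hU t (ltW t0t) tt.
  have wt := weight_gt0 m0 t.
  have Ut : 0 < U t.
    by rewrite -(pmulr_rgt0 _ wt); apply: lt_le_trans hUt; rewrite mulr_gt0.
  have G0 : 0 <= weight m t * G t by rewrite mulr_ge0 ?source_ge0 ?(ltW wt).
  pose X := C * t `^ (((m + 1) * n%:R - m) / 2).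
  have X0 : 0 < X by rewrite mulr_gt0 ?powR_gt0.
  have kX : k t = d `^ p * X `^ (1 - p).
    rewrite /k /c0 /X powRM ?powR_ge0 ?(ltW C0)// -powRrM mulrA; congr (_ * _ * _ `^ _).
    by rewrite /al; field.
  have h1 : (d * W t) `^ p <= weight m t * G t * X `^ (p - 1).
    apply: (@le_trans _ _ ((weight m t * `|U t|) `^ p)).
      rewrite gtr0_norm//; apply: ge0_ler_powR; rewrite ?nnegrE ?(ltW p0)//.
        by rewrite mulr_ge0 ?(ltW d0) ?(ltW Wt).
      by rewrite mulr_ge0 ?(ltW Ut) ?(ltW wt).
    apply: (le_trans (ht tt0 (ltW tt))); apply: ler_wpM2l => //.
    apply: ge0_ler_powR; rewrite ?nnegrE ?subr_ge0 ?(ltW p1) ?(ltW X0)//.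
      by rewrite mulr_ge0 ?cone_mass_ge0 ?(ltW wt).
    exact: hC.
  rewrite powRM ?(ltW d0) ?(ltW Wt)// in h1.
  rewrite kX -[1 - p]opprB powRN mulrAC ler_pdivrMr ?powR_gt0//.
have itv0 t : `[t0, b]%classic t -> 0 < t.
  by rewrite /= in_itv/= => /andP[h _]; exact: lt_le_trans h.
have cW : {within `[t0, b], continuous W}.
  apply: (@continuous_subspaceW _ _ _ (time T)).
    move=> t ht; split; first exact/ltW/itv0.
    by move: ht; rewrite /= in_itv/= => /andP[_ tb]; apply: le_lt_trans bT; rewrite lee_fin.
  exact: (energy_functional_continuous m0 sol).
have ck : {within `[t0, b], continuous k}.
  apply: within_continuousW => t ht.
  by apply: (@continuousM _ _ (cst c0)); [exact: cst_continuous|exact: powR_continuous_pos (itv0 t ht)].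
have cK : {within `[t0, b], continuous (fun t => c0 * K t)}.
  apply: within_continuousW => t ht.
  by apply: (@continuousM _ _ (cst c0)); [exact: cst_continuous|exact: is_derive_continuous (dK t (itv0 t ht))].
have cF : {within `[t0, b], continuous (fun t => k t * W t `^ p)}.
  apply/subspace_continuousP => t ht; apply: cvgM; first exact: (subspace_continuousP _ _).1 ck t ht.
  have Wt : 0 < W t.
    apply: W0; first exact: itv0.
    by move: ht; rewrite /= in_itv/= => /andP[_ tb]; exact: le_lt_trans btau.
  apply: (@cvg_comp _ _ _ W (fun y => y `^ p) _ (nbhs (W t))).
    by move/subspace_continuousP : cW; exact.
  exact: powR_continuous_pos Wt.
have dcK t : t0 < t -> t < b -> is_derive t 1 (fun t => c0 * K t) (k t).
  by move=> tt0 tb; apply: is_derive1Ml; apply: dK; exact: lt_trans tt0.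
have blow : c0 * K b - c0 * K t0 <= W t0 `^ (1 - p) / (p - 1).
  apply: (@blowup_integral_inequality R W k (fun t => c0 * K t)) => //.
  - by move=> t tt0 tb; apply: W0; [exact: lt_le_trans tt0|exact: le_lt_trans btau].
  - by move=> t _ _; rewrite mulr_ge0 ?powR_ge0// ltW.
  move=> t t0t tb.
  have ttau : t < tau by exact: le_lt_trans btau.
  have iF : leb.-integrable `]t0, t] (EFin \o (fun t => k t * W t `^ p)).
    have ib : leb.-integrable `[t0, b] (EFin \o (fun t => k t * W t `^ p)).
      by apply: continuous_compact_integrable => //; exact: segment_compact.
    apply: integrableS ib => // t' /=; rewrite !in_itv/= => /andP[h1 h2].
    by rewrite (ltW h1) (le_trans h2).
  have iG : leb.-integrable `]t0, t] (EFin \o (fun t => weight m t * G t)).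
    have [i _] := energy_balance m0 sol hs fs gs f1 tau0 tauT (lt_trans t00 t0t) ttau.
    apply: integrableS i => // t' /=; rewrite !in_itv/= => /andP[h1 ->].
    by rewrite (lt_trans t00).
  rewrite -(Rintegral_itv_obnd_cbnd iF) (energy_functional_increment sol hs tau0 tauT t00 (ltW t0t) ttau).
  apply: fine_le; rewrite ?integrable_fin_num//.
  apply: ae_ge0_le_integral => //.
  - by move=> t' _; rewrite lee_fin mulr_ge0 ?powR_ge0// mulr_ge0 ?powR_ge0// ltW.
  - exact: measurable_int iF.
  - by move=> t' _; rewrite lee_fin mulr_ge0 ?source_ge0// ltW// weight_gt0.
  - exact: measurable_int iG.
  have [B [mB B0 hB]] := hG.
  exists B; split => //; apply: subset_trans hB; apply: subsetC => t' /= ht.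
  rewrite in_itv/= => /andP[h1 h2]; rewrite lee_fin; apply: ht => //.
  exact: le_lt_trans ttau.
rewrite mulrAC ler_pdivlMr// mulrC mulrBr.
apply: (le_trans blow); rewrite [leRHS]mulrAC ler_pM2r ?invr_gt0 ?subr_gt0//.
rewrite -powRM ?(ltW eps0) ?mulr_ge0 ?(ltW w00) ?(ltW I0_gt0)//.
have X0 : 0 < w0 * I0 * eps by rewrite !mulr_gt0.
have XW : w0 * I0 * eps <= W t0 by rewrite mulrC mulrA; exact: W1 t00 (lt_trans t0b btau).
have Wt0 := lt_le_trans X0 XW.
rewrite -[1 - p]opprB !powRN lef_pV2 ?posrE ?(powR_gt0 _ X0) ?(powR_gt0 _ Wt0)//.
by apply: ge0_ler_powR => //; rewrite ?nnegrE ?subr_ge0 ltW.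
Qed.

End blowup_time_bound.

(** * The lifespan *)

Lemma lee_of_real_lower_bounds (R : realType) (T : \bar R) (B : R) :
  (forall b : R, (b%:E < T)%E -> b <= B) -> (T <= B%:E)%E.
Proof.
move=> h; rewrite leNgt; apply/negP => /exists_later_time[c Bc cT].
by have := lt_le_trans Bc (h c cT); rewrite ltxx.
Qed.

Lemma powR_ge1_of_le1 (R : realType) (e q : R) : 0 < e -> e <= 1 -> 0 <= q -> 1 <= e `^ (- q).
Proof.
move=> e0 e1 q0; rewrite powRN invf_ge1 ?powR_gt0//.
have := @ge0_ler_powR R q q0 e 1; rewrite !nnegrE powR1; apply => //.
exact: ltW.
Qed.

Lemma lt_p_T_gamma_T (R : realType) (n : nat) (m p : R) : 0 <= m -> 1 < p ->
  (p%:E < p_T n.+1 m)%E -> 0 < gamma_T n.+1 m p.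
Proof.
move=> m0 p1; rewrite /p_T /gamma_T; case: ifPn => [n1 _|].
  move: n1; rewrite ltnS leqn0 => /eqP ->.
  have : 0 <= m * (p - 1) by rewrite mulr_ge0// subr_ge0 ltW.
  by rewrite subrr mulr0 sub0r => h; lra.
rewrite -ltnNge ltnS => n1; rewrite lte_fin.
set k := (m + 1) * (n.+1%:R - 1) - m.
have k0 : 0 < k.
  have n1R : 1 <= n%:R :> R by rewrite ler1n.
  by rewrite /k -natr1 addrK; nra.
by rewrite -ltrBlDl ltr_pdivlMr// mulrC subr_gt0.
Qed.

Lemma eq_p_T_gamma_T (R : realType) (n : nat) (m p : R) : 0 <= m -> 1 < p ->
  p%:E = p_T n.+1 m -> gamma_T n.+1 m p = 0.
Proof.
move=> m0 p1; rewrite /p_T /gamma_T; case: ifPn => [//|].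
rewrite -ltnNge ltnS => n1 [].
set k := (m + 1) * (n.+1%:R - 1) - m.
have k0 : 0 < k.
  have n1R : 1 <= n%:R :> R by rewrite ler1n.
  by rewrite /k -natr1 addrK; nra.
by move=> ->; field; rewrite gt_eqF.
Qed.

Theorem theorem1 (R : realType) (n : nat) (m p : R) (f g : 'rV[R]_n -> R) :
  (1 <= n)%N -> 0 <= m -> 1 < p -> (p%:E <= p_T n m)%E ->
  in_sobolev 1 f -> in_sobolev (1 - (m + 1)^-1) g ->
  ess_support (lebesgue_rV R n).-negligible f
    `|` ess_support (lebesgue_rV R n).-negligible g
    `<=` [set x | enorm x <= 1] ->
  {ae lebesgue_rV R n, forall x, 0 <= a_coef m * f x + g x} ->
  ~ {ae lebesgue_rV R n, forall x, a_coef m * f x + g x = 0} ->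
  exists2 eps0 : R, 0 < eps0 &
  exists2 C : R, 0 < C &
  forall eps : R, 0 < eps -> eps <= eps0 ->
  forall (T : \bar R) (u : R -> 'rV[R]_n -> R), (0 < T)%E ->
  energy_solution m p eps f g T u ->
  solution_support T u `<=` cone m T ->
  ((p%:E < p_T n m)%E ->
     (lifespan m p eps f g
        <= (C * eps `^ (- (2 * (p - 1) / gamma_T n m p)))%:E)%E) /\
  (p%:E = p_T n m ->
     (lifespan m p eps f g <= (expR (C * eps `^ (- (p - 1))))%:E)%E).
Proof.
case: n f g => [//|n] f g _ m0 p1 _ fs gs fg1 fg0 fgn0.
have f1 : ess_support (lebesgue_rV R n.+1).-negligible f `<=` [set x | enorm x <= 1].
  by move=> x hx; apply: fg1; left.
have g1 : ess_support (lebesgue_rV R n.+1).-negligible g `<=` [set x | enorm x <= 1].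
  by move=> x hx; apply: fg1; right.
have I0 := data_mean_gt0 fs gs f1 g1 fg0 fgn0.
have [t0 t01 [c c0 bound]] := blowup_time_bound m0 p1 fs gs f1 g1 I0.
have t00 : 0 < t0 by exact: lt_le_trans t01.
pose ga := gamma_T n.+1 m p.
have alE : - (((m + 1) * n%:R - m) * (p - 1) / 2) = ga / 2 - 1.
  have n1 : n.+1%:R - 1 = n%:R :> R by rewrite -natr1 addrK.
  by rewrite /ga /gamma_T n1; field.
(* Chosen so that [t0] itself, where the estimate starts, obeys the bound for [eps <= 1]. *)
pose M := t0 `^ (ga / 2) + c * (ga / 2).
have lnt0 : 0 <= ln t0 by rewrite ln_ge0.
exists 1 => //; exists (M `^ (2 / ga) + (ln t0 + c)).
  by rewrite ltr_wpDl ?powR_ge0// ltr_wpDl.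
move=> eps eps0 eps1 _ _ _ _ _.
have p10 : 0 <= p - 1 by rewrite subr_ge0 ltW.
have e1 : 1 <= eps `^ (- (p - 1)) by exact: powR_ge1_of_le1.
have e0 : 0 <= eps `^ (- (p - 1)) by exact: powR_ge0.
split => hp.
  have ga0 : 0 < ga by exact: lt_p_T_gamma_T.
  have ga2 : 0 < ga / 2 by rewrite divr_gt0.
  have M0 : 0 < M by rewrite ltr_wpDl ?powR_ge0// mulr_gt0.
  apply: ge_ereal_sup => T' [T'0 [u [[ut sol] hs]]].
  apply: lee_of_real_lower_bounds => b bT.
  have [b0|b0] := leP b 0.
    by apply: (le_trans b0); rewrite mulr_ge0 ?powR_ge0// !addr_ge0 ?powR_ge0 ?(ltW c0)//.
  apply: (@le_trans _ _ (M `^ (2 / ga) * eps `^ (- (2 * (p - 1) / ga)))); last first.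
    by rewrite ler_wpM2r ?powR_ge0// lerDl addr_ge0 ?(ltW c0)//.
  have -> : M `^ (2 / ga) * eps `^ (- (2 * (p - 1) / ga)) =
      (M * eps `^ (- (p - 1))) `^ (2 / ga).
    rewrite powRM ?powR_ge0 ?(ltW M0)// -powRrM; congr (_ * _ `^ _).
    by field; rewrite gt_eqF.
  have -> : b = (b `^ (ga / 2)) `^ (2 / ga).
    rewrite -powRrM (_ : _ * _ = 1) ?powRr1// ?ltW//.
    by field; rewrite gt_eqF.
  apply: ge0_ler_powR; rewrite ?nnegrE ?powR_ge0 ?mulr_ge0 ?(ltW M0) ?invr_ge0 ?(ltW ga0)//.
  have tM : t0 `^ (ga / 2) <= M * eps `^ (- (p - 1)).
    rewrite -[leLHS]mulr1; apply: ler_pM; rewrite ?powR_ge0//.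
    by rewrite /M lerDl mulr_ge0 ?ltW.
  have [bt|tb] := leP b t0.
    apply: le_trans tM; apply: ge0_ler_powR; rewrite ?nnegrE ?(ltW ga2) ?(ltW b0) ?(ltW t00)//.
  pose K (t : R) := t `^ (ga / 2) / (ga / 2).
  have dK (t : R) : 0 < t -> is_derive t 1 K (t `^ (- (((m + 1) * n%:R - m) * (p - 1) / 2))).
    move=> s0; rewrite alE.
    have h := is_derive1Ml (ga / 2)^-1 (is_derive_powR_pos (ga / 2) s0).
    rewrite (_ : K = fun t => (ga / 2)^-1 * t `^ (ga / 2)); last first.
      by apply/funext => y; rewrite /K mulrC.
    by apply: (is_derive_eq h); rewrite mulrA mulVf ?mul1r// gt_eqF.
  have := bound eps T' u ut eps0 sol hs b K tb bT dK.
  rewrite -[1 - p]opprB /K -mulrBl ler_pdivrMr// => h.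
  apply: (@le_trans _ _ (t0 `^ (ga / 2) * 1 + c * eps `^ (- (p - 1)) * (ga / 2))).
    by rewrite mulr1 addrC -lerBlDr.
  rewrite /M [leRHS]mulrDl; apply: lerD; first by rewrite ler_wpM2l ?powR_ge0.
  by rewrite mulrAC.
have ga0 : ga = 0 by exact: eq_p_T_gamma_T.
apply: ge_ereal_sup => T' [T'0 [u [[ut sol] hs]]].
apply: lee_of_real_lower_bounds => b bT.
have [b0|b0] := leP b 0; first by apply: (le_trans b0); exact: expR_ge0.
rewrite -[leLHS]lnK ?posrE// ler_expR.
apply: (@le_trans _ _ ((ln t0 + c) * eps `^ (- (p - 1)))); last first.
  by rewrite ler_wpM2r// lerDr powR_ge0.
have [bt|tb] := leP b t0.
  apply: (@le_trans _ _ (ln t0)); first by rewrite ler_ln ?posrE.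
  rewrite -[leLHS]mulr1; apply: ler_pM => //.
  by rewrite lerDl ltW.
have dK (t : R) : 0 < t -> is_derive t 1 (@ln R) (t `^ (- (((m + 1) * n%:R - m) * (p - 1) / 2))).
  move=> s0; rewrite alE ga0 mul0r sub0r powR_inv1 ?(ltW s0)//.
  exact: is_derive1_ln.
have := bound eps T' u ut eps0 sol hs b (@ln R) tb bT dK.
rewrite -[1 - p]opprB lerBlDr => h; apply: (le_trans h).
rewrite [leRHS]mulrDl addrC lerD2r -[leLHS]mulr1.
by rewrite ler_wpM2l.
Qed.
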